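(* There is a well-defined map $$\jmath\colon\mathscr{C}_{\mathrm{lin}}^{\mathrm{reg}}(A)\to\mathscr{C}_{\mathrm{anis}}(A)$$ given by taking $\hat\nabla$ to $\jmath_N(\hat\nabla)$ (the horizontal part of $\hat\nabla$ according to $N$), where $N$ is the nonlinear connection induced by $\hat\nabla$, $N^a_i=B^a_b(\hat\Gamma^1)^b_{ic}y^c$. (I.e., if $\hat\nabla$ has coefficients $(\hat\Gamma^1)^i_{jk},(\hat\Gamma^2)^i_{jk}$, then $\jmath(\hat\nabla)=\Gamma$ with $$\Gamma^i_{jk}=(\hat\Gamma^1)^i_{jk}-B^b_a(\hat\Gamma^1)^a_{jc}y^c(\hat\Gamma^2)^i_{bk},$$ where $(B^i_j)$ is the inverse matrix of $(\delta^i_j+(\hat\Gamma^2)^i_{jc}y^c)$.) Moreover: (i) It holds that $\mathrm{Img}(\varrho)\subset\mathscr{C}_{\mathrm{lin}}^{\mathrm{reg}}(A)$ and $\jmath\circ\varrho=\mathrm{Id}_{\mathscr{C}_{\mathrm{anis}}(A)}$, so $\jmath$ is surjective. (ii) There is a bijective correspondence $$\mathscr{C}_{\mathrm{lin}}^{\mathrm{reg}}(A)\equiv\mathscr{C}_{\mathrm{anis}}(A)\times\{\Delta\in\mathrm{h}_{-1}\mathcal{T}^1_2(M_A):(\delta^i_j+\Delta^i_{jc}y^c)\text{ invertible everywhere}\},\qquad\hat\nabla\equiv(\Gamma,\Delta).$$ To be precise, from left to right, $\Gamma=\jmath(\hat\nabla)$ and $\Delta$ is the vertical part of $\hat\nabla$,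 $\Delta^i_{jk}=(\hat\Gamma^2)^i_{jk}$; whereas from right to left, $\hat\nabla$ is the linear connection corresponding to $(\Gamma,\Delta)$ under the identification $\mathscr{C}_{\mathrm{lin}}(A)\equiv\mathscr{C}_{\mathrm{anis}}(A)\times\mathrm{h}_{-1}\mathcal{T}^1_2(M_A)$ determined by the nonlinear connection $N=\imath^{\mathrm{nl}}(\Gamma)$, i.e. $N^i_j=\Gamma^i_{jc}y^c$.
   Context: $M$ is a smooth (Hausdorff, second countable) $n$-dimensional manifold and $A\subseteq \mathrm{T}M\setminus\mathbf{0}$ is open with every fiber $A_p:=A\cap \mathrm{T}_pM$ ($p\in M$) nonempty and conic (closed under multiplication by $\lambda\in\mathbb{R}^+=(0,\infty)$). $\pi_A\colon A\to M$ is the natural projection and $h_\lambda\colon A\to A$, $h_\lambda(v)=\lambda v$. All objects are smooth ($\mathcal{C}^\infty$). $\mathcal{T}^r_s(M_A)$ is the set of sections of $\pi_A^*(\mathrm{T}M^{\otimes r}\otimes\mathrm{T}^*M^{\otimes s})\to A$; $\mathrm{h}_\alpha\mathcal{T}^r_s(M_A)$ those whose components in natural coordinates $(x^i,y^i)$ of $\mathrm{T}M$ satisfy $T(x,\lambda y)=\lambda^\alpha T(x,y)$ for $\lambda\in\mathbb{R}^+$. $\mathbb{C}=y^i\partial_{x^i}\in\mathcal{T}^1_0(M_A)$ is the Liouville field. The vertical bundle $\mathrm{V}A\subset \mathrm{T}A$ is identified with $\pi_A^*(\mathrm{T}M)$ ($\partial_{y^i}\equiv\partial_{x^i}$). A vector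 field $\mathcal{X}=\mathcal{X}_1^i\partial_{x^i}+\mathcal{X}_2^i\partial_{y^i}$ on $A$ is homogeneous of degree $\alpha$ if $\mathcal{X}_{\lambda v}=\lambda^\alpha\,\mathrm{d}(h_\lambda)_v(\mathcal{X}_v)$, i.e. $\mathcal{X}_1^i$ is $\alpha$-homogeneous and $\mathcal{X}_2^i$ is $(\alpha+1)$-homogeneous; $\mathrm{h}_\alpha\mathfrak{X}(A)$ is the set of these. $\mathscr{C}_{\mathrm{nl}}(A)$: ($1$-homogeneous) nonlinear connections, i.e. assignments $v\in A\mapsto N_v\in\mathrm{Hom}(\mathrm{T}_{\pi(v)}M,\mathrm{T}_vA)$ with $\mathrm{d}(\pi_A)_v\circ N_v=\mathrm{Id}$ and $N_{\lambda v}=\mathrm{d}(h_\lambda)_v\circ N_v$; locally $N=(\delta^i_j\partial_{x^i}-N^i_j\partial_{y^i})\otimes\mathrm{d}x^j$. Equivalent to the horizontal bundle $\mathrm{H}A\subset\mathrm{T}A$ spanned by $\delta_{x^i}:=\partial_{x^i}-N^a_i\partial_{y^a}$. $\mathscr{C}_{\mathrm{anis}}(A)$: ($0$-homogeneous) anisotropic connections, i.e. sections of $\pi_A^*(\mathrm{C}M)\to A$ invariant under $v\mapsto\lambda v$, where $\mathrm{C}M\to M$ is the bundle whose sections are the affine connections on $M$; locally given by $0$-homogeneous functions $\Gamma^i_{jk}$ on $A\cap\mathrm{T}U$ transforming as classical Christoffel symbols. The map $\imath^{\mathrm{nl}}\colon\mathscr{C}_{\mathrm{anis}}(A)\to\mathscr{C}_{\mathrm{nl}}(A)$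 takes $\Gamma$ to the nonlinear connection with components $N^i_j=\Gamma^i_{ja}y^a$. $\mathscr{C}_{\mathrm{lin}}(A)$: homogeneous linear connections $\hat\nabla$ on the vector bundle $\pi_A^*(\mathrm{T}M)\to A$, i.e. Koszul connections $\hat\nabla\colon\mathfrak{X}(A)\times\mathcal{T}^1_0(M_A)\to\mathcal{T}^1_0(M_A)$ restricting to $\mathrm{h}_\alpha\mathfrak{X}(A)\times\mathrm{h}_\beta\mathcal{T}^1_0(M_A)\to\mathrm{h}_{\alpha+\beta}\mathcal{T}^1_0(M_A)$ for all $\alpha,\beta\in\mathbb{R}$. Coefficients: $(\hat\Gamma^1)^i_{jk}\partial_{x^i}:=\hat\nabla_{\partial_{x^j}}\partial_{x^k}$, $(\hat\Gamma^2)^i_{jk}\partial_{x^i}:=\hat\nabla_{\partial_{y^j}}\partial_{x^k}$. Given $N\in\mathscr{C}_{\mathrm{nl}}(A)$, there is an identification $\mathscr{C}_{\mathrm{lin}}(A)\equiv\mathscr{C}_{\mathrm{anis}}(A)\times\mathrm{h}_{-1}\mathcal{T}^1_2(M_A)$, $\hat\nabla\equiv(\Gamma,\Delta)$, with $\Gamma^i_{jk}\partial_{x^i}:=\hat\nabla_{\delta_{x^j}}\partial_{x^k}$ (horizontal part of $\hat\nabla$ according to $N$) and $\Delta^i_{jk}\partial_{x^i}:=\hat\nabla_{\partial_{y^j}}\partial_{x^k}$ (vertical part, independent of $N$); thus $\Gamma^i_{jk}=(\hat\Gamma^1)^i_{jk}-N^b_j\Delta^i_{bk}$. Put $\jmath_N(\hat\nabla):=\Gamma$.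 The map $\varrho\colon\mathscr{C}_{\mathrm{anis}}(A)\to\mathscr{C}_{\mathrm{lin}}(A)$ takes $\Gamma$ to the $\hat\nabla$ corresponding to $(\Gamma,0)$ (independent of $N$), i.e. $(\hat\Gamma^1)^i_{jk}=\Gamma^i_{jk}$ and $(\hat\Gamma^2)^i_{jk}=0$. $\hat\nabla\in\mathscr{C}_{\mathrm{lin}}(A)$ is regular if $\hat\nabla\mathbb{C}|_{\mathrm{V}A}\colon\mathrm{V}A\to\pi_A^*(\mathrm{T}M)$ is an isomorphism of bundles over $A$; equivalently the matrix $(\delta^i_j+(\hat\Gamma^2)^i_{jc}y^c)$ is invertible everywhere. $\mathscr{C}_{\mathrm{lin}}^{\mathrm{reg}}(A)$ is the set of regular ones. For regular $\hat\nabla$, $\mathrm{H}_vA:=\mathrm{Ker}(\hat\nabla\mathbb{C}|_{\mathrm{T}_vA})$ is a horizontal bundle, whose nonlinear connection $N$ (the one induced by $\hat\nabla$) has components $N^a_i=B^a_b(\hat\Gamma^1)^b_{ic}y^c$ with $(B^i_j)=(\delta^i_j+(\hat\Gamma^2)^i_{jc}y^c)^{-1}$. *)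

(* Defs.v *)
From HB Require Import structures.
From mathcomp Require Import all_boot all_order all_algebra.
From mathcomp Require Import all_classical all_reals all_analysis.

Set Implicit Arguments.
Unset Strict Implicit.
Unset Printing Implicit Defensive.

Import Order.TTheory GRing.Theory Num.Theory.
Import numFieldNormedType.Exports.

Local Open Scope classical_set_scope.
Local Open Scope ring_scope.

(* In finite dimension and for open U, this is C^k on U in the usual sense:
   all directional derivatives (equivalently, all partial ones) are used. *)
Fixpoint Cdiff (R : realType) (V W : normedModType R) (k : nat)
    (U : set V) (f : V -> W) : Prop :=
  match k with
  | 0 => forall x, U x -> {for x, continuous f}
  | k'.+1 => (forall x, U x -> differentiable f x) /\
             (forall u : V, Cdiff k' U ('D_u f))
  end.

Definition smooth_on (R : realType) (V W : normedModType R)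
    (U : set V) (f : V -> W) : Prop := forall k, Cdiff k U f.

(* A smooth structure is presented by an atlas that need not be maximal.
   [cmap e] and [cinv e] are total functions, meaningful on [cdom e] and on its
   image only.  [chart_at] chooses a preferred chart around each point. *)
Record manifold (R : realType) (n : nat) := Manifold {
  mspace :> topologicalType;
  mspace_hausdorff : hausdorff_space mspace;
  mspace_second_countable : @second_countable mspace;
  chart : Type;
  cdom : chart -> set mspace;
  cmap : chart -> mspace -> 'rV[R]_n;
  cinv : chart -> 'rV[R]_n -> mspace;
  chart_at : mspace -> chart;
  cdom_open : forall e, open (cdom e);
  cimg_open : forall e, open (cmap e @` cdom e);
  cmapK : forall e p, cdom e p -> cinv e (cmap e p) = p;
  cmap_continuous : forall e p, cdom e p -> {for p, continuous (cmap e)};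
  cinv_continuous : forall e x, (cmap e @` cdom e) x ->
    {for x, continuous (cinv e)};
  chart_at_dom : forall p, cdom (chart_at p) p;
  trans_smooth : forall e e',
    smooth_on (cmap e @` (cdom e `&` cdom e')) (cmap e' \o cinv e)
}.

(* T_pM is modelled on R^n through the preferred chart at p: the pair (p, w)
   stands for the vector at p with components w in the chart [chart_at p].
   This is a record rather than a product type so that it does not inherit the
   product topology, which is not that of the tangent bundle. *)
Record TM (R : realType) (n : nat) (M : manifold R n) :=
  Tvec { foot : M; vec : 'rV[R]_n }.

Section TangentBundle.
Context (R : realType) (n : nat) (M : manifold R n).
Local Notation Rn := 'rV[R]_n.

Definition trans (e e' : chart M) : Rn -> Rn := cmap e' \o cinv e.

(* components in the chart e of w in T_pM *)
Definition tcomp (e : chart M) (p : M) (w : Rn) : Rn :=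
  'd (trans (chart_at p) e) (cmap (chart_at p) p) w.

(* the vector of T_pM with components y in the chart e *)
Definition tvec (e : chart M) (p : M) (y : Rn) : Rn :=
  'd (trans e (chart_at p)) (cmap e p) y.

(* the coordinate vector d/dx^j at p *)
Definition dvec (e : chart M) (p : M) (j : 'I_n) : Rn :=
  tvec e p (delta_mx 0 j).

(* natural coordinates (x, y) of TM associated with the chart e *)
Definition tcoord (e : chart M) (v : TM M) : Rn * Rn :=
  (cmap e (foot v), tcomp e (foot v) (vec v)).

Definition tinv (e : chart M) (z : Rn * Rn) : TM M :=
  Tvec (cinv e z.1) (tvec e (cinv e z.1) z.2).

Definition ttrans (e e' : chart M) (z : Rn * Rn) : Rn * Rn :=
  (trans e e' z.1, 'd (trans e e') (z.1) (z.2)).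

Definition ycoord (e : chart M) (v : TM M) (c : 'I_n) : R :=
  (tcoord e v).2 0 c.

Definition tscale (lam : R) (v : TM M) : TM M :=
  Tvec (foot v) (lam *: vec v).

(* T_v(TM) is modelled on R^n x R^n through the natural coordinates of the
   preferred chart at [foot v]: (w1, w2) stands for w1^i d/dx^i + w2^i d/dy^i,
   d(pi) is the first projection, and T_pM is identified with the vertical
   space by w |-> (0, w).  [xcomp e v w] are the components of w in the natural
   coordinates of the chart e. *)
Definition xcomp (e : chart M) (v : TM M) (w : Rn * Rn) : Rn * Rn :=
  'd (ttrans (chart_at (foot v)) e) (tcoord (chart_at (foot v)) v) w.

(* differential of the dilation h_lam, from T_v(TM) to T_{lam v}(TM) *)
Definition dscale (lam : R) (w : Rn * Rn) : Rn * Rn := (w.1, lam *: w.2).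

(* first and second partial derivatives dx'^i/dx^j and d^2x'^i/dx^j dx^k of the
   change of coordinates x' = trans e e' (x) at p *)
Definition dtrans (e e' : chart M) (p : M) (i j : 'I_n) : R :=
  ('D_(delta_mx 0 j) (trans e e') (cmap e p)) 0 i.

Definition d2trans (e e' : chart M) (p : M) (i j k : 'I_n) : R :=
  ('D_(delta_mx 0 j) ('D_(delta_mx 0 k) (trans e e')) (cmap e p)) 0 i.

(* coordinate expression of a subset of TM *)
Definition tloc (A : TM M -> Prop) (e : chart M) : set (Rn * Rn) :=
  [set z | (cmap e @` cdom e) z.1 /\ A (tinv e z)].

Record cone := Cone {
  car :> TM M -> Prop;
  car_open : forall e, open (tloc car e);
  car_slit : forall v, car v -> vec v != 0;
  car_fiber : forall p : M, exists w, car (Tvec p w);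
  car_conic : forall v (lam : R), 0 < lam -> car v -> car (tscale lam v)
}.

End TangentBundle.

(* Functions and sections over A are total functions on TM which, in the
   records below, are extended by 0 outside of A so that equality of records
   is equality over A. *)
Section Objects.
Context (R : realType) (n : nat) (M : manifold R n) (A : cone M).
Local Notation Rn := 'rV[R]_n.

Definition smooth_fun (f : TM M -> R) : Prop :=
  forall e : chart M, smooth_on (tloc A e) (f \o tinv e).

Definition srep (e : chart M) (Y : TM M -> Rn) (z : Rn * Rn) : Rn :=
  tcomp e (foot (tinv e z)) (Y (tinv e z)).

Definition xrep (e : chart M) (X : TM M -> Rn * Rn) (z : Rn * Rn) : Rn * Rn :=
  xcomp e (tinv e z) (X (tinv e z)).

(* Sections of pi_A^*(TM): the value at v is a vector of T_pM, p = foot v. *)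
Record sect := Sect {
  sect_fun :> TM M -> Rn;
  sect_smooth : forall e, smooth_on (tloc A e) (srep e sect_fun);
  sect_off : forall v, ~ A v -> sect_fun v = 0
}.

Definition sect_hom (beta : R) (Y : sect) : Prop :=
  forall v (lam : R), A v -> 0 < lam -> Y (tscale lam v) = lam `^ beta *: Y v.

(* The value at v is a vector of T_vA. *)
Record vfield := VField {
  vfield_fun :> TM M -> Rn * Rn;
  vfield_smooth : forall e, smooth_on (tloc A e) (xrep e vfield_fun);
  vfield_off : forall v, ~ A v -> vfield_fun v = 0
}.

Definition vfield_hom (alpha : R) (X : vfield) : Prop :=
  forall v (lam : R), A v -> 0 < lam ->
    X (tscale lam v) = lam `^ alpha *: dscale lam (X v).

Definition lie (X : vfield) (f : TM M -> R) (v : TM M) : R :=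
  'd (f \o tinv (chart_at (foot v))) (tcoord (chart_at (foot v)) v) (X v).

(* Tensors of type (1,2) over A are bilinear maps T_pM x T_pM -> T_pM; the
   slots of T^i_{jk} dx^j (x) dx^k are taken in this order. *)
Definition tens_coef (T : TM M -> Rn -> Rn -> Rn) (e : chart M) (v : TM M)
    (i j k : 'I_n) : R :=
  (tcomp e (foot v) (T v (dvec e (foot v) j) (dvec e (foot v) k))) 0 i.

Record tens := Tens {
  tens_fun :> TM M -> Rn -> Rn -> Rn;
  tens_linl : forall v w, linear (fun u => tens_fun v u w);
  tens_linr : forall v u, linear (tens_fun v u);
  tens_smooth : forall e i j k,
    smooth_on (tloc A e) (fun z => tens_coef tens_fun e (tinv e z) i j k);
  tens_off : forall v u w, ~ A v -> tens_fun v u w = 0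
}.

Definition tens_hom (alpha : R) (T : tens) : Prop :=
  forall v (lam : R) u w, A v -> 0 < lam ->
    T (tscale lam v) u w = lam `^ alpha *: T v u w.

(* Coefficients Gamma^i_{jk} in each chart (0 where the chart is not defined),
   0-homogeneous and transforming as Christoffel symbols. *)
Record anis := Anis {
  anis_coef :> chart M -> TM M -> 'I_n -> 'I_n -> 'I_n -> R;
  anis_smooth : forall e i j k,
    smooth_on (tloc A e) (fun z => anis_coef e (tinv e z) i j k);
  anis_hom : forall e v (lam : R) i j k, A v -> cdom e (foot v) -> 0 < lam ->
    anis_coef e (tscale lam v) i j k = anis_coef e v i j k;
  anis_trans : forall e e' v i j k,
    A v -> cdom e (foot v) -> cdom e' (foot v) ->
    anis_coef e' v i j k =
      \sum_a dtrans e e' (foot v) i a *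
        (\sum_b \sum_c dtrans e' e (foot v) b j * dtrans e' e (foot v) c k
                       * anis_coef e v a b c
         + d2trans e' e (foot v) a j k);
  anis_off : forall e v i j k, ~ (A v /\ cdom e (foot v)) ->
    anis_coef e v i j k = 0
}.

(* Components N^a_j: N_v(d/dx^j) = d/dx^j - N^a_j d/dy^a. *)
Definition nl_coef (N : TM M -> Rn -> Rn * Rn) (e : chart M) (v : TM M)
    (a j : 'I_n) : R :=
  - (xcomp e v (N v (dvec e (foot v) j))).2 0 a.

(* [nl_section] says that d(pi) o N_v is the identity of T_pM. *)
Record nlconn := NLConn {
  nl_fun :> TM M -> Rn -> Rn * Rn;
  nl_linear : forall v, linear (nl_fun v);
  nl_section : forall v u, A v -> (nl_fun v u).1 = u;
  nl_hom : forall v (lam : R) u, A v -> 0 < lam ->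
    nl_fun (tscale lam v) u = dscale lam (nl_fun v u);
  nl_smooth : forall e a j,
    smooth_on (tloc A e) (fun z => nl_coef nl_fun e (tinv e z) a j);
  nl_off : forall v u, ~ A v -> nl_fun v u = 0
}.

(* Homogeneous Koszul connections on pi_A^*(TM); sums and products by functions
   of sections are expressed pointwise over A. *)
Record linconn := LinConn {
  nabla :> vfield -> sect -> sect;
  nabla_addl : forall (X1 X2 X : vfield) (Y : sect),
    (forall v, A v -> X v = X1 v + X2 v) ->
    forall v, A v -> nabla X Y v = nabla X1 Y v + nabla X2 Y v;
  nabla_scalel : forall (f : TM M -> R) (X fX : vfield) (Y : sect),
    smooth_fun f -> (forall v, A v -> fX v = f v *: X v) ->
    forall v, A v -> nabla fX Y v = f v *: nabla X Y v;
  nabla_addr : forall (X : vfield) (Y1 Y2 Y : sect),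
    (forall v, A v -> Y v = Y1 v + Y2 v) ->
    forall v, A v -> nabla X Y v = nabla X Y1 v + nabla X Y2 v;
  nabla_leibniz : forall (f : TM M -> R) (X : vfield) (Y fY : sect),
    smooth_fun f -> (forall v, A v -> fY v = f v *: Y v) ->
    forall v, A v -> nabla X fY v = lie X f v *: Y v + f v *: nabla X Y v;
  nabla_hom : forall (alpha beta : R) (X : vfield) (Y : sect),
    vfield_hom alpha X -> sect_hom beta Y ->
    sect_hom (alpha + beta) (nabla X Y)
}.

(* Components in the chart e, at v, of nabla_X Y for local fields X, Y given by
   their components in natural coordinates near v.  As usual for Koszul
   connections, it is computed on arbitrary global fields having the same germs
   at v as X and Y. *)
Definition nabla_loc (D : linconn) (e : chart M) (X : Rn * Rn -> Rn * Rn)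
    (Y : Rn * Rn -> Rn) (v : TM M) : Rn :=
  xget 0 [set u | exists (X' : vfield) (Y' : sect),
    [/\ \forall z \near tcoord e v, xrep e X' z = X z,
        \forall z \near tcoord e v, srep e Y' z = Y z
      & u = tcomp e (foot v) (D X' Y' v)]].

Definition dx (j : 'I_n) (z : Rn * Rn) : Rn * Rn := (delta_mx 0 j, 0).
Definition dy (j : 'I_n) (z : Rn * Rn) : Rn * Rn := (0, delta_mx 0 j).
Definition dxs (k : 'I_n) (z : Rn * Rn) : Rn := delta_mx 0 k.

(* delta_{x^j} = d/dx^j - N^a_j d/dy^a *)
Definition deltax (N : nlconn) (e : chart M) (j : 'I_n) (z : Rn * Rn) :
    Rn * Rn :=
  (delta_mx 0 j, - \row_a nl_coef N e (tinv e z) a j).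

(* (Gamma^1)^i_{jk} and (Gamma^2)^i_{jk} *)
Definition hatG1 (D : linconn) e v (i j k : 'I_n) : R :=
  (nabla_loc D e (dx j) (dxs k) v) 0 i.
Definition hatG2 (D : linconn) e v (i j k : 'I_n) : R :=
  (nabla_loc D e (dy j) (dxs k) v) 0 i.

(* Gamma = j_N(D), the horizontal part of D according to N *)
Definition is_hpart (N : nlconn) (D : linconn) (G : anis) : Prop :=
  forall e v i j k, A v -> cdom e (foot v) ->
    G e v i j k = (nabla_loc D e (deltax N e j) (dxs k) v) 0 i.

Definition is_vpart (D : linconn) (T : tens) : Prop :=
  forall e v i j k, A v -> cdom e (foot v) ->
    tens_coef T e v i j k = hatG2 D e v i j k.

(* D corresponds to (G, T) under the identification determined by N *)
Definition corresponds (N : nlconn) (D : linconn) (G : anis) (T : tens) :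
    Prop := is_hpart N D G /\ is_vpart D T.

(* N is the nonlinear connection underlying G. *)
Definition is_nl_of (G : anis) (N : nlconn) : Prop :=
  forall e v i j, A v -> cdom e (foot v) ->
    nl_coef N e v i j = \sum_c G e v i j c * ycoord e v c.

Definition is_rho (G : anis) (D : linconn) : Prop :=
  forall e v i j k, A v -> cdom e (foot v) ->
    hatG1 D e v i j k = G e v i j k /\ hatG2 D e v i j k = 0.

(* The covariant differential at v of the Liouville field; by tensoriality, the
   value on w in T_vA is computed on any vector field X with X_v = w. *)
Definition nablaC (D : linconn) (v : TM M) (w : Rn * Rn) : Rn :=
  xget 0 [set u | exists (X : vfield) (C : sect),
    [/\ forall v', A v' -> C v' = vec v', X v = w & u = D X C v]].

(* Each nablaC D v is linear and depends smoothly on v, so being a bundle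
   isomorphism amounts to being fibrewise bijective. *)
Definition regular_conn (D : linconn) : Prop :=
  forall v, A v -> bijective (fun w : Rn => nablaC D v (0, w)).

(* the horizontal space of N at v is the kernel of nablaC D v *)
Definition is_induced (D : linconn) (N : nlconn) : Prop :=
  forall v, A v -> forall w, nablaC D v w = 0 <-> exists u, w = N v u.

(* the matrix (delta^i_j + S^i_{jc} y^c), upper index = row *)
Definition regmx (S : chart M -> TM M -> 'I_n -> 'I_n -> 'I_n -> R)
    (e : chart M) (v : TM M) : 'M[R]_n :=
  \matrix_(i, j) ((i == j)%:R + \sum_c S e v i j c * ycoord e v c).

(* B^a_b (Gamma^1)^b_{ic} y^c *)
Definition ind_coef (D : linconn) (e : chart M) (v : TM M) (a i : 'I_n) : R :=
  \sum_b \sum_c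
    invmx (regmx (hatG2 D) e v) a b * hatG1 D e v b i c * ycoord e v c.

Definition reglin := {D : linconn | regular_conn D}.

Definition invtens := {T : tens | tens_hom (-1) T /\
  forall e v, A v -> cdom e (foot v) -> regmx (tens_coef T) e v \in unitmx}.

End Objects.

(* Main.v *)
Require Import Defs.
From HB Require Import structures.
From mathcomp Require Import all_boot all_order all_algebra.
From mathcomp Require Import all_classical all_reals all_analysis.
From mathcomp Require Import ring lra.
Import Order.TTheory GRing.Theory Num.Theory.
Import numFieldNormedType.Exports.
Set Implicit Arguments.
Unset Strict Implicit.
Unset Printing Implicit Defensive.
Local Open Scope classical_set_scope.
Local Open Scope ring_scope.

(* A connection D on the pull-back bundle is tensorial in its first argument and a
   derivation in the second one.  Multiplying coordinate fields by a bump function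
   on M gives global fields, and expanding b^2 X and b^2 Y in them shows that, in
   every chart, D_X Y is the derivative of Y along X plus the term
   hatG1(X_1, Y) + hatG2(X_2, Y).  Hence D is determined by (hatG1, hatG2), and
   conversely a family of such coefficients defines a connection as soon as it
   obeys the inhomogeneous transformation law (lemma conn_chart), where the second
   derivatives of the change of coordinates only see the first component of X.
   Regularity says that the kernel of w |-> D_w C is the graph of a horizontal lift,
   intrinsically defined, whose coefficients are ind_coef.  Feeding this lift to the
   transformation law gives Christoffel symbols.  What remains is linear algebra:
   with Q = hatG2 y and P = hatG1 y, the induced nonlinear connection is
   N = (1 + Q)^-1 P, so that (P - Q N) = N, that is, jm(D) has N as its underlying
   nonlinear connection, and (jm(D), hatG2) determines hatG1 = jm(D) + N hatG2. *)

(** * Calculus of smooth germs *)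

(** A connection accepts global fields only, so its local coefficients are reached through
    extensions of coordinate fields. The cutoff is a function on M rather than on A: it is then
    constant along the fibres, so the extended fields remain homogeneous and the homogeneity axiom,
    which speaks of global homogeneous fields, applies to them. The square b^2 occurs because one
    factor b is absorbed by the component functions and another by the coordinate fields, neither of
    which is defined outside of the chart. The change of charts of the induced nonlinear connection
    is never computed from [ind_coef]: the kernel of the covariant differential of C needs no chart,
    and a kernel vector is determined by its projection to M. Smoothness is iterated
    differentiability along fixed directions, while changes of natural coordinates apply a
    differential to a vector that moves with the point; expansions in a finite basis bridge the
    two. *)

Section Germs.
Context {R : realType}.
Implicit Types V W : normedModType R.

(* Variant of [Cdiff] in which each condition is imposed near x, so that it only
   depends on the germ of f at x. *)
Fixpoint Ck V W (k : nat) (x : V) (f : V -> W) : Prop :=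
  match k with
  | 0 => \forall y \near x, {for y, continuous f}
  | k'.+1 => (\forall y \near x, differentiable f y) /\
             (forall u : V, @Ck V W k' x ('D_u f))
  end.

Definition smooth_at V W (x : V) (f : V -> W) : Prop := forall k, Ck k x f.

(** A first-order expansion of f at x is one of g as well, and [diff_unique] makes its linear part
    the differential of g. *)
Lemma near_eq_diff V W (x : V) (f g : V -> W) :
  (\forall y \near x, f y = g y) -> differentiable f x ->
  differentiable g x /\ 'd g x = 'd f x :> (V -> W).
Proof.
move=> fg fd.
have E : g \o shift x = cst (g x) + ('d f x : V -> W) +o_ 0 id.
  have ff := diff_locally fd; rewrite (nbhs_singleton fg) in ff.
  have fgs : \forall h \near (0 : V), f (h + x) = g (h + x).
    by rewrite (near_shift x) /=; near=> z; rewrite /= sub0r subrK; near: z.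
  apply/eqaddoP => _/posnumP[e].
  have /eqaddoP/(_ _ (gt0 e)) ffe := ff.
  near=> h.
  have <- : (f \o shift x - (cst (g x) + 'd f x)) h =
      (g \o shift x - (cst (g x) + 'd f x)) h.
    by rewrite !fctE /=; congr (_ - _); near: h.
  by near: h.
have dE := diff_unique (diff_continuous fd) E.
by split=> //; apply/diff_locallyP; rewrite dE; split; first exact: diff_continuous.
Unshelve. all: by end_near. Qed.

Lemma Ck_eq V W k (x : V) (f g : V -> W) :
  (\forall y \near x, f y = g y) -> Ck k x f -> Ck k x g.
Proof.
elim: k f g => [|k IH] f g /near_join fg /=.
  (* By [near_join], agreement near x has become agreement near each y close to x, as continuity and
     differentiability at y require. *)
  move=> fc; near=> y.
  have fgy : {near y, f =1 g} by near: y.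
  change (g z @[z --> y] --> g y); rewrite -(nbhs_singleton fgy).
  have fcy : f z @[z --> y] --> f y by near: y.
  exact: cvg_trans (near_eq_cvg _) fcy.
move=> [fd fD]; split; last first.
  move=> u; apply: IH (fD u).
  by near=> y; apply: near_eq_derive; near: y.
near=> y; have fgy : {near y, f =1 g} by near: y.
by apply: (near_eq_diff fgy _).1; near: y.
Unshelve. all: by end_near. Qed.

Lemma Ck_le V W k (x : V) (f : V -> W) : Ck k.+1 x f -> Ck k x f.
Proof.
elim: k f => [|k IH] f [fd fD] /=.
  by near=> y; apply: differentiable_continuous; near: y.
by split=> // u; apply: IH; apply: fD.
Unshelve. all: by end_near. Qed.

(** On an open set, a condition at every point is a condition near every point. All later calculus
    is done on germs and brought back by this equivalence. *)
Lemma smooth_onP V W (U : set V) (f : V -> W) : open U ->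
  smooth_on U f <-> forall x, U x -> smooth_at x f.
Proof.
move=> oU; split=> [fU x Ux k|fU k].
  elim: k f {fU}(fU k) => [|k IH] f /=.
    by move=> fc; apply: filterS (open_nbhs_nbhs (conj oU Ux)) => y; exact: fc.
  move=> [fd fD]; split; last by move=> u; exact: IH.
  by apply: filterS (open_nbhs_nbhs (conj oU Ux)) => y; exact: fd.
elim: k f {fU}(fun x Ux => fU x Ux k) => [|k IH] f /= fk.
  by move=> x /fk; exact: nbhs_singleton.
split; first by move=> x /fk [+ _]; exact: nbhs_singleton.
by move=> u; apply: IH => x /fk [].
Qed.

Lemma smooth_at_eq V W (x : V) (f g : V -> W) :
  (\forall y \near x, f y = g y) -> smooth_at x f -> smooth_at x g.
Proof. by move=> fg fs k; apply: Ck_eq (fs k). Qed.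

Lemma smooth_at_near_diff V W (x : V) (f : V -> W) :
  smooth_at x f -> \forall y \near x, differentiable f y.
Proof. by move=> /(_ 1) []. Qed.

Lemma smooth_at_diff V W (x : V) (f : V -> W) :
  smooth_at x f -> differentiable f x.
Proof. by move=> /smooth_at_near_diff; exact: nbhs_singleton. Qed.

Lemma smooth_at_cont V W (x : V) (f : V -> W) :
  smooth_at x f -> {for x, continuous f}.
Proof. by move=> /smooth_at_diff; exact: differentiable_continuous. Qed.

Lemma smooth_at_derive V W (x u : V) (f : V -> W) :
  smooth_at x f -> smooth_at x ('D_u f).
Proof. by move=> fs k; have [_] := fs k.+1; exact. Qed.

Lemma Ck_cst V W k (x : V) (a : W) : Ck k x (cst a).
Proof.
elim: k a => [|k IH] a /=; first by near=> y; exact: cvg_cst.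
split; first by near=> y; exact: differentiable_cst.
move=> u; rewrite (_ : 'D_u (cst a) = cst 0) //.
by apply/funext => y; rewrite derive_cst.
Unshelve. all: by end_near. Qed.

Lemma smooth_at_cst V W (x : V) (a : W) : smooth_at x (fun=> a).
Proof. by move=> k; exact: Ck_cst. Qed.

Lemma smooth_at_lin V W (x : V) (f : {linear V -> W}) :
  continuous f -> smooth_at x f.
Proof.
move=> fc [|k] /=; first by near=> y; exact: fc.
split; first by near=> y; exact: linear_differentiable.
move=> u; rewrite (_ : 'D_u f = cst (f u)); first exact: Ck_cst.
apply/funext => y; rewrite deriveE; last exact: linear_differentiable.
by rewrite diff_lin.
Unshelve. all: by end_near. Qed.

Lemma smooth_at_id V (x : V) : smooth_at x (fun y : V => y).
Proof.
by apply: (@smooth_at_lin _ _ _ (idfun : {linear V -> V})) => y; exact: cvg_id.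
Qed.

Lemma Ck_lincomp V W W' k (x : V) (f : V -> W) (L : {linear W -> W'}) :
  continuous L -> Ck k x f -> Ck k x (fun y => L (f y)).
Proof.
move=> Lc; elim: k f => [|k IH] f /=.
  by move=> fc; near=> y; apply: continuous_comp; [near: y | exact: Lc].
move=> [fd fD]; split.
  near=> y; apply: (@differentiable_comp _ _ _ _ f L); first by near: y.
  exact: linear_differentiable.
move=> u; apply: Ck_eq (IH _ (fD u)); near=> y.
have fdy : differentiable f y by near: y.
rewrite !deriveE //; last exact/differentiable_comp/linear_differentiable.
by rewrite (@diff_comp _ _ _ _ f L) //= ?diff_lin //; exact: linear_differentiable.
Unshelve. all: by end_near. Qed.

Lemma Ck_add V W k (x : V) (f g : V -> W) :
  Ck k x f -> Ck k x g -> Ck k x (fun y => f y + g y).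
Proof.
elim: k f g => [|k IH] f g /=.
  move=> fc gc; near=> y.
  by apply: (@continuousD _ _ _ f g); near: y.
move=> [fd fD] [gd gD]; split.
  by near=> y; apply: (@differentiableD _ _ _ f g); near: y.
move=> u; apply: Ck_eq (IH _ _ (fD u) (gD u)); near=> y.
by rewrite -deriveD //; apply: diff_derivable; near: y.
Unshelve. all: by end_near. Qed.

Lemma scale_bilinear_for V :
  bilinear_for (GRing.Scale.Law.clone _ _ *:%R _)
    (GRing.Scale.Law.clone _ _ *:%R _) (fun (a : R) (v : V) => a *: v).
Proof.
split=> [u'|u] a x y /=; first by rewrite scalerDl scalerA.
by rewrite scalerDr !scalerA mulrC.
Qed.

(** Scaling is packed as a continuous bilinear map, so the product rule is the chain rule for this
    map after the pair (f, g). *)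
Lemma is_diff_scale V W (x : V) (f : V -> R) (g : V -> W) :
  differentiable f x -> differentiable g x ->
  is_diff x (fun y => f y *: g y) (fun u => f x *: 'd g x u + 'd f x u *: g x).
Proof.
move=> fd gd.
pose SM := bilinear_isBilinear.Build R R W W _ _ _ (scale_bilinear_for W).
pose S : {bilinear R -> W -> W} := HB.pack (fun (a : R) (v : W) => a *: v) SM.
have Sc : continuous (fun p : R * W => S p.1 p.2) by exact: scale_continuous.
have dS p : is_diff p (fun q : R * W => S q.1 q.2)
    (fun q => S p.1 q.2 + S q.1 p.2).
  by apply: DiffDef; [exact: differentiable_bilin | rewrite diff_bilin].
have dfg : is_diff x (fun y => (f y, g y)) (fun y => ('d f x y, 'd g x y)).
  by apply: is_diff_pair; exact: differentiableP.
exact: (is_diff_comp dfg (dS (f x, g x))).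
Qed.

Lemma Ck_scale V W k (x : V) (f : V -> R) (g : V -> W) :
  Ck k x f -> Ck k x g -> Ck k x (fun y => f y *: g y).
Proof.
elim: k f g => [|k IH] f g.
  move=> /= fc gc; near=> y.
  by apply: (@continuousZ _ _ _ f g); near: y.
move=> fk gk; move: (fk) (gk) => [fd fD] [gd gD]; split.
  near=> y; have fdy : differentiable f y by near: y.
  have gdy : differentiable g y by near: y.
  by case: (is_diff_scale fdy gdy).
(* In the product rule each term pairs a derivative, of order k, with an undifferentiated factor,
   which [Ck_le] lowers to the same order. *)
move=> u.
apply: Ck_eq (Ck_add (IH _ _ (Ck_le fk) (gD u)) (IH _ _ (fD u) (Ck_le gk))).
near=> y.
have fdy : differentiable f y by near: y.
have gdy : differentiable g y by near: y.
have fgy := is_diff_scale fdy gdy.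
by rewrite !deriveE // diff_val.
Unshelve. all: by end_near. Qed.

Lemma Ck_mul V k (x : V) (f g : V -> R) :
  Ck k x f -> Ck k x g -> Ck k x (fun y => f y * g y).
Proof. exact: (@Ck_scale V R). Qed.

Lemma Ck_pair V W W' k (x : V) (f : V -> W) (g : V -> W') :
  Ck k x f -> Ck k x g -> Ck k x (fun y => (f y, g y)).
Proof.
elim: k f g => [|k IH] f g /=.
  by move=> fc gc; near=> y; apply: cvg_pair; near: y.
move=> [fd fD] [gd gD]; split.
  by near=> y; apply: differentiable_pair; near: y.
move=> u; apply: Ck_eq (IH _ _ (fD u) (gD u)); near=> y.
have fdy : differentiable f y by near: y.
have gdy : differentiable g y by near: y.
rewrite !deriveE //; last exact: differentiable_pair.
by rewrite diff_pair.
Unshelve. all: by end_near. Qed.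

Lemma Ck_sum V W k (x : V) (I : Type) (r : seq I) (F : I -> V -> W) :
  (forall i, Ck k x (F i)) -> Ck k x (fun y => \sum_(i <- r) F i y).
Proof.
move=> Fk; elim: r => [|i r IH].
  rewrite (_ : (fun _ => _) = cst 0); first exact: Ck_cst.
  by apply/funext => y; rewrite big_nil.
rewrite (_ : (fun _ => _) = (fun y => F i y + \sum_(j <- r) F j y)); first exact: Ck_add.
by apply/funext => y; rewrite big_cons.
Qed.

(** The functionals [c i] let a differential in a direction that moves with the point be written as
    a finite sum of derivatives along the fixed directions [b i], the only ones that [Ck]
    controls. *)
Class fdim V : Prop := fdimP : exists (I : finType) (b : I -> V)
  (c : I -> {linear V -> R}),
  (forall i, continuous (c i)) /\ forall v, v = \sum_i c i v *: b i.

Lemma diff_fdim V W (I : finType) (b : I -> V) (c : I -> {linear V -> R})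
    (g : V -> W) (x w : V) :
  (forall v, v = \sum_i c i v *: b i) -> differentiable g x ->
  'd g x w = \sum_i c i w *: 'D_(b i) g x.
Proof.
move=> bE gd; rewrite {1}(bE w) linear_sum; apply: eq_bigr => i _.
by rewrite linearZ deriveE.
Qed.

(** The chain rule along u gives the sum over i of c_i(D_u f) times ['D_(b i) g] after f. The
    induction hypothesis is applied to these composites, with f at the lower order k. *)
Lemma Ck_comp V W W' k (x : V) (f : V -> W) (g : W -> W') : fdim W ->
  Ck k x f -> Ck k (f x) g -> Ck k x (fun y => g (f y)).
Proof.
move=> [I [b [c [cc bE]]]]; elim: k f g => [|k IH] f g.
  move=> /= fc gc; near=> y; apply: continuous_comp; first by near: y.
  by near: y; exact: ((nbhs_singleton fc) _ gc).
move=> fk gk; move: (fk) (gk) => [fd fD] [gd gD].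
have gdf : \forall y \near x, differentiable g (f y).
  exact: (differentiable_continuous (nbhs_singleton fd) gd).
split; first by near=> y; apply: (@differentiable_comp _ _ _ _ f g); near: y.
move=> u.
have : Ck k x (fun y => \sum_i c i ('D_u f y) *: 'D_(b i) g (f y)).
  apply: Ck_sum => i; apply: Ck_scale.
    by apply: (@Ck_lincomp _ _ _ _ _ ('D_u f)) => //; exact: fD.
  exact: (IH f ('D_(b i) g) (Ck_le fk) (gD _)).
apply: Ck_eq; near=> y.
have fdy : differentiable f y by near: y.
have gdy : differentiable g (f y) by near: y.
rewrite [RHS]deriveE; last exact: (@differentiable_comp _ _ _ _ f g).
by rewrite (@diff_comp _ _ _ _ f g) //= -(diff_fdim _ bE) // deriveE.
Unshelve. all: by end_near. Qed.

Section Rules.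
Context {V W W' : normedModType R}.
Implicit Type x : V.

Lemma smooth_at_lincomp x (f : V -> W) (L : {linear W -> W'}) :
  continuous L -> smooth_at x f -> smooth_at x (fun y => L (f y)).
Proof. by move=> Lc fs k; exact: Ck_lincomp. Qed.

Lemma smooth_atD x (f g : V -> W) :
  smooth_at x f -> smooth_at x g -> smooth_at x (fun y => f y + g y).
Proof. by move=> fs gs k; exact: Ck_add. Qed.

Lemma smooth_atZ x (f : V -> R) (g : V -> W) :
  smooth_at x f -> smooth_at x g -> smooth_at x (fun y => f y *: g y).
Proof. by move=> fs gs k; exact: Ck_scale. Qed.

Lemma smooth_atM x (f g : V -> R) :
  smooth_at x f -> smooth_at x g -> smooth_at x (fun y => f y * g y).
Proof. by move=> fs gs k; exact: (@Ck_scale V R). Qed.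

Lemma smooth_at_pair x (f : V -> W) (g : V -> W') :
  smooth_at x f -> smooth_at x g -> smooth_at x (fun y => (f y, g y)).
Proof. by move=> fs gs k; exact: Ck_pair. Qed.

Lemma smooth_at_sum x (I : Type) (r : seq I) (F : I -> V -> W) :
  (forall i, smooth_at x (F i)) -> smooth_at x (fun y => \sum_(i <- r) F i y).
Proof. by move=> Fs k; apply: Ck_sum => i; exact: Fs. Qed.

Lemma smooth_at_comp x (f : V -> W) (g : W -> W') : fdim W ->
  smooth_at x f -> smooth_at (f x) g -> smooth_at x (fun y => g (f y)).
Proof. by move=> Wf fs gs k; exact: Ck_comp. Qed.

End Rules.

Section CompositeRules.
Context {V W W' : normedModType R}.
Implicit Type x : V.

Lemma smooth_atN x (f : V -> W) :
  smooth_at x f -> smooth_at x (fun y => - f y).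
Proof.
move=> fs; apply: smooth_at_eq (smooth_atZ (smooth_at_cst x (-1 : R)) fs).
by near=> y; rewrite scaleN1r.
Unshelve. all: by end_near. Qed.

Lemma smooth_atB x (f g : V -> W) :
  smooth_at x f -> smooth_at x g -> smooth_at x (fun y => f y - g y).
Proof. by move=> fs gs; apply/smooth_atD/smooth_atN. Qed.

Lemma smooth_at_dapp x (f h : V -> W) (g : W -> W') : fdim W ->
  smooth_at x f -> smooth_at x h -> smooth_at (f x) g ->
  smooth_at x (fun y => 'd g (f y) (h y)).
Proof.
move=> Wf; have [I [b [c [cc bE]]]] := Wf => fs hs gs.
have : smooth_at x (fun y => \sum_i c i (h y) *: 'D_(b i) g (f y)).
  apply: smooth_at_sum => i k; apply: Ck_scale; first exact: Ck_lincomp.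
  by apply: (@Ck_comp _ _ _ _ _ f ('D_(b i) g)) => //; exact: smooth_at_derive.
apply: smooth_at_eq; near=> y; rewrite -(diff_fdim _ bE) //.
near: y; exact: (smooth_at_cont fs (smooth_at_near_diff gs)).
Unshelve. all: by end_near. Qed.

Lemma smooth_at_prod x (I : Type) (r : seq I) (F : I -> V -> R) :
  (forall i, smooth_at x (F i)) -> smooth_at x (fun y => \prod_(i <- r) F i y).
Proof.
move=> Fs; elim: r => [|i r IH].
  rewrite (_ : (fun _ => _) = cst 1); first exact: smooth_at_cst.
  by apply/funext => y; rewrite big_nil.
rewrite (_ : (fun _ => _) = (fun y => F i y * \prod_(j <- r) F j y)).
  exact: smooth_atM.
by apply/funext => y; rewrite big_cons.
Qed.

End CompositeRules.

#[global] Instance fdim_R : fdim R.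
Proof.
exists 'I_1, (fun=> 1), (fun=> (idfun : {linear R -> R})); split.
  by move=> _ v; exact: cvg_id.
by move=> v; rewrite big_ord1 /= -[RHS]/(v * 1) mulr1.
Qed.

#[global] Instance fdim_prod V W : fdim V -> fdim W -> fdim (V * W)%type.
Proof.
move=> [I [b [c [cc bE]]]] [I' [b' [c' [cc' bE']]]].
exists (I + I')%type,
  (fun i => match i with inl i => (b i, 0) | inr i => (0, b' i) end),
  (fun i => match i with
   | inl i => (c i \o fst : {linear (V * W)%type -> R})
   | inr i => (c' i \o snd : {linear (V * W)%type -> R}) end); split.
  case=> i v /=; apply: continuous_comp; by
    [exact: cvg_fst | exact: cc | exact: cvg_snd | exact: cc'].
move=> [v w]; rewrite big_sumType /=.
have fst_sum (J : finType) (F : J -> V * W) : (\sum_j F j).1 = \sum_j (F j).1.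
  exact: (raddf_sum (fst : {additive V * W -> V})).
have snd_sum (J : finType) (F : J -> V * W) : (\sum_j F j).2 = \sum_j (F j).2.
  exact: (raddf_sum (snd : {additive V * W -> W})).
apply/pair_equal_spec; split; rewrite /= ?fst_sum ?snd_sum /= -?scaler_sumr.
  rewrite [X in _ + X]big1 ?addr0 -?bE //.
  by move=> i _; rewrite /= scaler0.
rewrite [X in X + _]big1 ?add0r -?bE' //.
by move=> i _; rewrite /= scaler0.
Qed.

Lemma coordL n (i : 'I_n) : exists L : {linear 'rV[R]_n -> R},
  continuous L /\ forall v, L v = v 0 i.
Proof.
have cl : linear (fun v : 'rV[R]_n => v 0 i : R) by move=> a u v; rewrite !mxE.
pose cM := GRing.isLinear.Build _ _ _ _ _ cl.
exists (HB.pack (fun v : 'rV[R]_n => v 0 i : R) cM : {linear _ -> _}).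
by split=> //; exact: coord_continuous.
Qed.

#[global] Instance fdim_rV n : fdim 'rV[R]_n.
Proof.
exists 'I_n, (fun i => delta_mx 0 i), (fun i => sval (cid (coordL i))).
split=> [i|v]; first by have [] := svalP (cid (coordL i)).
rewrite [LHS]row_sum_delta; apply: eq_bigr => i _.
by have [_ ->] := svalP (cid (coordL i)).
Qed.

Lemma smooth_at_fst V W (x : V * W) : smooth_at x (fun y => y.1).
Proof.
by apply: (@smooth_at_lin _ _ _ (fst : {linear (V * W)%type -> V})) => y; exact: cvg_fst.
Qed.

Lemma smooth_at_snd V W (x : V * W) : smooth_at x (fun y => y.2).
Proof.
by apply: (@smooth_at_lin _ _ _ (snd : {linear (V * W)%type -> W})) => y; exact: cvg_snd.
Qed.

Lemma smooth_at_coord V n (x : V) (f : V -> 'rV[R]_n) i :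
  smooth_at x f -> smooth_at x (fun y => f y 0 i : R).
Proof.
by have [L [Lc LE]] := coordL i => /(smooth_at_lincomp Lc); under eq_fun do rewrite LE.
Qed.

Lemma smooth_at_row V n (x : V) (F : 'I_n -> V -> R) :
  (forall i, smooth_at x (F i)) -> smooth_at x (fun y => \row_i F i y).
Proof.
move=> Fs; rewrite (_ : (fun _ => _) =
  (fun y => \sum_i F i y *: (delta_mx 0 i : 'rV[R]_n))).
  by apply: smooth_at_sum => i; apply: smooth_atZ => //; exact: smooth_at_cst.
apply/funext => y; rewrite [LHS]row_sum_delta; apply: eq_bigr => i _.
by rewrite mxE.
Qed.

(** The derivative of 1/y is a constant multiple of the square of 1/y, so the induction closes on
    products of the function with itself. *)
Lemma smooth_at_inv (x : R) : x != 0 -> smooth_at x (fun y : R => y^-1).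
Proof.
move=> x0 k; elim: k x x0 => [|k IH] x x0.
  by near=> y; apply: inv_continuous; near: y; exact: (cvgr_neq0 x).
split.
  by near=> y; apply: differentiable_Rinv; near: y; exact: (cvgr_neq0 x).
move=> u; apply: (@Ck_eq R R _ _ (fun y => - (u : R) * (y^-1 * y^-1))).
  near=> y; have y0 : y != 0 by near: y; exact: (cvgr_neq0 x).
  rewrite deriveE; last exact: differentiable_Rinv.
  rewrite diff_Rinv // -[RHS]/(- y ^- 2 * u).
  by rewrite -expr2 exprVn mulrC mulrN mulNr.
apply: Ck_mul; first exact: Ck_cst.
by apply: Ck_mul; exact: IH.
Unshelve. all: by end_near. Qed.

Lemma smooth_atV V (x : V) (f : V -> R) : f x != 0 ->
  smooth_at x f -> smooth_at x (fun y => (f y)^-1).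
Proof.
move=> fx0 fs.
exact: (@smooth_at_comp _ _ _ _ f (fun y : R => y^-1) _ fs (smooth_at_inv fx0)).
Qed.

(** * Flat functions, a smooth step and bump functions on R^n *)

Lemma derive_R V (f : R -> V) (y u : R) :
  differentiable f y -> 'D_u f y = u *: 'D_1 f y.
Proof.
move=> fd; rewrite !deriveE // -linearZ; congr ('d f y _).
by rewrite -[RHS]/(u * 1) mulr1.
Qed.

(* [flat p] extends [p(1/t) exp(-1/t)] by 0 to t <= 0; differentiation acts on
   this family by [p |-> X^2 (p - p')]. *)
Definition flat (p : {poly R}) (t : R) : R :=
  if 0 < t then p.[t^-1] * expR (- t^-1) else 0.

(** With s = 1/t >= 1 and d = [size p], |p(s)| is at most c s^d, where c is the sum of the absolute
    values of the coefficients, and exp(-s) is at most N!/s^N. The choice N = d + 2 leaves a factor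
    t^2, which makes the difference quotients at 0 tend to 0. *)
Lemma flat_bound (p : {poly R}) : exists2 C : R, 0 <= C &
  forall t : R, 0 < t -> t <= 1 -> `|flat p t| <= C * t ^+ 2.
Proof.
pose c : R := \sum_(i < size p) `|p`_i|; have [N NE] : exists N, N = (size p + 2)%N by eexists.
have c0 : 0 <= c by exact: sumr_ge0.
exists (c * N`!%:R) => [|t t0 t1]; first by rewrite mulr_ge0.
have s1 : 1 <= t^-1 by rewrite invf_ge1.
have s0 : 0 < t^-1 by rewrite invr_gt0.
have ps : `|p.[t^-1]| <= c * t^-1 ^+ size p.
  rewrite horner_coef (le_trans (ler_norm_sum _ _ _)) // /c mulr_suml.
  apply: ler_sum => i _; rewrite normrM ler_wpM2l // ger0_norm ?exprn_ge0 ?(ltW s0) //.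
  by rewrite ler_weXn2l // ltnW.
have es : expR (- t^-1) <= N`!%:R * t ^+ N.
  have tN : 0 < t ^+ N by rewrite exprn_gt0.
  have fN : 0 < N`!%:R :> R by rewrite ltr0n fact_gt0.
  rewrite expRN -[leRHS]invrK lef_pV2 ?posrE ?expR_gt0 ?invr_gt0 ?mulr_gt0 //.
  rewrite invfM -exprVn mulrC (le_trans _ (expR_ge1Dxn N.-1 (ltW s0))) // prednK ?NE ?addn2 //.
  by rewrite lerDr.
rewrite /flat t0 normrM (ger0_norm (expR_ge0 _)).
apply: le_trans (ler_pM _ _ ps es) _; rewrite ?normr_ge0 ?expR_ge0 //.
rewrite exprVn {2}NE exprD.
have tp : t ^+ size p != 0 by rewrite expf_neq0 // gt_eqF.
suff -> : c / t ^+ size p * (N`!%:R * (t ^+ size p * t ^+ 2)) = c * N`!%:R * t ^+ 2 by [].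
by field.
Qed.

Lemma is_derive_flat (p : {poly R}) (t : R) :
  is_derive t 1 (flat p) (flat ('X^2 * (p - p^`())) t).
Proof.
have [t0|t0|t0] := ltgtP t 0.
- rewrite {2}/flat ltNge (ltW t0) /=.
  apply: (@near_eq_is_derive _ _ _ (cst 0)).
  near=> y; rewrite /flat ltNge; suff -> : y <= 0 by [].
  by near: y; apply: (cvgr_le t) => //; exact: cvg_id.
- have tn : t != 0 by rewrite gt_eqF.
  apply: (@near_eq_is_derive _ _ _ (fun y : R => p.[y^-1] * expR (- y^-1) : R)).
    near=> y; rewrite /flat; suff -> : 0 < y by [].
    by near: y; apply: (cvgr_gt t) => //; exact: cvg_id.
  have dV : is_derive t 1 (fun y : R => y^-1) (- t ^- 2).
    rewrite -[X in is_derive _ _ _ X]mulr1.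
    exact: (@is_deriveV R id t 1 1 tn (is_derive_id t 1)).
  have dp : is_derive t 1 (fun y : R => p.[y^-1]) (p^`().[t^-1] * - t ^- 2).
    exact: (is_derive1_comp (is_derive_poly p t^-1) dV).
  have de : is_derive t 1 (fun y : R => expR (- y^-1)) (t ^- 2 * expR (- t^-1)).
    have := @is_derive1_comp R expR (fun y => - y^-1) t _ _
      (is_derive_expR (- t^-1)) (is_deriveN dV).
    by rewrite opprK mulrC.
  rewrite /flat t0 hornerM hornerXn hornerD hornerN.
  have H := is_deriveM dp de; refine (is_derive_eq H _).
  rewrite -![_ *: _]/(_ * _) exprVn; ring.
- rewrite t0 {2}/flat ltxx.
  suff L : h^-1 *: (flat p (h *: 1 + 0) - flat p 0) @[h --> (0:R)^'] --> (0:R).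
    by apply: DeriveDef; [exact: cvgP L | exact: cvg_lim].
  have [C C0 Cp] := flat_bound p.
  apply/cvgrPdist_le => e e0; near=> h.
  have hn : h != 0 by near: h; exact: nbhs_dnbhs_neq.
  have h1 : `|h| < 1 by near: h; exact: dnbhs0_lt.
  (* The quotient is at most C h for h > 0 and vanishes for h < 0; dividing by C + 1 also covers C =
     0. *)
  have he : `|h| < e / (C + 1) by near: h; apply: dnbhs0_lt; rewrite divr_gt0 // ltr_wpDl.
  rewrite sub0r normrN addr0 {2}/flat ltxx subr0 -[_ *: 1]/(h * 1) mulr1.
  rewrite -[_ *: _]/(_ * _) normrM normfV.
  rewrite mulrC ler_pdivrMr ?normr_gt0 //.
  have [h0|h0] := ltP 0 h; last by rewrite /flat ltNge h0 /= normr0 mulr_ge0 // ltW.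
  rewrite (gtr0_norm h0) in h1 he *.
  apply: le_trans (Cp _ h0 (ltW h1)) _; rewrite expr2 mulrA ler_wpM2r ?ltW //.
  rewrite (le_lt_trans (y := (C + 1) * h)) ?ler_wpM2r ?lerDl ?ltW //.
  by rewrite mulrC -ltr_pdivlMr // ltr_wpDl.
Unshelve. all: by end_near. Qed.

Lemma smooth_at_flat (p : {poly R}) (t : R) : smooth_at t (flat p).
Proof.
have fdif q s : differentiable (flat q) s.
  by apply/derivable1_diffP; have [] := is_derive_flat q s.
move=> k; elim: k p => [|k IH] p.
  by near=> y; apply: differentiable_continuous.
split; first by near=> y; exact: fdif.
move=> u.
apply: (@Ck_eq R R _ _ (fun y => (u : R) * flat ('X^2 * (p - p^`())) y)).
  near=> y; have [df <-] := is_derive_flat p y.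
  by rewrite [RHS]derive_R.
by apply: Ck_mul; [exact: Ck_cst | exact: IH].
Unshelve. all: by end_near. Qed.

(** The classical transition function, equal to 0 for t <= 0 and to 1 for t >= 1. Since t and 1 - t
    are never both nonpositive, the denominator is positive. *)
Definition step (t : R) : R := flat 1 t / (flat 1 t + flat 1 (1 - t)).

Lemma flat1_ge0 t : 0 <= flat 1 t.
Proof. by rewrite /flat hornerC mul1r; case: ifP => // _; exact: expR_ge0. Qed.

Lemma flat1_gt0 t : 0 < t -> 0 < flat 1 t.
Proof. by move=> t0; rewrite /flat t0 hornerC mul1r expR_gt0. Qed.

Lemma smooth_at_step t : smooth_at t step.
Proof.
apply: smooth_atM; first exact: smooth_at_flat.
apply: smooth_atV.
  have [t0|t0] := ltP 0 t.
    by rewrite gt_eqF // ltr_pwDl ?flat1_gt0 ?flat1_ge0.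
  by rewrite gt_eqF // ltr_wpDl ?flat1_ge0 // flat1_gt0 // subr_gt0 (le_lt_trans t0).
apply: smooth_atD; first exact: smooth_at_flat.
apply: (@smooth_at_comp R R R t (fun y => 1 - y) (flat 1)).
  by apply: smooth_atB; [exact: smooth_at_cst | exact: smooth_at_id].
exact: smooth_at_flat.
Qed.

Lemma step_le0 t : t <= 0 -> step t = 0.
Proof. by move=> t0; rewrite /step /flat ltNge t0 mul0r. Qed.

Lemma step_ge1 t : 1 <= t -> step t = 1.
Proof.
move=> t1; rewrite /step {3}/flat subr_gt0 ltNge t1 addr0 divff //.
by rewrite gt_eqF // flat1_gt0 // (lt_le_trans _ t1).
Qed.

(* Sum of squares rather than the (non-smooth) sup norm of ['rV_n]. *)
Lemma bump_rV n (x0 : 'rV[R]_n) (r : R) : 0 < r ->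
  exists b : 'rV[R]_n -> R, [/\ forall x, smooth_at x b,
    \forall x \near x0, b x = 1 &
    forall x, b x != 0 -> forall i, `|x 0 i - x0 0 i| <= r].
Proof.
move=> r0; pose q (x : 'rV[R]_n) := \sum_i (x 0 i - x0 0 i) * (x 0 i - x0 0 i).
have qs x : smooth_at x q.
  apply: smooth_at_sum => i; apply: smooth_atM; apply: smooth_atB;
    by [apply: smooth_at_coord; exact: smooth_at_id | exact: smooth_at_cst].
have r20 : 0 < r ^+ 2 by rewrite exprn_gt0.
(* The argument of [step] is at least 1 where q <= r^2/2 and at most 0 where q >= r^2, so the bump
   is nonzero only in the Euclidean ball of radius r, hence in the box. *)
exists (fun x => step (2 - 2 / r ^+ 2 * q x)); split.
- move=> x; apply: (@smooth_at_comp _ _ _ _ (fun x => 2 - 2 / r ^+ 2 * q x) step).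
    by apply: smooth_atB; [exact: smooth_at_cst | apply: smooth_atM; first exact: smooth_at_cst].
  exact: smooth_at_step.
- have q0 : q x0 = 0 by rewrite /q big1 // => i _; rewrite subrr mul0r.
  have : \forall x \near x0, q x < r ^+ 2 / 2.
    have /cvgr_lt : q y @[y --> x0] --> q x0 by exact: (smooth_at_cont (qs x0)).
    by apply; rewrite q0 divr_gt0.
  apply: filterS => x qx; rewrite step_ge1 //.
  rewrite lerBrDr -lerBrDl [2 - 1](_ : _ = 1 :> R); last by rewrite -[2]/(1 + 1) addrK.
  by rewrite mulrC -ler_pdivlMr ?divr_gt0 // mul1r invf_div ltW.
move=> x; apply: contraNP => /existsNP[i /negP]; rewrite -ltNge => ri.
apply/eqP/step_le0; rewrite subr_le0 mulrAC ler_pdivlMr // ler_pM2l //.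
rewrite -real_normK ?num_real // (le_trans (y := `|x 0 i - x0 0 i| ^+ 2)) //.
  by rewrite lerXn2r ?nnegrE ?normr_ge0 // ger0_norm ltW.
rewrite real_normK ?num_real // /q (bigD1 i) //= -expr2 lerDl sumr_ge0 // => j _.
by rewrite -expr2 sqr_ge0.
Qed.

(* The value of the differential on a vector, sealed so that unification does
   not unfold ['d]. *)
Fact dv_key : unit. Proof. exact: tt. Qed.
Definition dv V W (f : V -> W) (x w : V) : W := locked_with dv_key ('d f x w).

Section Dv.
Context {V W : normedModType R}.
Implicit Types (f g : V -> W) (x w : V).

Lemma dvE f x w : dv f x w = 'd f x w.
Proof. by rewrite /dv unlock. Qed.

Lemma dv_is_linear f x : linear (dv f x).
Proof. by move=> k u v; rewrite !dvE linearP. Qed.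

HB.instance Definition _ f x := GRing.isLinear.Build R V W _ (dv f x) (dv_is_linear f x).

Lemma dvZ f x (k : R) w : dv f x (k *: w) = k *: dv f x w.
Proof. exact: linearZ. Qed.

Lemma derive_dv f x w : differentiable f x -> 'D_w f x = dv f x w.
Proof. by move=> fd; rewrite dvE deriveE. Qed.

Lemma dv_eq f g x w : (\forall y \near x, f y = g y) -> differentiable f x ->
  dv g x w = dv f x w.
Proof. by move=> fg fd; rewrite !dvE (near_eq_diff fg fd).2. Qed.

Lemma dv_cst (a : W) x w : dv (fun=> a) x w = 0.
Proof. by rewrite dvE diff_cst. Qed.

Lemma dvD f g x w : differentiable f x -> differentiable g x ->
  dv (fun y => f y + g y) x w = dv f x w + dv g x w.
Proof. by move=> fd gd; rewrite !dvE (diffD fd gd). Qed.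

Lemma dv_scalec (k : R) g x w : differentiable g x ->
  dv (fun y => k *: g y) x w = k *: dv g x w.
Proof. by move=> gd; rewrite !dvE (diffZ k gd). Qed.

Lemma dv_sum (I : Type) (r : seq I) (F : I -> V -> W) x w :
  (forall i, differentiable (F i) x) ->
  dv (fun y => \sum_(i <- r) F i y) x w = \sum_(i <- r) dv (F i) x w.
Proof.
move=> Fd.
suff : differentiable (fun y => \sum_(i <- r) F i y) x /\
  dv (fun y => \sum_(i <- r) F i y) x w = \sum_(i <- r) dv (F i) x w by case.
elim: r => [|i r [IHd IH]].
  have -> : (fun y => \sum_(i <- [::]) F i y) = cst 0.
    by apply/funext => y; rewrite big_nil.
  by split; [exact: differentiable_cst | rewrite dv_cst big_nil].
have -> : (fun y => \sum_(j <- i :: r) F j y) =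
    (fun y => F i y + \sum_(j <- r) F j y).
  by apply/funext => y; rewrite big_cons.
by split; [exact: differentiableD | rewrite dvD // big_cons IH].
Qed.

End Dv.

Lemma dv_scale V W (f : V -> R) (g : V -> W) x w : differentiable f x -> differentiable g x ->
  dv (fun y => f y *: g y) x w = f x *: dv g x w + dv f x w *: g x.
Proof.
by move=> fd gd; have fg := is_diff_scale fd gd; rewrite !dvE diff_val.
Qed.

Lemma dv_id V (x w : V) : dv (fun y => y) x w = w.
Proof.
by rewrite -derive_dv; [exact: derive_id | have [] := is_diff_id x].
Qed.

Lemma dv_comp V W W' (f : V -> W) (g : W -> W') x w :
  differentiable f x -> differentiable g (f x) ->
  dv (fun y => g (f y)) x w = dv g (f x) (dv f x w).
Proof. by move=> fd gd; rewrite !dvE (diff_comp fd gd). Qed.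

Lemma dv_lincomp V W W' (f : V -> W) (L : {linear W -> W'}) x w :
  continuous L -> differentiable f x ->
  dv (fun y => L (f y)) x w = L (dv f x w).
Proof.
move=> Lc fd; rewrite (dv_comp _ fd (linear_differentiable _ Lc)).
by rewrite [LHS]dvE diff_lin.
Qed.

Lemma dv_pair V W W' (f : V -> W) (g : V -> W') x w :
  differentiable f x -> differentiable g x ->
  dv (fun y => (f y, g y)) x w = (dv f x w, dv g x w).
Proof. by move=> fd gd; rewrite !dvE (diff_pair fd gd). Qed.

Lemma dv_coord V n (f : V -> 'rV[R]_n) x w i : differentiable f x ->
  dv (fun y => f y 0 i : R) x w = dv f x w 0 i.
Proof.
move=> fd; have [L [Lc LE]] := coordL i.
have -> : (fun y => f y 0 i : R) = (fun y => L (f y)).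
  by apply/funext => y; rewrite LE.
by rewrite dv_lincomp // LE.
Qed.

Lemma dv_fst V W (x w : V * W) : dv (fun y => y.1) x w = w.1.
Proof.
rewrite (@dv_lincomp _ _ _ (fun y => y) (fst : {linear (V * W)%type -> V})) ?dv_id //.
by move=> y; exact: cvg_fst.
Qed.

Lemma dv_snd V W (x w : V * W) : dv (fun y => y.2) x w = w.2.
Proof.
rewrite (@dv_lincomp _ _ _ (fun y => y) (snd : {linear (V * W)%type -> W})) ?dv_id //.
by move=> y; exact: cvg_snd.
Qed.

Lemma smooth_at_dv V W W' x (f h : V -> W) (g : W -> W') : fdim W ->
  smooth_at x f -> smooth_at x h -> smooth_at (f x) g ->
  smooth_at x (fun y => dv g (f y) (h y)).
Proof.
move=> Wf fs hs gs; rewrite (_ : (fun _ => _) = (fun y => 'd g (f y) (h y))).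
  exact: smooth_at_dapp.
by apply/funext => y; rewrite dvE.
Qed.

Lemma smooth_at_dvr V W (x : V) (f : V -> W) u :
  smooth_at x f -> smooth_at x (fun y => dv f y u).
Proof.
move=> fs; apply: smooth_at_eq (smooth_at_derive u fs).
by apply: filterS (smooth_at_near_diff fs) => y; exact: derive_dv.
Qed.

Lemma derive2_dv V W (x : V) (f : V -> W) a b : smooth_at x f ->
  'D_a ('D_b f) x = dv (fun y => dv f y b) x a.
Proof.
move=> fs; have dD := smooth_at_diff (smooth_at_derive b fs).
rewrite (derive_dv _ dD); symmetry; apply: dv_eq dD.
by apply: filterS (smooth_at_near_diff fs) => y; exact: derive_dv.
Qed.

Lemma dv2_linear V W (x : V) (f : V -> W) a : smooth_at x f ->
  linear (fun b => dv (fun y => dv f y b) x a).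
Proof.
move=> fs k u v.
have du := smooth_at_diff (smooth_at_dvr u fs).
have dw := smooth_at_diff (smooth_at_dvr v fs).
have -> : (fun y => dv f y (k *: u + v)) = (fun y => k *: dv f y u + dv f y v).
  by apply/funext => y; rewrite linearP.
by rewrite (dvD _ (differentiableZ k du) dw) (dv_scalec _ _ du).
Qed.

(** The map (x, y) |-> df_x(y) is linear in y, so expanding y in a basis reduces the rule to
    products of a coordinate of y and a function of x. The first term is the source of every Hessian
    in the changes of natural coordinates. *)
Lemma dv_dapp V W (f : V -> W) (z w : V * V) : fdim V -> smooth_at z.1 f ->
  dv (fun z => dv f z.1 z.2) z w =
  dv (fun x => dv f x z.2) z.1 w.1 + dv f z.1 w.2.
Proof.
move=> [I [b [c [cc bE]]]] fs.
have d1 := smooth_at_diff (smooth_at_fst z).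
have d2 := smooth_at_diff (smooth_at_snd z).
have dj i := smooth_at_diff (smooth_at_dvr (b i) fs).
have ds i : differentiable (fun z => dv f z.1 (b i)) z.
  exact: (differentiable_comp d1 (dj i)).
have dc i : differentiable (fun z : V * V => c i z.2) z.
  exact: smooth_at_diff (smooth_at_lincomp (cc i) (smooth_at_snd z)).
have dsc i : differentiable (fun z : V * V => c i z.2 *: dv f z.1 (b i)) z.
  by have [] := is_diff_scale (dc i) (ds i).
have E x y : dv f x y = \sum_i c i y *: dv f x (b i).
  by rewrite {1}(bE y) linear_sum; apply: eq_bigr => i _; rewrite linearZ.
have -> : (fun z => dv f z.1 z.2) = (fun z => \sum_i c i z.2 *: dv f z.1 (b i)).
  by apply/funext => y.
have -> : (fun x => dv f x z.2) = (fun x => \sum_i c i z.2 *: dv f x (b i)).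
  by apply/funext => y.
rewrite (dv_sum _ _ dsc) dv_sum => [|i]; last exact: differentiableZ.
rewrite (E z.1 w.2) -big_split; apply: eq_bigr => i _ /=.
rewrite (dv_scale _ (dc i) (ds i)) (dv_scalec _ _ (dj i)); congr (_ *: _ + _ *: _).
  by rewrite (dv_comp _ d1 (dj i)) dv_fst.
by rewrite (dv_lincomp _ (cc i) d2) dv_snd.
Qed.

Lemma dv_comp_eq V W W' (f : V -> W) (g : W -> W') (h : V -> W') x y w :
  f x = y -> (\forall z \near x, g (f z) = h z) ->
  differentiable f x -> differentiable g y ->
  dv h x w = dv g y (dv f x w).
Proof.
move=> <- fgh fd gd; rewrite -(dv_comp _ fd gd); apply: dv_eq fgh _.
exact: differentiable_comp.
Qed.

Lemma smooth_at_dv_pull V W W' (x : V) y (T : V -> W) (F : W -> W)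
    (g : W -> W') : fdim W -> T x = y ->
  smooth_at x T -> smooth_at y F -> smooth_at y g ->
  smooth_at x (fun z => dv g (T z) (F (T z))).
Proof.
move=> Wf <- Ts Fs gs; apply: smooth_at_dv => //.
exact: (@smooth_at_comp _ _ _ _ T F).
Qed.

Lemma dv_section_change V (T : V * V -> V * V) (S S' : V * V -> V) (t : V -> V)
    z z' w a : fdim V -> T z = z' -> S z = a ->
  (\forall x \near z, S' (T x) = dv t x.1 (S x)) ->
  differentiable T z -> smooth_at z S -> differentiable S' z' -> smooth_at z.1 t ->
  dv S' z' (dv T z w) = dv (fun x => dv t x a) z.1 w.1 + dv t z.1 (dv S z w).
Proof.
move=> Vf TE <- SE Td Ss S'd ts.
have Sd := smooth_at_diff Ss.
have d1 := smooth_at_diff (smooth_at_fst z).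
have gd : differentiable (fun p => dv t p.1 p.2) (z.1, S z).
  apply: smooth_at_diff; apply: (@smooth_at_dv _ _ _ _ fst snd t) => //.
    exact: smooth_at_fst.
  exact: smooth_at_snd.
rewrite -(dv_comp_eq w TE SE Td S'd).
have pd : differentiable (fun x => (x.1, S x)) z by exact: differentiable_pair.
rewrite (dv_comp (g := fun p => dv t p.1 p.2) w pd gd).
by rewrite (dv_pair _ d1 Sd) dv_fst dv_dapp.
Qed.

End Germs.

Global Opaque dv.

(** * Charts, cutoffs and extension of local fields *)

Section Charts.
Context {R : realType} {n : nat} {M : manifold R n}.
Local Notation Rn := 'rV[R]_n.
Implicit Types (e : chart M) (p : M).

(** [cinv e] is meaningful on the image of the chart only, so a local property is always transported
    together with the domain and inverse identities. *)
Lemma near_cmap e p (P : M -> Prop) : cdom e p -> (\forall q \near p, P q) ->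
  \forall x \near cmap e p,
    [/\ cdom e (cinv e x), cmap e (cinv e x) = x & P (cinv e x)].
Proof.
move=> ep Pp.
have ex : (cmap e @` cdom e) (cmap e p) by exists p.
have : \forall x \near cmap e p, (cmap e @` cdom e) x.
  by apply: open_nbhs_nbhs; split=> //; exact: cimg_open.
have : \forall x \near cmap e p, P (cinv e x).
  by apply: (cinv_continuous ex); rewrite cmapK.
apply: filterS2 => x Px [q eq qx]; rewrite -qx cmapK // in Px *.
Qed.

Lemma near_cdom e p : cdom e p -> \forall q \near p, cdom e q.
Proof. by move=> ep; apply: open_nbhs_nbhs; split=> //; exact: cdom_open. Qed.

Lemma transE e e' p : cdom e p -> trans e e' (cmap e p) = cmap e' p.
Proof. by move=> ep; rewrite /trans /= cmapK. Qed.

Lemma overlap_open e e' : open (cmap e @` (cdom e `&` cdom e')).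
Proof.
rewrite openE => _ [p [ep e'p] <-].
apply: filterS (near_cmap ep (near_cdom e'p)) => x [ex xE e'x].
by exists (cinv e x).
Qed.

Lemma smooth_at_trans e e' p : cdom e p -> cdom e' p ->
  smooth_at (cmap e p) (trans e e').
Proof.
move=> ep e'p; have := @trans_smooth _ _ M e e'.
by move=> /(smooth_onP _ (@overlap_open e e')); apply; exists p.
Qed.

Definition jac e e' p (w : Rn) : Rn := dv (trans e e') (cmap e p) w.

Definition hess e e' p (a b : Rn) : Rn :=
  dv (fun x => dv (trans e e') x b) (cmap e p) a.

Lemma jac_is_linear e e' p : linear (jac e e' p).
Proof. by move=> k u v; rewrite /jac linearP. Qed.

HB.instance Definition _ e e' p :=
  GRing.isLinear.Build R Rn Rn _ (jac e e' p) (jac_is_linear e e' p).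

Lemma jac_comp e e' e'' p w : cdom e p -> cdom e' p -> cdom e'' p ->
  jac e' e'' p (jac e e' p w) = jac e e'' p w.
Proof.
move=> ep e'p e''p; rewrite /jac.
have de := smooth_at_diff (smooth_at_trans ep e'p).
have de' := smooth_at_diff (smooth_at_trans e'p e''p).
symmetry; apply: (dv_comp_eq _ (transE e' ep) _ de de').
apply: filterS (near_cmap ep (near_cdom e'p)) => x [ex xE e'x].
by rewrite -xE !transE.
Qed.

Lemma jac_id e p w : cdom e p -> jac e e p w = w.
Proof.
move=> ep; rewrite /jac -[RHS](dv_id (cmap e p)).
apply: dv_eq; last by have [] := is_diff_id (cmap e p).
by apply: filterS (near_cmap ep (near_cdom ep)) => x [_ xE _]; rewrite /trans /= xE.
Qed.

Lemma jacK e e' p w : cdom e p -> cdom e' p -> jac e' e p (jac e e' p w) = w.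
Proof. by move=> ep e'p; rewrite jac_comp // jac_id. Qed.

Lemma hess_linl e e' p b : linear (fun a => hess e e' p a b).
Proof. by move=> k u v; rewrite /hess linearP. Qed.

Lemma hess_linr e e' p a : cdom e p -> cdom e' p -> linear (hess e e' p a).
Proof.
by move=> ep e'p; exact: (dv2_linear _ (smooth_at_trans ep e'p)).
Qed.

Lemma dtransE e e' p i j : cdom e p -> cdom e' p ->
  dtrans e e' p i j = jac e e' p (delta_mx 0 j) 0 i.
Proof.
by move=> ep e'p; rewrite /dtrans derive_dv //; exact: smooth_at_diff (smooth_at_trans ep e'p).
Qed.

Lemma d2transE e e' p i j k : cdom e p -> cdom e' p ->
  d2trans e e' p i j k = hess e e' p (delta_mx 0 j) (delta_mx 0 k) 0 i.
Proof.
by move=> ep e'p; rewrite /d2trans (derive2_dv _ _ (smooth_at_trans ep e'p)).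
Qed.

Lemma row_delta (v : Rn) : v = \sum_j v 0 j *: delta_mx 0 j.
Proof. exact: row_sum_delta. Qed.

Lemma pair_delta (w : Rn * Rn) :
  w = \sum_j w.1 0 j *: (delta_mx 0 j, 0) + \sum_j w.2 0 j *: (0, delta_mx 0 j).
Proof.
have fst_sum (F : 'I_n -> Rn * Rn) : (\sum_j F j).1 = \sum_j (F j).1.
  exact: (raddf_sum (fst : {additive Rn * Rn -> Rn})).
have snd_sum (F : 'I_n -> Rn * Rn) : (\sum_j F j).2 = \sum_j (F j).2.
  exact: (raddf_sum (snd : {additive Rn * Rn -> Rn})).
case: w => a b; apply/pair_equal_spec; rewrite /= !fst_sum !snd_sum /=; split.
  by rewrite [X in _ + X]big1 ?addr0 -?row_delta // => j _; rewrite scaler0.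
by rewrite [X in X + _]big1 ?add0r -?row_delta // => j _; rewrite scaler0.
Qed.

Lemma jac_sum e e' p w i : cdom e p -> cdom e' p ->
  jac e e' p w 0 i = \sum_j dtrans e e' p i j * w 0 j.
Proof.
move=> ep e'p; rewrite {1}(row_delta w) linear_sum summxE; apply: eq_bigr => j _.
by rewrite linearZ mxE dtransE // mulrC.
Qed.

Lemma hess_sumr e e' p a b : cdom e p -> cdom e' p ->
  hess e e' p a b = \sum_k b 0 k *: hess e e' p a (delta_mx 0 k).
Proof.
move=> ep e'p.
pose hr := GRing.isLinear.Build _ _ _ _ _ (hess_linr a ep e'p).
pose hR : {linear Rn -> Rn} := HB.pack (hess e e' p a) hr.
rewrite -[LHS]/(hR b) {1}(row_delta b) linear_sum.
by apply: eq_bigr => k _; rewrite linearZ.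
Qed.

Lemma hessZr e e' p a b (k : R) : cdom e p -> cdom e' p ->
  hess e e' p a (k *: b) = k *: hess e e' p a b.
Proof.
move=> ep e'p; rewrite hess_sumr // [in RHS]hess_sumr // scaler_sumr.
by apply: eq_bigr => j _; rewrite mxE scalerA.
Qed.

Lemma hess_suml e e' p a b :
  hess e e' p a b = \sum_j a 0 j *: hess e e' p (delta_mx 0 j) b.
Proof.
pose hl := GRing.isLinear.Build _ _ _ _ _ (hess_linl e e' p b).
pose hL : {linear Rn -> Rn} := HB.pack (fun a => hess e e' p a b) hl.
rewrite -[LHS]/(hL a) {1}(row_delta a) linear_sum.
by apply: eq_bigr => k _; rewrite linearZ.
Qed.

Lemma tcompE e p w : tcomp e p w = jac (chart_at p) e p w.
Proof. by rewrite /jac dvE. Qed.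

Lemma tvecE e p w : tvec e p w = jac e (chart_at p) p w.
Proof. by rewrite /jac dvE. Qed.

Lemma tcomp_is_linear e p : linear (tcomp e p).
Proof. by move=> k a b; rewrite !tcompE linearP. Qed.

HB.instance Definition _ e p :=
  GRing.isLinear.Build R Rn Rn _ (tcomp e p) (tcomp_is_linear e p).

Lemma tcompD e p a b : tcomp e p (a + b) = tcomp e p a + tcomp e p b.
Proof. exact: linearD. Qed.

Lemma tcompZ e p (k : R) a : tcomp e p (k *: a) = k *: tcomp e p a.
Proof. exact: linearZ. Qed.

Lemma tcomp0 e p : tcomp e p 0 = 0.
Proof. exact: linear0. Qed.

Lemma tcomp_sum e p (F : 'I_n -> Rn) :
  tcomp e p (\sum_k F k) = \sum_k tcomp e p (F k).
Proof. exact: linear_sum. Qed.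

Lemma tvec_is_linear e p : linear (tvec e p).
Proof. by move=> k a b; rewrite !tvecE linearP. Qed.

HB.instance Definition _ e p :=
  GRing.isLinear.Build R Rn Rn _ (tvec e p) (tvec_is_linear e p).

Lemma tcompK e p : cdom e p -> cancel (tcomp e p) (tvec e p).
Proof. by move=> ep w; rewrite tcompE tvecE jacK //; exact: chart_at_dom. Qed.

Lemma tvecK e p : cdom e p -> cancel (tvec e p) (tcomp e p).
Proof. by move=> ep w; rewrite tcompE tvecE jacK //; exact: chart_at_dom. Qed.

Lemma jac_tcomp e e' p w : cdom e p -> cdom e' p ->
  jac e e' p (tcomp e p w) = tcomp e' p w.
Proof. by move=> ep e'p; rewrite !tcompE jac_comp //; exact: chart_at_dom. Qed.

Lemma tcomp_chart_at p w : tcomp (chart_at p) p w = w.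
Proof. by rewrite tcompE jac_id //; exact: chart_at_dom. Qed.

Lemma tinvK e v : cdom e (foot v) -> tinv e (tcoord e v) = v.
Proof.
by case: v => p w ep; rewrite /tinv /tcoord /= cmapK // tcompK.
Qed.

Lemma tcoordK e z : cdom e (cinv e z.1) -> cmap e (cinv e z.1) = z.1 ->
  tcoord e (tinv e z) = z.
Proof. by case: z => x y /= ex xE; rewrite /tcoord /= xE tvecK. Qed.

Lemma ttrans_tcoord e e' v : cdom e (foot v) -> cdom e' (foot v) ->
  ttrans e e' (tcoord e v) = tcoord e' v.
Proof.
by move=> ep e'p; rewrite /ttrans /tcoord /= transE // -dvE -[X in (_, X)]/(jac e e' _ _) jac_tcomp.
Qed.

Lemma near_tcoord e v (P : M -> Prop) : cdom e (foot v) ->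
  (\forall q \near foot v, P q) ->
  \forall z \near tcoord e v, [/\ cdom e (foot (tinv e z)),
    tcoord e (tinv e z) = z & P (foot (tinv e z))].
Proof.
move=> ep Pp; have := near_cmap ep Pp.
move=> cPp.
have : \forall z \near tcoord e v, [/\ cdom e (cinv e z.1),
    cmap e (cinv e z.1) = z.1 & P (cinv e z.1)] by exact: cvg_fst cPp.
by apply: filterS => z [ez zE Pz]; split=> //; exact: tcoordK.
Qed.

Lemma ttransE e e' :
  ttrans e e' = (fun z => (trans e e' z.1, dv (trans e e') z.1 z.2)).
Proof. by apply/funext => z; rewrite dvE. Qed.

Lemma smooth_at_ttrans e e' v : cdom e (foot v) -> cdom e' (foot v) ->
  smooth_at (tcoord e v) (ttrans e e').
Proof.
move=> ep e'p; rewrite ttransE.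
apply: smooth_at_pair.
  apply: (@smooth_at_comp _ _ _ _ _ fst (trans e e')).
    exact: smooth_at_fst.
  exact: smooth_at_trans.
apply: (@smooth_at_dv _ _ _ _ _ fst snd (trans e e')).
- exact: smooth_at_fst.
- exact: smooth_at_snd.
- exact: smooth_at_trans.
Qed.

Definition tjac e e' v (w : Rn * Rn) : Rn * Rn := dv (ttrans e e') (tcoord e v) w.

Lemma tjac_is_linear e e' v : linear (tjac e e' v).
Proof. by move=> k a b; rewrite /tjac linearP. Qed.

HB.instance Definition _ e e' v := GRing.isLinear.Build R (Rn * Rn)%type
  (Rn * Rn)%type _ (tjac e e' v) (tjac_is_linear e e' v).

Lemma tjacE e e' v w : cdom e (foot v) -> cdom e' (foot v) ->
  tjac e e' v w = (jac e e' (foot v) w.1,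
    hess e e' (foot v) w.1 (tcoord e v).2 + jac e e' (foot v) w.2).
Proof.
move=> ep e'p; rewrite /tjac ttransE.
have ts := smooth_at_trans ep e'p.
have d1 : differentiable (fun z : Rn * Rn => z.1) (tcoord e v).
  exact: smooth_at_diff (smooth_at_fst _).
rewrite dv_pair; last 2 first.
- exact: (differentiable_comp d1 (smooth_at_diff ts)).
- apply: smooth_at_diff; apply: (@smooth_at_dv _ _ _ _ _ fst snd (trans e e')) => //.
    exact: smooth_at_fst.
  exact: smooth_at_snd.
congr (_, _); first by rewrite (dv_comp _ d1 (smooth_at_diff ts)) dv_fst.
exact: dv_dapp.
Qed.

Lemma tjac_comp e e' e'' v w :
  cdom e (foot v) -> cdom e' (foot v) -> cdom e'' (foot v) ->
  tjac e' e'' v (tjac e e' v w) = tjac e e'' v w.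
Proof.
move=> ep e'p e''p; rewrite /tjac.
have de := smooth_at_diff (smooth_at_ttrans ep e'p).
have de' := smooth_at_diff (smooth_at_ttrans e'p e''p).
symmetry; apply: (dv_comp_eq _ (ttrans_tcoord ep e'p) _ de de').
apply: filterS (near_tcoord ep (filterI (near_cdom e'p) (near_cdom e''p))).
by move=> z [ez zE [e'z e''z]]; rewrite -zE !ttrans_tcoord.
Qed.

Lemma tjac_id e v w : cdom e (foot v) -> tjac e e v w = w.
Proof.
move=> ep; rewrite /tjac -[RHS](dv_id (tcoord e v)).
apply: dv_eq; last exact: smooth_at_diff (smooth_at_id _).
by apply: filterS (near_tcoord ep (near_cdom ep)) => z [ez zE _]; rewrite -zE ttrans_tcoord.
Qed.

Lemma tjacK e e' v w : cdom e (foot v) -> cdom e' (foot v) ->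
  tjac e' e v (tjac e e' v w) = w.
Proof. by move=> ep e'p; rewrite tjac_comp // tjac_id. Qed.

Lemma xcompE e v w : xcomp e v w = tjac (chart_at (foot v)) e v w.
Proof. by rewrite /tjac dvE. Qed.

Lemma xcomp_is_linear e (v : TM M) : linear (xcomp e v).
Proof. by move=> k a b; rewrite !xcompE linearP. Qed.

HB.instance Definition _ e v := GRing.isLinear.Build R (Rn * Rn)%type
  (Rn * Rn)%type _ (xcomp e v) (xcomp_is_linear e v).

Lemma xcompD e (v : TM M) a b : xcomp e v (a + b) = xcomp e v a + xcomp e v b.
Proof. exact: linearD. Qed.

Lemma xcompZ e (v : TM M) (k : R) a : xcomp e v (k *: a) = k *: xcomp e v a.
Proof. exact: linearZ. Qed.

Lemma xcomp0 e (v : TM M) : xcomp e v 0 = 0.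
Proof. exact: linear0. Qed.

Lemma xcomp_sum e (v : TM M) (I : finType) (F : I -> Rn * Rn) :
  xcomp e v (\sum_k F k) = \sum_k xcomp e v (F k).
Proof. exact: linear_sum. Qed.

Lemma tjac_xcomp e e' v w : cdom e (foot v) -> cdom e' (foot v) ->
  tjac e e' v (xcomp e v w) = xcomp e' v w.
Proof. by move=> ep e'p; rewrite !xcompE tjac_comp //; exact: chart_at_dom. Qed.

Lemma xcomp_chart_at (v : TM M) w : xcomp (chart_at (foot v)) v w = w.
Proof. by rewrite xcompE tjac_id //; exact: chart_at_dom. Qed.

Lemma xcomp_inj e v : cdom e (foot v) -> injective (xcomp e v).
Proof.
move=> ev w1 w2 /(congr1 (tjac e (chart_at (foot v)) v)).
by rewrite !xcompE !tjacK //; exact: chart_at_dom.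
Qed.

(** Allows smoothness of a function built from one chart to be checked in that chart alone. *)
Lemma smooth_at_chart (W : normedModType R) e e' v (F : TM M -> W) :
  cdom e (foot v) -> cdom e' (foot v) ->
  smooth_at (tcoord e v) (F \o tinv e) -> smooth_at (tcoord e' v) (F \o tinv e').
Proof.
move=> ep e'p Fs.
apply: (@smooth_at_eq _ _ _ _ (fun z => (F \o tinv e) (ttrans e' e z))).
  apply: filterS (near_tcoord e'p (near_cdom ep)) => z [e'z zE ez].
  by rewrite /= -{1}zE ttrans_tcoord // tinvK.
apply: smooth_at_comp; first exact: smooth_at_ttrans.
by rewrite ttrans_tcoord.
Qed.

(* Compactness of the closed box and the Hausdorff property make the
   extension by 0 smooth. *)
Lemma bump_manifold e p0 : cdom e p0 ->
  exists b : M -> R, [/\ forall e' p, cdom e' p -> smooth_at (cmap e' p) (b \o cinv e'),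
    \forall q \near p0, b q = 1 &
    forall p, ~ cdom e p -> \forall q \near p, b q = 0].
Proof.
move=> ep0; have /nbhs_ballP[r /= r0 rU] : nbhs (cmap e p0) (cmap e @` cdom e).
  by apply: open_nbhs_nbhs; split; [exact: cimg_open | exists p0].
have r20 : 0 < r / 2 by rewrite divr_gt0.
(* Half the radius keeps the closed box inside the open ball of radius r, which lies in the image of
   the chart. *)
pose K := [set x : Rn | forall i, `[cmap e p0 0 i - r / 2, cmap e p0 0 i + r / 2]%classic (x 0 i)].
have Kc : compact K.
  apply: (@rV_compact R n
    (fun i => `[cmap e p0 0 i - r / 2, cmap e p0 0 i + r / 2]%classic)) => i.
  exact: segment_compact.
have KU : K `<=` cmap e @` cdom e.
  move=> x Kx; apply: rU; split=> // i j; rewrite (ord1 i) /ball /=.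
  have := Kx j; rewrite /= in_itv /= => /andP[h1 h2].
  rewrite ltr_norml; apply/andP; split; lra.
have [b [bs b1 b0]] := bump_rV (cmap e p0) r20.
pose bM q := if `[< cdom e q >] then b (cmap e q) else 0.
have KMc : closed (cinv e @` K).
  apply: compact_closed; first exact: mspace_hausdorff.
  apply: continuous_compact => //; apply: continuous_in_subspaceT => x.
  by rewrite inE => /KU /cinv_continuous.
(* The image of K in M is closed and contained in the domain of e; its complement is therefore a
   neighbourhood of p, and [bM] vanishes there. *)
have bM0 p : ~ cdom e p -> \forall q \near p, bM q = 0.
  move=> ep; have : \forall q \near p, (~` (cinv e @` K)) q.
    apply: open_nbhs_nbhs; split; first exact: closed_openC.
    by move=> [x /KU [q eq <-]]; rewrite cmapK // => qp; apply: ep; rewrite -qp.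
  apply: filterS => q nKq; rewrite /bM; case: asboolP => // eq.
  apply: contrapT => /eqP bq; apply: nKq; exists (cmap e q); last by rewrite cmapK.
  move=> i; rewrite /= in_itv /=; have := b0 _ bq i; rewrite ler_norml => /andP[h1 h2].
  apply/andP; split; lra.
exists bM; split=> //.
- move=> e' p e'p; have [ep|nep] := pselect (cdom e p).
    apply: (@smooth_at_eq _ _ _ _ (fun x => b (trans e' e x))).
      apply: filterS (near_cmap e'p (near_cdom ep)) => x [e'x xE ex].
      by rewrite /bM /= asboolT.
    apply: smooth_at_comp; [exact: smooth_at_trans | exact: bs].
  apply: (@smooth_at_eq _ _ _ _ (fun x => 0)); last exact: smooth_at_cst.
  by apply: filterS (near_cmap e'p (bM0 _ nep)) => x [_ _ bx]; rewrite /= bx.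
- have : \forall q \near p0, b (cmap e q) = 1 by exact: (cmap_continuous ep0 b1).
  by apply: filterS2 (near_cdom ep0) => q eq; rewrite /bM asboolT.
Qed.

(** * Smoothness over the cone and extension of local fields by a cutoff *)

Section Fields.
Context {A : cone M}.
Implicit Types (v : TM M).

Lemma open_tloc e : open (tloc A e). Proof. exact: car_open. Qed.

Lemma tloc_tcoord e v : A v -> cdom e (foot v) -> tloc A e (tcoord e v).
Proof. by move=> Av ev; split; [exists (foot v) | rewrite tinvK]. Qed.

Lemma near_tloc e v (P : M -> Prop) : A v -> cdom e (foot v) ->
  (\forall q \near foot v, P q) ->
  \forall z \near tcoord e v, [/\ A (tinv e z), cdom e (foot (tinv e z)),
    tcoord e (tinv e z) = z & P (foot (tinv e z))].
Proof.
move=> Av ev Pv.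
have : \forall z \near tcoord e v, tloc A e z.
  by apply: open_nbhs_nbhs; split; [exact: open_tloc | exact: tloc_tcoord].
by apply: filterS2 (near_tcoord ev Pv) => z [ez zE Pz] [].
Qed.

(** The points of [tloc A e] are exactly the coordinates of the vectors of A over the domain of e,
    so smoothness can be tested vector by vector. *)
Lemma smooth_on_tloc (W : normedModType R) e (F : Rn * Rn -> W) :
  smooth_on (tloc A e) F <->
  (forall v, A v -> cdom e (foot v) -> smooth_at (tcoord e v) F).
Proof.
rewrite (smooth_onP _ (@open_tloc e)); split=> [Fs v Av ev|Fs z [[p ep pz] Az]].
  exact/Fs/tloc_tcoord.
have ez : cdom e (cinv e z.1) by rewrite -pz cmapK.
by rewrite -(@tcoordK e z) //; [exact: Fs | rewrite -pz cmapK].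
Qed.

Lemma smooth_funP (f : TM M -> R) : smooth_fun A f <->
  (forall e v, A v -> cdom e (foot v) -> smooth_at (tcoord e v) (f \o tinv e)).
Proof.
split=> [fs e|fs e]; first by have /smooth_on_tloc := fs e.
by apply/smooth_on_tloc; exact: fs.
Qed.

Lemma srep_tcoord e (Y : TM M -> Rn) v : cdom e (foot v) ->
  srep e Y (tcoord e v) = tcomp e (foot v) (Y v).
Proof. by move=> ev; rewrite /srep tinvK. Qed.

Lemma xrep_tcoord e (X : TM M -> Rn * Rn) v : cdom e (foot v) ->
  xrep e X (tcoord e v) = xcomp e v (X v).
Proof. by move=> ev; rewrite /xrep tinvK. Qed.

Lemma smooth_at_srep_chart e e' (Y : TM M -> Rn) v :
  cdom e (foot v) -> cdom e' (foot v) ->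
  smooth_at (tcoord e v) (srep e Y) -> smooth_at (tcoord e' v) (srep e' Y).
Proof.
move=> ev e'v Ys.
pose T z := ttrans e' e z.
have Ts : smooth_at (tcoord e' v) T by exact: smooth_at_ttrans.
have TE : T (tcoord e' v) = tcoord e v by exact: ttrans_tcoord.
apply: (@smooth_at_eq _ _ _ _ (fun z => dv (trans e e') (T z).1 (srep e Y (T z)))).
  apply: filterS (near_tcoord e'v (near_cdom ev)) => z [e'z zE ez].
  rewrite /T -zE ttrans_tcoord // !srep_tcoord //.
  by rewrite -[LHS]/(jac e e' _ _) jac_tcomp.
apply: (@smooth_at_dv _ _ _ _ _ (fun z => (T z).1) (fun z => srep e Y (T z))).
- by apply: (@smooth_at_comp _ _ _ _ _ T fst) => //; exact: smooth_at_fst.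
- by apply: (@smooth_at_comp _ _ _ _ _ T (srep e Y)) => //; rewrite TE.
- by rewrite TE; exact: smooth_at_trans.
Qed.

Lemma smooth_at_xrep_chart e e' (X : TM M -> Rn * Rn) v :
  cdom e (foot v) -> cdom e' (foot v) ->
  smooth_at (tcoord e v) (xrep e X) -> smooth_at (tcoord e' v) (xrep e' X).
Proof.
move=> ev e'v Xs.
pose T z := ttrans e' e z.
have Ts : smooth_at (tcoord e' v) T by exact: smooth_at_ttrans.
have TE : T (tcoord e' v) = tcoord e v by exact: ttrans_tcoord.
apply: (@smooth_at_eq _ _ _ _ (fun z => dv (ttrans e e') (T z) (xrep e X (T z)))).
  apply: filterS (near_tcoord e'v (near_cdom ev)) => z [e'z zE ez].
  rewrite /T -zE ttrans_tcoord // !xrep_tcoord //.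
  by rewrite -[LHS]/(tjac e e' _ _) tjac_xcomp.
exact: (smooth_at_dv_pull _ TE Ts Xs (smooth_at_ttrans ev e'v)).
Qed.

(** The second clause asks for vanishing near every point outside the domain of e, not only at it,
    so that products extended by 0 have the zero germ there. *)
Definition cutoff e (b : M -> R) :=
  (forall e' p, cdom e' p -> smooth_at (cmap e' p) (b \o cinv e')) /\
  (forall p, ~ cdom e p -> \forall q \near p, b q = 0).

Lemma cutoff_exists e p : cdom e p ->
  exists b, cutoff e b /\ \forall q \near p, b q = 1.
Proof. by move=> /bump_manifold[b [bs b1 b0]]; exists b. Qed.

Lemma smooth_at_cutoff e b e' v : cutoff e b -> cdom e' (foot v) ->
  smooth_at (tcoord e' v) (fun z => b (cinv e' z.1)).
Proof.
move=> [bs _] e'v; apply: (@smooth_at_comp _ _ _ _ _ fst (b \o cinv e')).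
  exact: smooth_at_fst.
exact: bs.
Qed.

Section Extend.
Variables (e : chart M) (b : M -> R) (bc : cutoff e b).

Definition inU v := `[< A v /\ cdom e (foot v) >].

Lemma near_off (W : normedModType R) e' v (F : TM M -> W) :
  A v -> cdom e' (foot v) -> ~ cdom e (foot v) ->
  (forall u, b (foot u) = 0 -> F u = 0) ->
  smooth_at (tcoord e' v) (fun z => F (tinv e' z)).
Proof.
move=> Av e'v nev F0; apply: (@smooth_at_eq _ _ _ _ (fun=> 0)); last exact: smooth_at_cst.
apply: filterS (near_tcoord e'v (bc.2 _ nev)) => z [_ _ bz].
by rewrite F0.
Qed.

Definition fext (f : Rn * Rn -> R) (u : TM M) : R :=
  if inU u then b (foot u) * f (tcoord e u) else 0.

Lemma fext_in f u : A u -> cdom e (foot u) ->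
  fext f u = b (foot u) * f (tcoord e u).
Proof. by move=> Au eu; rewrite /fext /inU asboolT. Qed.

Lemma fext_smooth f : smooth_on (tloc A e) f -> smooth_fun A (fext f).
Proof.
move=> /smooth_on_tloc fs; apply/smooth_funP => e' v Av e'v.
have [ev|nev] := pselect (cdom e (foot v)); last first.
  by apply: near_off => // u bu; rewrite /fext bu mul0r if_same.
apply: (smooth_at_chart ev e'v).
apply: (@smooth_at_eq _ _ _ _ (fun z => b (cinv e z.1) * f z)).
  apply: filterS (near_tloc Av ev (near_cdom ev)) => z [Az ez zE _].
  by rewrite /= fext_in // zE.
by apply: smooth_atM; [exact: (smooth_at_cutoff bc) | exact: fs].
Qed.

Definition sext_fun (Y : Rn * Rn -> Rn) (u : TM M) : Rn :=
  if inU u then b (foot u) *: tvec e (foot u) (Y (tcoord e u)) else 0.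

Lemma sext_exists (Y : Rn * Rn -> Rn) : smooth_on (tloc A e) Y ->
  exists Y' : sect A,
    (forall u, A u -> cdom e (foot u) ->
      tcomp e (foot u) (Y' u) = b (foot u) *: Y (tcoord e u)) /\
    (forall u, ~ cdom e (foot u) -> Y' u = 0).
Proof.
move=> /smooth_on_tloc Ys.
have inE u : A u -> cdom e (foot u) ->
    tcomp e (foot u) (sext_fun Y u) = b (foot u) *: Y (tcoord e u).
  move=> Au eu; rewrite /sext_fun /inU asboolT //.
  by rewrite tcompZ tvecK.
have sm e' : smooth_on (tloc A e') (srep e' (sext_fun Y)).
  apply/smooth_on_tloc => v Av e'v.
  have [ev|nev] := pselect (cdom e (foot v)); last first.
    apply: (@near_off _ e' v (fun u => tcomp e' (foot u) (sext_fun Y u))) => // u bu.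
    by rewrite /sext_fun bu scale0r if_same tcomp0.
  apply: (smooth_at_srep_chart ev e'v).
  apply: (@smooth_at_eq _ _ _ _ (fun z => b (cinv e z.1) *: Y z)).
    apply: filterS (near_tloc Av ev (near_cdom ev)) => z [Az ez zE _].
    by rewrite /srep inE // zE.
  by apply: smooth_atZ; [exact: (smooth_at_cutoff bc) | exact: Ys].
have off v : ~ A v -> sext_fun Y v = 0.
  by move=> nA; rewrite /sext_fun /inU asboolF // => -[].
exists (Sect sm off); split=> // u nu /=.
by rewrite /sext_fun /inU asboolF // => -[].
Qed.

Definition xext_fun (X : Rn * Rn -> Rn * Rn) (u : TM M) : Rn * Rn :=
  if inU u then b (foot u) *: tjac e (chart_at (foot u)) u (X (tcoord e u)) else 0.

Lemma xext_exists (X : Rn * Rn -> Rn * Rn) : smooth_on (tloc A e) X ->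
  exists X' : vfield A,
    (forall u, A u -> cdom e (foot u) ->
      xcomp e u (X' u) = b (foot u) *: X (tcoord e u)) /\
    (forall u, ~ cdom e (foot u) -> X' u = 0).
Proof.
move=> /smooth_on_tloc Xs.
have inE u : A u -> cdom e (foot u) ->
    xcomp e u (xext_fun X u) = b (foot u) *: X (tcoord e u).
  move=> Au eu; rewrite /xext_fun /inU asboolT //.
  by rewrite xcompZ xcompE tjacK //; exact: chart_at_dom.
have sm e' : smooth_on (tloc A e') (xrep e' (xext_fun X)).
  apply/smooth_on_tloc => v Av e'v.
  have [ev|nev] := pselect (cdom e (foot v)); last first.
    apply: (@near_off _ e' v (fun u => xcomp e' u (xext_fun X u))) => // u bu.
    by rewrite /xext_fun bu scale0r if_same xcomp0.
  apply: (smooth_at_xrep_chart ev e'v).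
  apply: (@smooth_at_eq _ _ _ _ (fun z => b (cinv e z.1) *: X z)).
    apply: filterS (near_tloc Av ev (near_cdom ev)) => z [Az ez zE _].
    by rewrite /xrep inE // zE.
  by apply: smooth_atZ; [exact: (smooth_at_cutoff bc) | exact: Xs].
have off v : ~ A v -> xext_fun X v = 0.
  by move=> nA; rewrite /xext_fun /inU asboolF // => -[].
exists (VField sm off); split=> // u nu /=.
by rewrite /xext_fun /inU asboolF // => -[].
Qed.

End Extend.

End Fields.

End Charts.

(** * Local expression of a Koszul connection *)

Section Koszul.
Context {R : realType} {n : nat} {M : manifold R n} {A : cone M}.
Local Notation Rn := 'rV[R]_n.
Implicit Types (e : chart M) (v : TM M) (X : vfield A) (Y : sect A).

Lemma sect_ext Y1 Y2 : (forall v, A v -> Y1 v = Y2 v) -> Y1 = Y2.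
Proof.
case: Y1 Y2 => [f1 s1 o1] [f2 s2 o2] /= f12.
have E : f1 = f2.
  apply/funext => v; have [Av|nA] := pselect (A v); first exact: f12.
  by rewrite o1 // o2.
by subst f2; congr Sect; exact: Prop_irrelevance.
Qed.

Lemma smooth_at_srep Y e v : A v -> cdom e (foot v) ->
  smooth_at (tcoord e v) (srep e Y).
Proof. by have /smooth_on_tloc := sect_smooth Y e; apply. Qed.

Lemma smooth_at_xrep X e v : A v -> cdom e (foot v) ->
  smooth_at (tcoord e v) (xrep e X).
Proof. by have /smooth_on_tloc := vfield_smooth X e; apply. Qed.

(** With Y1 = 0 this yields multiples of a section, and with -f in place of f it removes one term
    from a sum; the inductions on finite sums use both. *)
Lemma sect_lincomb (f : TM M -> R) Y1 Y2 : smooth_fun A f ->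
  exists Z : sect A, forall v, Z v = Y1 v + f v *: Y2 v.
Proof.
move=> /smooth_funP fs.
have sm e : smooth_on (tloc A e) (srep e (fun v => Y1 v + f v *: Y2 v)).
  apply/smooth_on_tloc => v Av ev.
  apply: (@smooth_at_eq _ _ _ _ (fun z => srep e Y1 z + (f \o tinv e) z *: srep e Y2 z)).
    by near=> z; rewrite /srep tcompD tcompZ.
  apply: smooth_atD; first exact: smooth_at_srep.
  by apply: smooth_atZ; [exact: fs | exact: smooth_at_srep].
have off v : ~ A v -> Y1 v + f v *: Y2 v = 0.
  by move=> nA; rewrite !sect_off // scaler0 addr0.
by exists (Sect sm off).
Unshelve. all: by end_near. Qed.

Lemma vfield_lincomb (f : TM M -> R) X1 X2 : smooth_fun A f ->
  exists Z : vfield A, forall v, Z v = X1 v + f v *: X2 v.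
Proof.
move=> /smooth_funP fs.
have sm e : smooth_on (tloc A e) (xrep e (fun v => X1 v + f v *: X2 v)).
  apply/smooth_on_tloc => v Av ev.
  apply: (@smooth_at_eq _ _ _ _ (fun z => xrep e X1 z + (f \o tinv e) z *: xrep e X2 z)).
    by near=> z; rewrite /xrep xcompD xcompZ.
  apply: smooth_atD (smooth_at_xrep X1 Av ev) _.
  exact: smooth_atZ (fs _ _ Av ev) (smooth_at_xrep X2 Av ev).
have off v : ~ A v -> X1 v + f v *: X2 v = 0.
  by move=> nA; rewrite !vfield_off // scaler0 addr0.
by exists (VField sm off).
Unshelve. all: by end_near. Qed.

Lemma sect0_exists : exists Z : sect A, forall v, Z v = 0.
Proof.
have sm e : smooth_on (tloc A e) (srep e (fun=> 0)).
  apply/smooth_on_tloc => v Av ev.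
  apply: (@smooth_at_eq _ _ _ _ (fun=> 0)); last exact: smooth_at_cst.
  by near=> z; rewrite /srep tcomp0.
by exists (Sect sm (fun _ _ => erefl)).
Unshelve. all: by end_near. Qed.

Lemma vfield0_exists : exists Z : vfield A, forall v, Z v = 0.
Proof.
have sm e : smooth_on (tloc A e) (xrep e (fun=> 0)).
  apply/smooth_on_tloc => v Av ev.
  apply: (@smooth_at_eq _ _ _ _ (fun=> 0)); last exact: smooth_at_cst.
  by near=> z; rewrite /xrep xcomp0.
by exists (VField sm (fun _ _ => erefl)).
Unshelve. all: by end_near. Qed.

Lemma smooth_fun_opp (f : TM M -> R) : smooth_fun A f -> smooth_fun A (fun v => - f v).
Proof.
move=> /smooth_funP fs; apply/smooth_funP => e v Av ev.
by apply: smooth_atN; exact: fs.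
Qed.

Lemma lie_chart X (f : TM M -> R) e v : smooth_fun A f -> A v -> cdom e (foot v) ->
  lie X f v = dv (f \o tinv e) (tcoord e v) (xcomp e v (X v)).
Proof.
move=> /smooth_funP fs Av ev; rewrite /lie -dvE.
have cv := chart_at_dom (foot v).
rewrite xcompE; apply: (dv_comp_eq _ (ttrans_tcoord cv ev)).
- apply: filterS (near_tcoord cv (near_cdom ev)) => z [cz zE ez].
  by rewrite /= -{1}zE ttrans_tcoord // tinvK.
- exact: smooth_at_diff (smooth_at_ttrans cv ev).
- exact: smooth_at_diff (fs _ _ Av ev).
Qed.

Section Connection.
Variable D : linconn A.

(** Over A, Y = Y + Y, so by additivity the value equals its double. *)
Lemma nabla0r X Y : (forall v, A v -> Y v = 0) -> forall v, A v -> D X Y v = 0.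
Proof.
move=> Y0 v Av.
apply: (addrI (D X Y v)); rewrite addr0 -(@nabla_addr _ _ _ _ D X Y Y Y) // => u Au.
by rewrite Y0 // addr0.
Qed.

Lemma nabla0l X Y : (forall v, A v -> X v = 0) -> forall v, A v -> D X Y v = 0.
Proof.
move=> X0 v Av.
apply: (addrI (D X Y v)); rewrite addr0 -(@nabla_addl _ _ _ _ D X X X Y) // => u Au.
by rewrite X0 // addr0.
Qed.

(** The axioms concern sums of two given sections, and the terms f_i Y_i are not sections yet. The
    head f_i Y_i and the tail Y - f_i Y_i are therefore built as sections before the induction
    hypothesis is applied to the tail. *)
Lemma nabla_sumr (I : Type) (r : seq I) (f : I -> TM M -> R) (Ys : I -> sect A) X Y v :
  (forall i, smooth_fun A (f i)) ->
  (forall u, A u -> Y u = \sum_(i <- r) f i u *: Ys i u) -> A v ->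
  D X Y v = \sum_(i <- r) (lie X (f i) v *: Ys i v + f i v *: D X (Ys i) v).
Proof.
move=> fs; elim: r Y => [|i r IH] Y YE Av.
  by rewrite big_nil nabla0r // => u /YE ->; rewrite big_nil.
have [Z0 Z0E] := sect0_exists.
have [Z1 Z1E] := sect_lincomb Z0 (Ys i) (fs i).
have [Z2 Z2E] := sect_lincomb Y (Ys i) (smooth_fun_opp (fs i)).
rewrite big_cons -(IH Z2) // => [|u Au]; last first.
  by rewrite Z2E YE // big_cons addrC addrA scaleNr addNr add0r.
rewrite (@nabla_addr _ _ _ _ D X Z1 Z2 Y) // => [|u Au]; last first.
  by rewrite Z1E Z2E Z0E add0r scaleNr addrC subrK.
congr (_ + _); apply: nabla_leibniz => // u Au.
by rewrite Z1E Z0E add0r.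
Qed.

Lemma nabla_suml (I : Type) (r : seq I) (f : I -> TM M -> R) (Xs : I -> vfield A) X Y v :
  (forall i, smooth_fun A (f i)) ->
  (forall u, A u -> X u = \sum_(i <- r) f i u *: Xs i u) -> A v ->
  D X Y v = \sum_(i <- r) f i v *: D (Xs i) Y v.
Proof.
move=> fs; elim: r X => [|i r IH] X XE Av.
  by rewrite big_nil nabla0l // => u /XE ->; rewrite big_nil.
have [Z0 Z0E] := vfield0_exists.
have [Z1 Z1E] := vfield_lincomb Z0 (Xs i) (fs i).
have [Z2 Z2E] := vfield_lincomb X (Xs i) (smooth_fun_opp (fs i)).
rewrite big_cons -(IH Z2) // => [|u Au]; last first.
  by rewrite Z2E XE // big_cons addrC addrA scaleNr addNr add0r.
rewrite (@nabla_addl _ _ _ _ D Z1 Z2 X) // => [|u Au]; last first.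
  by rewrite Z1E Z2E Z0E add0r scaleNr addrC subrK.
congr (_ + _); apply: nabla_scalel => // u Au.
by rewrite Z1E Z0E add0r.
Qed.

(* With S_k, E_j, F_j the coordinate fields multiplied by a cutoff b that is 1
   near the foot of v, the identities b^2 Y = \sum_k (b Y^k) S_k and
   b^2 X = \sum_j (b X1^j) E_j + (b X2^j) F_j hold globally. *)
Lemma nabla_formula e v : A v -> cdom e (foot v) ->
  exists C1 C2 : 'I_n -> 'I_n -> Rn, forall X Y,
    tcomp e (foot v) (D X Y v) =
    dv (srep e Y) (tcoord e v) (xcomp e v (X v)) +
    \sum_k (tcomp e (foot v) (Y v)) 0 k *:
      (\sum_j (xcomp e v (X v)).1 0 j *: C1 j k +
       \sum_j (xcomp e v (X v)).2 0 j *: C2 j k).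
Proof.
move=> Av ev; have [b [bc b1]] := cutoff_exists ev.
have bv : b (foot v) = 1 by exact: nbhs_singleton b1.
have b0 u : ~ cdom e (foot u) -> b (foot u) = 0.
  by move=> nu; exact: nbhs_singleton (bc.2 _ nu).
have cs (W : normedModType R) (c : W) : smooth_on (tloc A e) (fun=> c).
  by apply/smooth_on_tloc => *; exact: smooth_at_cst.
pose S k := projT1 (cid (sext_exists bc (cs _ (delta_mx 0 k : Rn)))).
have SE k u : A u -> cdom e (foot u) ->
    tcomp e (foot u) (S k u) = b (foot u) *: delta_mx 0 k.
  by rewrite /S; case: cid => Z /= [ZE _]; exact: ZE.
pose EF (j : 'I_n + 'I_n) := projT1 (cid (xext_exists bc (cs _
  (match j with inl i => (delta_mx 0 i : Rn, 0 : Rn) | inr i => (0, delta_mx 0 i) end)))).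
have EE j u : A u -> cdom e (foot u) ->
    xcomp e u (EF (inl j) u) = b (foot u) *: (delta_mx 0 j : Rn, 0 : Rn).
  by rewrite /EF; case: cid => Z /= [ZE _]; exact: ZE.
have FE j u : A u -> cdom e (foot u) ->
    xcomp e u (EF (inr j) u) = b (foot u) *: (0 : Rn, delta_mx 0 j : Rn).
  by rewrite /EF; case: cid => Z /= [ZE _]; exact: ZE.
pose b2 u := b (foot u) * b (foot u).
have b2s : smooth_fun A b2.
  apply/smooth_funP => e' u Au e'u.
  by apply: smooth_atM; exact: (smooth_at_cutoff bc e'u).
have b2v : b2 v = 1 by rewrite /b2 bv mulr1.
(* Being constant near the foot of v, b^2 contributes nothing to the Leibniz rule at v, so b^2 Y and
   Y have the same covariant derivative there. *)
have lie_b2 X : lie X b2 v = 0.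
  rewrite (lie_chart _ b2s Av ev) -[RHS](dv_cst (V := (Rn * Rn)%type) (1 : R) (tcoord e v) (xcomp e v (X v))).
  apply: dv_eq; last exact: differentiable_cst.
  by apply: filterS (near_tcoord ev b1) => z [_ _ bz]; rewrite /b2 /= bz mulr1.
have [Z0 Z0E] := sect0_exists; have [W0 W0E] := vfield0_exists.
exists (fun j k => tcomp e (foot v) (D (EF (inl j)) (S k) v)),
  (fun j k => tcomp e (foot v) (D (EF (inr j)) (S k) v)) => X Y.
pose f k := @fext _ _ _ A e b (fun z => srep e Y z 0 k).
have fs k : smooth_fun A (f k).
  apply: (fext_smooth bc); apply/smooth_on_tloc => u Au eu.
  by apply: smooth_at_coord; exact: smooth_at_srep.
have [Y2 Y2E] := sect_lincomb Z0 Y b2s.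
have Y2S u : A u -> Y2 u = \sum_k f k u *: S k u.
  move=> Au; rewrite Y2E Z0E add0r; have [eu|nu] := pselect (cdom e (foot u)); last first.
    by rewrite /b2 b0 // mul0r scale0r big1 // => k _; rewrite /f /fext b0 // mul0r if_same scale0r.
  apply: (can_inj (tcompK eu)); rewrite tcompZ tcomp_sum.
  rewrite {1}(row_delta (tcomp e (foot u) (Y u))) scaler_sumr.
  apply: eq_bigr => k _; rewrite tcompZ SE // /f fext_in // srep_tcoord //.
  by rewrite !scalerA /b2; congr (_ *: _); ring.
pose g j := @fext _ _ _ A e b (fun z => match j with
  | inl i => (xrep e X z).1 0 i | inr i => (xrep e X z).2 0 i end).
have gs j : smooth_fun A (g j).
  apply: (fext_smooth bc); apply/smooth_on_tloc => u Au eu.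
  have xs := smooth_at_xrep X Au eu.
  case: j => i; apply: smooth_at_coord.
    by apply: (@smooth_at_comp _ _ _ _ _ (xrep e X) fst) => //; exact: smooth_at_fst.
  by apply: (@smooth_at_comp _ _ _ _ _ (xrep e X) snd) => //; exact: smooth_at_snd.
have [X2 X2E] := vfield_lincomb W0 X b2s.
have X2S u : A u -> X2 u = \sum_j g j u *: EF j u.
  move=> Au; rewrite X2E W0E add0r; have [eu|nu] := pselect (cdom e (foot u)); last first.
    by rewrite /b2 b0 // mul0r scale0r big1 // => k _; rewrite /g /fext b0 // mul0r if_same scale0r.
  apply: (xcomp_inj eu); rewrite xcompZ xcomp_sum.
  rewrite {1}(pair_delta (xcomp e u (X u))) big_sumType /= scalerDr !scaler_sumr.
  congr (_ + _); apply: eq_bigr => k _; rewrite xcompZ.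
    by rewrite EE // /g fext_in // xrep_tcoord // !scalerA /b2; congr (_ *: _); ring.
  by rewrite FE // /g fext_in // xrep_tcoord // !scalerA /b2; congr (_ *: _); ring.
have XE Z : D X Z v = \sum_j g j v *: D (EF j) Z v.
  rewrite -(nabla_suml Z gs X2S Av) (@nabla_scalel _ _ _ _ D b2 X X2 Z) // ?b2v ?scale1r // => u Au.
  by rewrite X2E W0E add0r.
have YE : D X Y v = \sum_k (lie X (f k) v *: S k v + f k v *: D X (S k) v).
  rewrite -(nabla_sumr X fs Y2S Av) (@nabla_leibniz _ _ _ _ D b2 X Y Y2) // => [|u Au].
    by rewrite lie_b2 scale0r add0r b2v scale1r.
  by rewrite Y2E Z0E add0r.
(* Near v the cutoff is 1, so f k and g j are the components of Y and X there: the Lie derivatives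
   assemble into the derivative of Y, the other terms into the constants C1 and C2. *)
rewrite YE big_split tcompD !tcomp_sum; congr (_ + _).
  rewrite [RHS]row_delta; apply: eq_bigr => k _.
  rewrite tcompZ SE // bv scale1r; congr (_ *: _).
  have Yd := smooth_at_diff (smooth_at_srep Y Av ev).
  rewrite (lie_chart _ (fs k) Av ev) -(dv_coord _ _ Yd).
  apply: dv_eq; last exact: smooth_at_diff (smooth_at_coord _ (smooth_at_srep Y Av ev)).
  apply: filterS (near_tloc Av ev b1) => z [Az ez zE bz].
  by rewrite /f /= fext_in // bz mul1r zE.
apply: eq_bigr => k _; rewrite tcompZ; congr (_ *: _).
  by rewrite /f fext_in // bv mul1r srep_tcoord.
rewrite XE big_sumType tcompD !tcomp_sum /=.
by congr (_ + _); apply: eq_bigr => j _; rewrite tcompZ; congr (_ *: _);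
  rewrite /g fext_in // bv mul1r xrep_tcoord.
Qed.

Definition cof1 e v (j k : 'I_n) : Rn := nabla_loc D e (dx j) (@dxs R n k) v.
Definition cof2 e v (j k : 'I_n) : Rn := nabla_loc D e (dy j) (@dxs R n k) v.

Lemma srep_germ e v (Y : Rn * Rn -> Rn) Y' : A v -> cdom e (foot v) ->
  (\forall z \near tcoord e v, srep e Y' z = Y z) ->
  tcomp e (foot v) (Y' v) = Y (tcoord e v) /\
  forall w, dv (srep e Y') (tcoord e v) w = dv Y (tcoord e v) w.
Proof.
move=> Av ev YE; split=> [|w].
  by rewrite -(nbhs_singleton YE) srep_tcoord.
rewrite -(dv_eq w YE) //; exact: smooth_at_diff (smooth_at_srep Y' Av ev).
Qed.

Lemma xrep_germ e v (X : Rn * Rn -> Rn * Rn) X' : A v -> cdom e (foot v) ->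
  (\forall z \near tcoord e v, xrep e X' z = X z) ->
  xcomp e v (X' v) = X (tcoord e v).
Proof. by move=> Av ev XE; rewrite -(nbhs_singleton XE) xrep_tcoord. Qed.

(** By [nabla_formula] the value at v depends on X through its value and on Y through its value and
    differential at v, all of which are fixed by the germs. Hence the set in [nabla_loc] is a
    singleton. *)
Lemma nabla_locE e v (X : Rn * Rn -> Rn * Rn) (Y : Rn * Rn -> Rn) X' Y' : A v -> cdom e (foot v) ->
  (\forall z \near tcoord e v, xrep e X' z = X z) ->
  (\forall z \near tcoord e v, srep e Y' z = Y z) ->
  nabla_loc D e X Y v = tcomp e (foot v) (D X' Y' v).
Proof.
move=> Av ev XE YE; have [C1 [C2 CE]] := nabla_formula Av ev.
have [Y'v Y'd] := srep_germ Av ev YE; have X'v := xrep_germ Av ev XE.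
apply: xget_unique; first by exists X', Y'.
move=> u [X'' [Y'' [XE2 YE2 ->]]].
have [Y''v Y''d] := srep_germ Av ev YE2; have X''v := xrep_germ Av ev XE2.
by rewrite !CE Y'v Y''v X'v X''v Y'd Y''d.
Qed.

Lemma xgerm_exists e v (X : Rn * Rn -> Rn * Rn) : A v -> cdom e (foot v) ->
  smooth_on (tloc A e) X ->
  exists X' : vfield A, \forall z \near tcoord e v, xrep e X' z = X z.
Proof.
move=> Av ev Xs; have [b [bc b1]] := cutoff_exists ev.
have [X' [XE _]] := xext_exists bc Xs; exists X'.
apply: filterS (near_tloc Av ev b1) => z [Az ez zE bz].
by rewrite /xrep XE // bz scale1r zE.
Qed.

Lemma sgerm_exists e v (Y : Rn * Rn -> Rn) : A v -> cdom e (foot v) ->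
  smooth_on (tloc A e) Y ->
  exists Y' : sect A, \forall z \near tcoord e v, srep e Y' z = Y z.
Proof.
move=> Av ev Ys; have [b [bc b1]] := cutoff_exists ev.
have [Y' [YE _]] := sext_exists bc Ys; exists Y'.
apply: filterS (near_tloc Av ev b1) => z [Az ez zE bz].
by rewrite /srep YE // bz scale1r zE.
Qed.

Lemma smooth_on_tloc_cst (W : normedModType R) e (c : W) :
  smooth_on (tloc A e) (fun=> c).
Proof. by apply/smooth_on_tloc => *; exact: smooth_at_cst. Qed.

(** The part of D without derivatives of the section, as a function of arbitrary w and y; this
    allows its laws to be stated with no field in sight. *)
Definition conn e v (w : Rn * Rn) (y : Rn) : Rn :=
  \sum_k y 0 k *: (\sum_j w.1 0 j *: cof1 e v j k + \sum_j w.2 0 j *: cof2 e v j k).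

Lemma sum_delta (V : lmodType R) (j : 'I_n) (F : 'I_n -> V) :
  \sum_i (delta_mx 0 j : Rn) 0 i *: F i = F j.
Proof.
rewrite (bigD1 j) //= mxE !eqxx scale1r big1 ?addr0 // => i /negPf ij.
by rewrite mxE ij andbF scale0r.
Qed.

(** The constants of [nabla_formula] are identified by evaluating that formula on germs of
    coordinate fields, whose components have zero derivative. *)
Lemma nabla_local e v X Y : A v -> cdom e (foot v) ->
  tcomp e (foot v) (D X Y v) =
  dv (srep e Y) (tcoord e v) (xcomp e v (X v)) +
  conn e v (xcomp e v (X v)) (tcomp e (foot v) (Y v)).
Proof.
move=> Av ev; have [C1 [C2 CE]] := nabla_formula Av ev.
have S k := sgerm_exists Av ev (smooth_on_tloc_cst e (delta_mx 0 k : Rn)).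
have E1 j k : cof1 e v j k = C1 j k.
  have [Y' YE] := S k.
  have [X' XE] := xgerm_exists Av ev (smooth_on_tloc_cst e ((delta_mx 0 j, 0) : Rn * Rn)).
  rewrite /cof1 (nabla_locE (X' := X') (Y' := Y')) // CE.
  have [-> ->] := srep_germ Av ev YE; rewrite (xrep_germ Av ev XE) dv_cst add0r.
  rewrite sum_delta /= sum_delta big1 ?addr0 // => i _.
  by rewrite mxE scale0r.
have E2 j k : cof2 e v j k = C2 j k.
  have [Y' YE] := S k.
  have [X' XE] := xgerm_exists Av ev (smooth_on_tloc_cst e ((0, delta_mx 0 j) : Rn * Rn)).
  rewrite /cof2 (nabla_locE (X' := X') (Y' := Y')) // CE.
  have [-> ->] := srep_germ Av ev YE; rewrite (xrep_germ Av ev XE) dv_cst add0r.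
  rewrite sum_delta /= sum_delta big1 ?add0r // => i _.
  by rewrite mxE scale0r.
rewrite CE /conn; congr (_ + _); apply: eq_bigr => k _; congr (_ *: (_ + _)).
  by apply: eq_bigr => j _; rewrite E1.
by apply: eq_bigr => j _; rewrite E2.
Qed.

Lemma nabla_loc_const e v (X : Rn * Rn -> Rn * Rn) k : A v -> cdom e (foot v) ->
  smooth_on (tloc A e) X ->
  nabla_loc D e X (@dxs R n k) v = conn e v (X (tcoord e v)) (delta_mx 0 k).
Proof.
move=> Av ev Xs; have [X' XE] := xgerm_exists Av ev Xs.
have [Y' YE] := sgerm_exists Av ev (smooth_on_tloc_cst e (delta_mx 0 k : Rn)).
rewrite (nabla_locE (X' := X') (Y' := Y')) // nabla_local //.
by have [-> ->] := srep_germ Av ev YE; rewrite (xrep_germ Av ev XE) dv_cst add0r.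
Qed.

End Connection.
End Koszul.

(** * Transformation law and reconstruction from coefficients *)

Section ConnLaws.
Context {R : realType} {n : nat} {M : manifold R n} {A : cone M}.
Local Notation Rn := 'rV[R]_n.
Implicit Types (e : chart M) (v : TM M) (X : vfield A) (Y : sect A).

Lemma dv_srep_chart e e' v (Y : TM M -> Rn) w : cdom e (foot v) -> cdom e' (foot v) ->
  smooth_at (tcoord e v) (srep e Y) -> smooth_at (tcoord e' v) (srep e' Y) ->
  dv (srep e' Y) (tcoord e' v) (tjac e e' v w) =
  hess e e' (foot v) w.1 (tcomp e (foot v) (Y v)) +
  jac e e' (foot v) (dv (srep e Y) (tcoord e v) w).
Proof.
move=> ev e'v Ys Ys'.
rewrite /hess /jac /tjac.
apply: (@dv_section_change _ _ (ttrans e e') (srep e Y) (srep e' Y) (trans e e')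
  _ _ w _ _ (ttrans_tcoord ev e'v) (srep_tcoord Y ev)).
- apply: filterS (near_tcoord ev (near_cdom e'v)) => z [ez zE e'z].
  rewrite -zE ttrans_tcoord // !srep_tcoord //.
  by rewrite -[RHS]/(jac e e' _ _) jac_tcomp.
- exact: smooth_at_diff (smooth_at_ttrans ev e'v).
- exact: Ys.
- exact: smooth_at_diff Ys'.
- exact: smooth_at_trans.
Qed.

Lemma xvalue_exists e v (w : Rn * Rn) : A v -> cdom e (foot v) ->
  exists X : vfield A, xcomp e v (X v) = w.
Proof.
move=> Av ev; have [X XE] := xgerm_exists Av ev (smooth_on_tloc_cst e w).
by exists X; rewrite (xrep_germ Av ev XE).
Qed.

Lemma svalue_exists e v (y : Rn) : A v -> cdom e (foot v) ->
  exists Y : sect A, tcomp e (foot v) (Y v) = y.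
Proof.
move=> Av ev; have [Y YE] := sgerm_exists Av ev (smooth_on_tloc_cst e y).
by exists Y; have [] := srep_germ Av ev YE.
Qed.

Lemma tcoord_scale e v (lam : R) : tcoord e (tscale lam v) =
  Defs.dscale lam (tcoord e v).
Proof. by rewrite /tcoord /Defs.dscale /= tcompZ. Qed.

Lemma tjac_scale e e' v (lam : R) w : cdom e (foot v) -> cdom e' (foot v) ->
  tjac e e' (tscale lam v) (Defs.dscale lam w) = Defs.dscale lam (tjac e e' v w).
Proof.
move=> ev e'v; rewrite !tjacE // tcoord_scale /Defs.dscale /=; congr (_, _).
by rewrite scalerDr linearZ hessZr.
Qed.

Lemma xcomp_scale e v (lam : R) w : cdom e (foot v) ->
  xcomp e (tscale lam v) (Defs.dscale lam w) = Defs.dscale lam (xcomp e v w).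
Proof. by move=> ev; rewrite !xcompE tjac_scale //; exact: chart_at_dom. Qed.

Section Laws.
Variable D : linconn A.

Lemma conn_linl e v y : linear (fun w => conn D e v w y).
Proof.
move=> k a b; rewrite /conn scaler_sumr -big_split; apply: eq_bigr => i _ /=.
rewrite scalerA mulrC -scalerA -scalerDr; congr (_ *: _).
rewrite scalerDr addrACA !scaler_sumr; congr (_ + _); rewrite -big_split /=;
  by apply: eq_bigr => j _; rewrite !mxE scalerDl scalerA.
Qed.

Lemma conn_linr e v w : linear (conn D e v w).
Proof.
move=> k a b; rewrite /conn scaler_sumr -big_split; apply: eq_bigr => i _ /=.
by rewrite !mxE scalerDl scalerA.
Qed.

(** Compare [nabla_local] in the two charts for fields with values w and y at v. The derivative of Y
    acquires a Hessian by [dv_srep_chart]; since the whole expression is a vector, [conn] must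
    compensate it. *)
Lemma conn_chart e e' v w y : A v -> cdom e (foot v) -> cdom e' (foot v) ->
  conn D e' v (tjac e e' v w) (jac e e' (foot v) y) + hess e e' (foot v) w.1 y =
  jac e e' (foot v) (conn D e v w y).
Proof.
move=> Av ev e'v.
have [X XE] := xvalue_exists w Av ev; have [Y YE] := svalue_exists y Av ev.
have E := nabla_local D X Y Av e'v.
have F := dv_srep_chart w ev e'v (smooth_at_srep Y Av ev) (smooth_at_srep Y Av e'v).
rewrite -(jac_tcomp _ ev e'v) -(jac_tcomp (Y v) ev e'v) -(tjac_xcomp _ ev e'v) in E.
rewrite (nabla_local D X Y Av ev) XE YE in E; rewrite YE in F.
have alg (L : {linear Rn -> Rn}) p q r s t : L (p + q) = r + s -> r = t + L p ->
    s + t = L q.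
  by move=> + rE; rewrite rE linearD (addrC t) -addrA => /addrI ->; rewrite addrC.
exact: alg E F.
Qed.

(** One pair of global extensions represents X and Y at all points close to v, so near v the
    function is the local expression of the smooth section [D X' Y']. *)
Lemma nabla_loc_smooth e v (X : Rn * Rn -> Rn * Rn) (Y : Rn * Rn -> Rn) :
  A v -> cdom e (foot v) -> smooth_on (tloc A e) X -> smooth_on (tloc A e) Y ->
  smooth_at (tcoord e v) (fun z => nabla_loc D e X Y (tinv e z)).
Proof.
move=> Av ev Xs Ys.
have [X' /near_join XE] := xgerm_exists Av ev Xs.
have [Y' /near_join YE] := sgerm_exists Av ev Ys.
apply: smooth_at_eq (smooth_at_srep (D X' Y') Av ev).
apply: filterS (filterI (filterI XE YE) (near_tloc Av ev (near_cdom ev))).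
move=> z [[Xz Yz] [Az ez zE _]].
by rewrite -{1}zE srep_tcoord // (nabla_locE D (X' := X') (Y' := Y')) // zE.
Qed.

(** The extension of X by a cutoff of M is globally homogeneous of degree a, and that of the k-th
    coordinate section has degree 0. The same extensions represent the germs at v and at
    [tscale lam v], because these vectors have the same foot. *)
Lemma nabla_loc_hom e v (lam : R) (X : Rn * Rn) (a : R) k : A v -> cdom e (foot v) -> 0 < lam ->
  (forall m : R, 0 < m -> m `^ a *: Defs.dscale m X = X) ->
  nabla_loc D e (fun=> X) (@dxs R n k) (tscale lam v) =
  lam `^ a *: nabla_loc D e (fun=> X) (@dxs R n k) v.
Proof.
move=> Av ev l0 Xh.
have [b [bc b1]] := cutoff_exists ev.
have b0 u : ~ cdom e (foot u) -> b (foot u) = 0.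
  by move=> nu; exact: nbhs_singleton (bc.2 _ nu).
have [X' [XE X0]] := xext_exists bc (@smooth_on_tloc_cst _ _ _ A _ e X).
have [Y' [YE Y0]] := sext_exists bc (@smooth_on_tloc_cst _ _ _ A _ e (delta_mx 0 k : Rn)).
have Xg u : A u -> foot u = foot v ->
    \forall z \near tcoord e u, xrep e X' z = X.
  move=> Au uv; have eu : cdom e (foot u) by rewrite uv.
  have b1u : \forall q \near foot u, b q = 1 by rewrite uv.
  apply: filterS (near_tloc Au eu b1u) => z [Az ez zE bz].
  by rewrite /xrep XE // bz scale1r.
have Yg u : A u -> foot u = foot v ->
    \forall z \near tcoord e u, srep e Y' z = delta_mx 0 k.
  move=> Au uv; have eu : cdom e (foot u) by rewrite uv.
  have b1u : \forall q \near foot u, b q = 1 by rewrite uv.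
  apply: filterS (near_tloc Au eu b1u) => z [Az ez zE bz].
  by rewrite /srep YE // bz scale1r.
have Al : A (tscale lam v) by exact: car_conic.
rewrite (nabla_locE D Al ev (Xg _ Al erefl) (Yg _ Al erefl)).
rewrite (nabla_locE D Av ev (Xg _ Av erefl) (Yg _ Av erefl)).
have Xhom : vfield_hom a X'.
  move=> u m Au m0; have [eu|nu] := pselect (cdom e (foot u)); last first.
    by rewrite !X0 // /Defs.dscale /= !scaler0.
  have Am : A (tscale m u) by exact: car_conic.
  apply: (@xcomp_inj _ _ _ e (tscale m u) eu).
  rewrite (XE _ Am eu) xcompZ xcomp_scale // (XE _ Au eu) -[in LHS](Xh m m0).
  rewrite scalerA mulrC -scalerA; congr (_ *: _).
  by rewrite /Defs.dscale /= scalerA mulrC -scalerA.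
have Yhom : sect_hom 0 Y'.
  move=> u m Au m0; rewrite powRr0 scale1r.
  have Am : A (tscale m u) by exact: car_conic.
  have [eu|nu] := pselect (cdom e (foot u)); last by rewrite !Y0.
  by apply: (can_inj (tcompK eu)); rewrite (YE _ Am eu) YE.
by have := nabla_hom D Xhom Yhom Av l0; rewrite addr0 => ->; rewrite tcompZ.
Qed.

(** The fields d/dx^j and d/dy^j are homogeneous of degrees 0 and -1, and so are the corresponding
    coefficients. The degree -1 cancels the factor lam that [dscale] puts on the vertical component
    of w. *)
Lemma conn_hom e v (lam : R) w y : A v -> cdom e (foot v) -> 0 < lam ->
  conn D e (tscale lam v) (Defs.dscale lam w) y = conn D e v w y.
Proof.
move=> Av ev l0; apply: eq_bigr => k _; congr (_ *: (_ + _)); apply: eq_bigr => j _ /=.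
  congr (_ *: _); rewrite /cof1 -[dx j]/(fun=> (delta_mx 0 j : Rn, 0 : Rn)).
  rewrite (@nabla_loc_hom e v lam _ 0) ?powRr0 ?scale1r // => m m0.
  by rewrite powRr0 scale1r /Defs.dscale /= scaler0.
rewrite /cof2 -[dy j]/(fun=> (0 : Rn, delta_mx 0 j : Rn)).
rewrite (@nabla_loc_hom e v lam _ (-1)) => // [|m m0].
  by rewrite mxE scalerA powR_inv1 ?ltW // mulrAC mulfV ?mul1r // gt_eqF.
rewrite powR_inv1 ?ltW // /Defs.dscale /=; apply/pair_equal_spec; split => /=.
  by rewrite scaler0.
by rewrite scalerA mulVf ?scale1r // gt_eqF.
Qed.

Lemma liouville_exists : exists C : sect A, forall v, A v -> C v = vec v.
Proof.
pose C v := if `[< A v >] then vec v else 0.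
have CE v : A v -> C v = vec v by move=> Av; rewrite /C asboolT.
have sm e : smooth_on (tloc A e) (srep e C).
  apply/smooth_on_tloc => v Av ev; apply: smooth_at_eq (smooth_at_snd _).
  apply: filterS (near_tloc Av ev (near_cdom ev)) => z [Az ez zE _].
  by rewrite -{1}zE -[in RHS]zE srep_tcoord // CE.
have off v : ~ A v -> C v = 0 by move=> nA; rewrite /C asboolF.
by exists (Sect sm off).
Qed.

(** In natural coordinates the components of the Liouville field are y, whose derivative along w is
    the vertical component of w. *)
Lemma nablaCE e v w : A v -> cdom e (foot v) ->
  tcomp e (foot v) (nablaC D v w) =
  (xcomp e v w).2 + conn D e v (xcomp e v w) (tcoord e v).2.
Proof.
move=> Av ev; have [C CE] := liouville_exists.
have [X XE] := xvalue_exists w Av (chart_at_dom (foot v)).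
rewrite xcomp_chart_at in XE.
have value X' (C' : sect A) : (forall u, A u -> C' u = vec u) -> X' v = w ->
    tcomp e (foot v) (D X' C' v) =
    (xcomp e v w).2 + conn D e v (xcomp e v w) (tcoord e v).2.
  move=> C'E X'E; rewrite (nabla_local D X' C' Av ev) X'E C'E //; congr (_ + _).
  rewrite -[RHS](dv_snd (tcoord e v)); apply: dv_eq; last exact: smooth_at_diff (smooth_at_snd _).
  apply: filterS (near_tloc Av ev (near_cdom ev)) => z [Az ez zE _].
  by rewrite -[in RHS]zE -{1}zE srep_tcoord // C'E.
have -> : nablaC D v w = D X C v.
  apply: xget_unique; first by exists X, C.
  move=> u [X' [C' [C'E X'E ->]]]; apply: (can_inj (tcompK ev)).
  by rewrite !value.
exact: value.
Qed.

End Laws.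

Lemma linconn_ext (D1 D2 : linconn A) :
  (forall e v w y, A v -> cdom e (foot v) -> conn D1 e v w y = conn D2 e v w y) ->
  D1 = D2.
Proof.
move=> D12; have E : nabla D1 = nabla D2.
  apply/funext => X; apply/funext => Y; apply: sect_ext => v Av.
  have cv := chart_at_dom (foot v).
  by apply: (can_inj (tcompK cv)); rewrite !nabla_local // D12.
case: D1 D2 E {D12} => [n1 a1 b1 c1 d1 h1] [n2 a2 b2 c2 d2 h2] /= E; subst n2.
by congr LinConn; exact: Prop_irrelevance.
Qed.

Lemma dv_srepD e v (Y1 Y2 Y : sect A) w : A v -> cdom e (foot v) ->
  (forall u, A u -> Y u = Y1 u + Y2 u) ->
  dv (srep e Y) (tcoord e v) w =
  dv (srep e Y1) (tcoord e v) w + dv (srep e Y2) (tcoord e v) w.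
Proof.
move=> Av ev YE.
have d1 := smooth_at_diff (smooth_at_srep Y1 Av ev).
have d2 := smooth_at_diff (smooth_at_srep Y2 Av ev).
rewrite -(dvD _ d1 d2); apply: dv_eq; last exact: differentiableD.
apply: filterS (near_tloc Av ev (near_cdom ev)) => z [Az ez zE _].
by rewrite /srep YE // tcompD.
Qed.

Lemma dv_srepZ e v (f : TM M -> R) (Y fY : sect A) w : A v -> cdom e (foot v) ->
  smooth_fun A f -> (forall u, A u -> fY u = f u *: Y u) ->
  dv (srep e fY) (tcoord e v) w = f v *: dv (srep e Y) (tcoord e v) w +
    dv (f \o tinv e) (tcoord e v) w *: tcomp e (foot v) (Y v).
Proof.
move=> Av ev fs YE.
have d1 := smooth_at_diff ((smooth_funP _).1 fs _ _ Av ev).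
have d2 := smooth_at_diff (smooth_at_srep Y Av ev).
have := dv_scale w d1 d2; rewrite /= (tinvK ev) (srep_tcoord Y ev) => <-.
apply: dv_eq; last by have [] := is_diff_scale d1 d2.
apply: filterS (near_tloc Av ev (near_cdom ev)) => z [Az ez zE _].
by rewrite /srep /= YE // tcompZ.
Qed.

(** Differentiate Y(x, lam y) = lam^beta Y(x, y) along w; the differential of the dilation sends w
    to [dscale lam w]. *)
Lemma dv_srep_hom e v (lam beta : R) (Y : sect A) w : A v -> cdom e (foot v) ->
  0 < lam -> sect_hom beta Y ->
  dv (srep e Y) (tcoord e (tscale lam v)) (Defs.dscale lam w) =
  lam `^ beta *: dv (srep e Y) (tcoord e v) w.
Proof.
move=> Av ev l0 Yh; pose T (z : Rn * Rn) := (z.1, lam *: z.2).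
have s2 : smooth_at (tcoord e v) (fun z => lam *: z.2).
  exact: smooth_atZ (smooth_at_cst _ _) (smooth_at_snd _).
have Ts : smooth_at (tcoord e v) T by exact: smooth_at_pair (smooth_at_fst _) s2.
have TE : T (tcoord e v) = tcoord e (tscale lam v) by rewrite tcoord_scale.
have dT : dv T (tcoord e v) w = Defs.dscale lam w.
  rewrite (dv_pair _ (smooth_at_diff (smooth_at_fst _)) (smooth_at_diff s2)) dv_fst.
  by rewrite (dv_scalec _ _ (smooth_at_diff (smooth_at_snd _))) dv_snd.
have Al : A (tscale lam v) by exact: car_conic.
have Yd := smooth_at_diff (smooth_at_srep Y Av ev).
have Ydl := smooth_at_diff (smooth_at_srep Y Al (ev : cdom e (foot (tscale lam v)))).
rewrite -dT -(dv_scalec _ _ Yd); symmetry.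
apply: (dv_comp_eq _ TE _ (smooth_at_diff Ts) Ydl).
apply: filterS (near_tloc Av ev (near_cdom ev)) => z [Az ez zE _].
have -> : T z = tcoord e (tscale lam (tinv e z)) by rewrite tcoord_scale zE.
by rewrite srep_tcoord // Yh // tcompZ -[in RHS]zE srep_tcoord.
Qed.

(** * Construction of a connection from prescribed local coefficients *)

Section KoszulOf.
Variable cc : chart M -> TM M -> Rn * Rn -> Rn -> Rn.
Hypothesis cc_linl : forall e v y, linear (fun w => cc e v w y).
Hypothesis cc_linr : forall e v w, linear (cc e v w).
Hypothesis cc_smooth : forall e v (W : Rn * Rn -> Rn * Rn) (Y : Rn * Rn -> Rn),
  A v -> cdom e (foot v) ->
  smooth_at (tcoord e v) W -> smooth_at (tcoord e v) Y ->
  smooth_at (tcoord e v) (fun z => cc e (tinv e z) (W z) (Y z)).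
Hypothesis cc_hom : forall e v (lam : R) w y, A v -> cdom e (foot v) -> 0 < lam ->
  cc e (tscale lam v) (Defs.dscale lam w) y = cc e v w y.
Hypothesis cc_chart : forall e e' v w y, A v -> cdom e (foot v) -> cdom e' (foot v) ->
  cc e' v (tjac e e' v w) (jac e e' (foot v) y) + hess e e' (foot v) w.1 y =
  jac e e' (foot v) (cc e v w y).

Let kf e (X : vfield A) (Y : sect A) v : Rn :=
  dv (srep e Y) (tcoord e v) (xcomp e v (X v)) +
  cc e v (xcomp e v (X v)) (tcomp e (foot v) (Y v)).

Let nab X Y v : Rn := if `[< A v >] then kf (chart_at (foot v)) X Y v else 0.

(** The Hessian created by differentiating the components of Y is the one that [cc_chart] removes,
    so the formula written in the preferred chart holds in every chart. *)
Lemma nab_chart e X Y v : A v -> cdom e (foot v) ->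
  tcomp e (foot v) (nab X Y v) = kf e X Y v.
Proof.
move=> Av ev; rewrite /nab asboolT // /kf.
have cv := chart_at_dom (foot v).
set c := chart_at (foot v) in cv *.
have F := dv_srep_chart (xcomp c v (X v)) cv ev (smooth_at_srep Y Av cv) (smooth_at_srep Y Av ev).
have G := cc_chart (xcomp c v (X v)) (tcomp c (foot v) (Y v)) Av cv ev.
rewrite !(tjac_xcomp _ cv ev) (jac_tcomp _ cv ev) in F G.
have alg (L : {linear Rn -> Rn}) p q r s t : s + t = L q -> r = t + L p ->
    L (p + q) = r + s.
  by move=> E rE; rewrite rE linearD -E (addrC t) -addrA (addrC s).
by rewrite tcompE; exact: alg G F.
Qed.

(** [chart_at] need not vary continuously with the foot, so smoothness is read off the formula in
    the fixed chart e. *)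
Lemma nab_smooth X Y e : smooth_on (tloc A e) (srep e (nab X Y)).
Proof.
apply/smooth_on_tloc => v Av ev.
apply: (@smooth_at_eq _ _ _ _ (fun z => dv (srep e Y) z (xrep e X z) +
  cc e (tinv e z) (xrep e X z) (srep e Y z))).
  apply: filterS (near_tloc Av ev (near_cdom ev)) => z [Az ez zE _].
  rewrite [RHS](_ : _ = tcomp e (foot (tinv e z)) (nab X Y (tinv e z))) //.
  by rewrite [RHS](nab_chart X Y Az ez) /kf zE.
have Xs := smooth_at_xrep X Av ev; have Ys := smooth_at_srep Y Av ev.
apply: smooth_atD; last exact: cc_smooth.
exact: (smooth_at_dv _ (smooth_at_id _) Xs Ys).
Qed.

Lemma nab_off X Y v : ~ A v -> nab X Y v = 0.
Proof. by move=> nA; rewrite /nab asboolF. Qed.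

Let nabS X Y := Sect (nab_smooth X Y) (@nab_off X Y).

Lemma koszul_of : exists D : linconn A, forall e v w y, A v -> cdom e (foot v) ->
  conn D e v w y = cc e v w y.
Proof.
have nE X Y v : A v -> nabS X Y v = kf (chart_at (foot v)) X Y v.
  by move=> Av; rewrite /= /nab asboolT.
have cD e v w1 w2 y : cc e v (w1 + w2) y = cc e v w1 y + cc e v w2 y.
  by have := cc_linl e v y 1 w1 w2; rewrite !scale1r.
(* [linear] is one axiom on k u + v; with u = v = w and the scalar k - 1 it gives homogeneity. *)
have cZ e v k w y : cc e v (k *: w) y = k *: cc e v w y.
  by have := cc_linl e v y (k - 1) w w; rewrite !scalerBl !scale1r !subrK.
have cDr e v w y1 y2 : cc e v w (y1 + y2) = cc e v w y1 + cc e v w y2.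
  by have := cc_linr e v w 1 y1 y2; rewrite !scale1r.
have cZr e v k w y : cc e v w (k *: y) = k *: cc e v w y.
  by have := cc_linr e v w (k - 1) y y; rewrite !scalerBl !scale1r !subrK.
have addl (X1 X2 X : vfield A) (Y : sect A) :
    (forall v, A v -> X v = X1 v + X2 v) ->
    forall v, A v -> nabS X Y v = nabS X1 Y v + nabS X2 Y v.
  move=> XE v Av; rewrite !nE // /kf XE // !xcompD cD.
  by rewrite (raddfD (dv _ _)) addrACA.
have scal (f : TM M -> R) (X fX : vfield A) (Y : sect A) : smooth_fun A f ->
    (forall v, A v -> fX v = f v *: X v) ->
    forall v, A v -> nabS fX Y v = f v *: nabS X Y v.
  move=> fs XE v Av; rewrite !nE // /kf XE // !xcompZ cZ scalerDr.
  by congr (_ + _); exact: linearZ.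
have addr (X : vfield A) (Y1 Y2 Y : sect A) :
    (forall v, A v -> Y v = Y1 v + Y2 v) ->
    forall v, A v -> nabS X Y v = nabS X Y1 v + nabS X Y2 v.
  move=> YE v Av; rewrite !nE // /kf YE // tcompD cDr [RHS]addrACA; congr (_ + _).
  exact: (dv_srepD _ Av (chart_at_dom (foot v)) YE).
have leib (f : TM M -> R) (X : vfield A) (Y fY : sect A) : smooth_fun A f ->
    (forall v, A v -> fY v = f v *: Y v) ->
    forall v, A v -> nabS X fY v = lie X f v *: Y v + f v *: nabS X Y v.
  move=> fs YE v Av; have cv := chart_at_dom (foot v).
  rewrite !nE // /kf YE // tcompZ cZr scalerDr addrA; congr (_ + _).
  by rewrite (lie_chart X fs Av cv) addrC (dv_srepZ _ Av cv fs YE) tcomp_chart_at.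
have hom (alpha beta : R) (X : vfield A) (Y : sect A) :
    vfield_hom alpha X -> sect_hom beta Y -> sect_hom (alpha + beta) (nabS X Y).
  move=> Xh Yh v lam Av l0; have cv := chart_at_dom (foot v).
  have Al : A (tscale lam v) by exact: car_conic.
  rewrite (nE _ _ _ Al) (nE _ _ _ Av) /kf /= -/(tscale lam v) (Xh _ _ Av l0) (Yh _ _ Av l0).
  rewrite xcompZ (xcomp_scale _ _ cv) tcompZ cZ cZr (cc_hom _ _ Av cv l0) dvZ.
  rewrite (dv_srep_hom _ Av cv l0 Yh) !scalerA -scalerDr powRD //.
  by rewrite (gt_eqF l0) implybT.
exists (LinConn addl scal addr leib hom) => e v w y Av ev.
have [X XE] := xvalue_exists w Av ev; have [Y YE] := svalue_exists y Av ev.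
have := nabla_local (LinConn addl scal addr leib hom) X Y Av ev.
by rewrite [LHS]nab_chart // /kf XE YE => /addrI.
Qed.

End KoszulOf.
End ConnLaws.

(** * Tensors, horizontal lifts and the induced nonlinear connection *)

Section Alg.
Context {R : realType} {n : nat}.
Local Notation Rn := 'rV[R]_n.

Lemma smooth_at_det (V : normedModType R) m (x : V) (F : V -> 'M[R]_m) :
  (forall i j, smooth_at x (fun y => F y i j)) -> smooth_at x (fun y => \det (F y)).
Proof.
move=> Fs; apply: smooth_at_sum => s; apply: smooth_atM; first exact: smooth_at_cst.
by apply: smooth_at_prod => i; exact: Fs.
Qed.

(** Cramer's rule, valid near x because the determinant stays nonzero there; at a singular matrix
    [invmx] only has a default value. *)
Lemma smooth_at_invmx (V : normedModType R) m (x : V) (F : V -> 'M[R]_m) :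
  (forall i j, smooth_at x (fun y => F y i j)) -> F x \in unitmx ->
  forall i j, smooth_at x (fun y => invmx (F y) i j).
Proof.
move=> Fs Fx i j; have ds := smooth_at_det Fs.
have d0 : \det (F x) != 0 by rewrite -unitfE -unitmxE.
apply: (@smooth_at_eq _ _ _ _ (fun y => (\det (F y))^-1 *
    ((-1) ^+ (j + i) * \det (row' j (col' i (F y)))))).
  have /(_ _) := @cvgr_neq0 _ _ _ _ _ _ _ (smooth_at_cont ds) d0.
  apply: filterS => y dy; rewrite /invmx unitmxE unitfE dy !mxE.
  by rewrite /cofactor addnC.
apply: smooth_atM; first exact: smooth_atV.
apply: smooth_atM; first exact: smooth_at_cst.
apply: smooth_at_det => a b.
rewrite (_ : (fun y => _) = (fun y => F y (lift j a) (lift i b))); first exact: Fs.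
by apply/funext => y; rewrite !mxE.
Qed.

Definition bil (G : 'I_n -> 'I_n -> 'I_n -> R) (a b : Rn) : Rn :=
  \row_i \sum_j \sum_k G i j k * a 0 j * b 0 k.

Lemma bil_linl G b : linear (fun a => bil G a b).
Proof.
move=> k u v; apply/rowP => i; rewrite !mxE mulr_sumr -big_split; apply: eq_bigr => j _ /=.
rewrite mulr_sumr -big_split; apply: eq_bigr => l _ /=.
by rewrite !mxE; ring.
Qed.

Lemma bil_linr G a : linear (bil G a).
Proof.
move=> k u v; apply/rowP => i; rewrite !mxE mulr_sumr -big_split; apply: eq_bigr => j _ /=.
rewrite mulr_sumr -big_split; apply: eq_bigr => l _ /=.
by rewrite !mxE; ring.
Qed.

Lemma bilDl G a1 a2 b : bil G (a1 + a2) b = bil G a1 b + bil G a2 b.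
Proof. by have := bil_linl G b 1 a1 a2; rewrite !scale1r. Qed.

Lemma bilDr G a b1 b2 : bil G a (b1 + b2) = bil G a b1 + bil G a b2.
Proof. by have := bil_linr G a 1 b1 b2; rewrite !scale1r. Qed.

Lemma bilZl G k a b : bil G (k *: a) b = k *: bil G a b.
Proof. by have := bil_linl G b (k - 1) a a; rewrite !scalerBl !scale1r !subrK. Qed.

Lemma bilZr G k a b : bil G a (k *: b) = k *: bil G a b.
Proof. by have := bil_linr G a (k - 1) b b; rewrite !scalerBl !scale1r !subrK. Qed.

Lemma bil0l G b : bil G 0 b = 0.
Proof. by have := bilZl G 0 0 b; rewrite !scale0r. Qed.

Lemma bil_delta G i j k : bil G (delta_mx 0 j) (delta_mx 0 k) 0 i = G i j k.
Proof.
rewrite mxE (bigD1 j) //= (bigD1 k) //= !mxE !eqxx !mulr1 !big1 ?addr0 // => [l /negPf lj|l /negPf lk].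
  by rewrite big1 // => m _; rewrite mxE lj andbF mulr0 mul0r.
by rewrite mxE lk andbF mulr0.
Qed.

Lemma bilE (f : Rn -> Rn -> Rn) : (forall b, linear (fun a => f a b)) ->
  (forall a, linear (f a)) ->
  forall a b, f a b = bil (fun i j k => f (delta_mx 0 j) (delta_mx 0 k) 0 i) a b.
Proof.
move=> fl fr a b.
pose flM b := GRing.isLinear.Build _ _ _ _ _ (fl b).
pose fL b : {linear Rn -> Rn} := HB.pack (fun a => f a b) (flM b).
pose frM a := GRing.isLinear.Build _ _ _ _ _ (fr a).
pose fR a : {linear Rn -> Rn} := HB.pack (f a) (frM a).
apply/rowP => i; rewrite mxE -[f a b]/(fL b a) {1}(row_delta a) linear_sum summxE.
apply: eq_bigr => j _; rewrite linearZ mxE -[fL b _]/(fR (delta_mx 0 j) b).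
rewrite {1}(row_delta b) linear_sum summxE mulr_sumr; apply: eq_bigr => k _.
by rewrite linearZ mxE /=; ring.
Qed.

Lemma eq_bil (f g : Rn -> Rn -> Rn) :
  (forall b, linear (fun a => f a b)) -> (forall a, linear (f a)) ->
  (forall b, linear (fun a => g a b)) -> (forall a, linear (g a)) ->
  (forall j k, f (delta_mx 0 j) (delta_mx 0 k) = g (delta_mx 0 j) (delta_mx 0 k)) ->
  forall a b, f a b = g a b.
Proof.
move=> fl fr gl gr fg a b; rewrite (bilE fl fr) (bilE gl gr).
apply/rowP => i; rewrite !mxE; apply: eq_bigr => j _; apply: eq_bigr => k _.
by rewrite fg.
Qed.

Lemma eq_bil_coef G1 G2 : (forall i j k, G1 i j k = G2 i j k) -> bil G1 = bil G2.
Proof.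
move=> E; apply/funext => a; apply/funext => b; apply/rowP => i; rewrite !mxE.
by apply: eq_bigr => j _; apply: eq_bigr => k _; rewrite E.
Qed.

Lemma smooth_at_bil (V : normedModType R) (x : V) (G : V -> 'I_n -> 'I_n -> 'I_n -> R)
    (a b : V -> Rn) :
  (forall i j k, smooth_at x (fun y => G y i j k)) -> smooth_at x a -> smooth_at x b ->
  smooth_at x (fun y => bil (G y) (a y) (b y)).
Proof.
move=> Gs As Bs; apply: smooth_at_row => i; apply: smooth_at_sum => j.
apply: smooth_at_sum => k; apply: smooth_atM; last exact: smooth_at_coord.
by apply: smooth_atM; [exact: Gs | exact: smooth_at_coord].
Qed.

End Alg.

Section Coefs.
Context {R : realType} {n : nat} {M : manifold R n} {A : cone M}.
Local Notation Rn := 'rV[R]_n.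
Implicit Types (e : chart M) (v : TM M).

(** Applying the Jacobian from e' to e to the classical law leaves an identity between bilinear
    maps, which may be tested on basis vectors. In this form the law has the shape of
    [conn_chart]. *)
Lemma trans_law_bil (G : chart M -> 'I_n -> 'I_n -> 'I_n -> R) e e' p :
  cdom e p -> cdom e' p ->
  (forall i j k, G e' i j k = \sum_a dtrans e e' p i a *
     (\sum_b \sum_c dtrans e' e p b j * dtrans e' e p c k * G e a b c
      + d2trans e' e p a j k)) <->
  (forall a b, bil (G e) (jac e' e p a) (jac e' e p b) + hess e' e p a b =
     jac e' e p (bil (G e') a b)).
Proof.
move=> ep e'p.
have rhsE i j k : \sum_a dtrans e e' p i a *
     (\sum_b \sum_c dtrans e' e p b j * dtrans e' e p c k * G e a b c
      + d2trans e' e p a j k) =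
    jac e e' p (bil (G e) (jac e' e p (delta_mx 0 j)) (jac e' e p (delta_mx 0 k)) +
      hess e' e p (delta_mx 0 j) (delta_mx 0 k)) 0 i.
  rewrite jac_sum //; apply: eq_bigr => a _; rewrite [in RHS]mxE d2transE //; congr (_ * (_ + _)).
  rewrite [in RHS]mxE; apply: eq_bigr => b _; apply: eq_bigr => c _.
  by rewrite !dtransE //; ring.
split=> [GE|GE i j k]; last first.
  by rewrite rhsE GE jacK // bil_delta.
apply: eq_bil => [b k u w|a k u w|b k u w|a k u w|j k].
- by rewrite linearP bil_linl hess_linl scalerDr addrACA.
- by rewrite linearP bil_linr hess_linr // scalerDr addrACA.
- by rewrite bil_linl linearP.
- by rewrite bil_linr linearP.
rewrite -[LHS](jacK _ ep e'p); congr jac; apply/rowP => i.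
by rewrite -rhsE -GE bil_delta.
Qed.

Lemma anis_bil (G : anis A) e e' v a b : A v -> cdom e (foot v) -> cdom e' (foot v) ->
  bil (G e' v) (jac e e' (foot v) a) (jac e e' (foot v) b) + hess e e' (foot v) a b =
  jac e e' (foot v) (bil (G e v) a b).
Proof.
move=> Av ev e'v.
apply: (trans_law_bil (fun e => G e v) e'v ev).1 => i j k.
exact: anis_trans.
Qed.

Lemma anis_ext (G1 G2 : anis A) :
  (forall e v i j k, A v -> cdom e (foot v) -> G1 e v i j k = G2 e v i j k) -> G1 = G2.
Proof.
case: G1 G2 => [g1 a1 b1 c1 d1] [g2 a2 b2 c2 d2] /= E.
have {}E : g1 = g2.
  apply/funext => e; apply/funext => v; apply/funext => i; apply/funext => j.
  apply/funext => k; have [[Av ev]|nA] := pselect (A v /\ cdom e (foot v)); first exact: E.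
  by rewrite d1 // d2.
by subst g2; congr Anis; exact: Prop_irrelevance.
Qed.

Lemma tens_bil (T : tens A) e v a b : cdom e (foot v) ->
  tcomp e (foot v) (T v a b) =
  bil (tens_coef T e v) (tcomp e (foot v) a) (tcomp e (foot v) b).
Proof.
move=> ev.
rewrite -{1}(tcompK ev a) -{1}(tcompK ev b).
pose f a b := tcomp e (foot v) (T v (tvec e (foot v) a) (tvec e (foot v) b)).
rewrite -[LHS]/(f _ _) (bilE (f := f)) // => [y k u w|x k u w].
  by rewrite /f linearP tens_linl linearP.
by rewrite /f linearP tens_linr linearP.
Qed.

Lemma tens_ext (T1 T2 : tens A) :
  (forall e v i j k, A v -> cdom e (foot v) ->
    tens_coef T1 e v i j k = tens_coef T2 e v i j k) -> T1 = T2.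
Proof.
move=> E; have {}E : tens_fun T1 = tens_fun T2.
  apply/funext => v; apply/funext => a; apply/funext => b.
  have [Av|nA] := pselect (A v); last by rewrite !tens_off.
  have cv := chart_at_dom (foot v); apply: (can_inj (tcompK cv)).
  rewrite !tens_bil //; congr (_ _ _); apply: eq_bil_coef => i j k; exact: E.
case: T1 T2 E => [t1 a1 b1 c1 d1] [t2 a2 b2 c2 d2] /= E; subst t2.
by congr Tens; exact: Prop_irrelevance.
Qed.

Lemma tens_chart (T : tens A) e e' v a b : cdom e (foot v) -> cdom e' (foot v) ->
  bil (tens_coef T e' v) (jac e e' (foot v) a) (jac e e' (foot v) b) =
  jac e e' (foot v) (bil (tens_coef T e v) a b).
Proof.
move=> ev e'v; pose a0 := tvec e (foot v) a; pose b0 := tvec e (foot v) b.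
have Ja : jac e e' (foot v) a = tcomp e' (foot v) a0.
  by rewrite -{1}(tvecK ev a); exact: jac_tcomp.
have Jb : jac e e' (foot v) b = tcomp e' (foot v) b0.
  by rewrite -{1}(tvecK ev b); exact: jac_tcomp.
rewrite Ja Jb; transitivity (tcomp e' (foot v) (T v a0 b0)).
  by symmetry; exact: tens_bil.
transitivity (jac e e' (foot v) (tcomp e (foot v) (T v a0 b0))).
  by symmetry; exact: jac_tcomp.
congr (jac _ _ _ _); apply: etrans (tens_bil T a0 b0 ev) _.
by congr (bil _ _ _); exact: tvecK.
Qed.

Lemma tens_coef_scale (T : tens A) (alpha lam : R) e v i j k : tens_hom alpha T ->
  A v -> 0 < lam ->
  tens_coef T e (tscale lam v) i j k = lam `^ alpha * tens_coef T e v i j k.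
Proof. by move=> Th Av l0; rewrite /tens_coef Th // tcompZ mxE. Qed.

Lemma hatG1E (D : linconn A) e v i j k :
  hatG1 D e v i j k = conn D e v (delta_mx 0 j, 0) (delta_mx 0 k) 0 i.
Proof.
rewrite /conn sum_delta /= sum_delta big1 ?addr0 // => l _.
by rewrite mxE scale0r.
Qed.

Lemma hatG2E (D : linconn A) e v i j k :
  hatG2 D e v i j k = conn D e v (0, delta_mx 0 j) (delta_mx 0 k) 0 i.
Proof.
rewrite /conn sum_delta /= sum_delta big1 ?add0r // => l _.
by rewrite mxE scale0r.
Qed.

Lemma conn_bil (D : linconn A) e v w y :
  conn D e v w y = bil (hatG1 D e v) w.1 y + bil (hatG2 D e v) w.2 y.
Proof.
apply/rowP => i; rewrite !mxE summxE; under eq_bigr => k _.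
  rewrite mxE [X in _ * X]mxE !summxE mulrDr; over.
rewrite big_split /=; congr (_ + _); rewrite [RHS]exchange_big /=;
  apply: eq_bigr => k _; rewrite mulr_sumr; apply: eq_bigr => j _;
  rewrite mxE /hatG1 /hatG2 /cof1 /cof2; ring.
Qed.

Lemma linconn_coef_ext (D1 D2 : linconn A) :
  (forall e v i j k, A v -> cdom e (foot v) ->
    hatG1 D1 e v i j k = hatG1 D2 e v i j k /\ hatG2 D1 e v i j k = hatG2 D2 e v i j k) ->
  D1 = D2.
Proof.
move=> E; apply: linconn_ext => e v w y Av ev; rewrite !conn_bil; congr (_ + _);
  by congr (_ _ _); apply: eq_bil_coef => i j k; have [] := E e v i j k Av ev.
Qed.

Lemma smooth_at_hatG1 (D : linconn A) e v i j k : A v -> cdom e (foot v) ->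
  smooth_at (tcoord e v) (fun z => hatG1 D e (tinv e z) i j k).
Proof.
move=> Av ev; apply: (@smooth_at_coord _ _ _ _ (fun z => cof1 D e (tinv e z) j k)).
by apply: nabla_loc_smooth => //; exact: smooth_on_tloc_cst.
Qed.

Lemma smooth_at_hatG2 (D : linconn A) e v i j k : A v -> cdom e (foot v) ->
  smooth_at (tcoord e v) (fun z => hatG2 D e (tinv e z) i j k).
Proof.
move=> Av ev; apply: (@smooth_at_coord _ _ _ _ (fun z => cof2 D e (tinv e z) j k)).
by apply: nabla_loc_smooth => //; exact: smooth_on_tloc_cst.
Qed.

Lemma hatG1_scale (D : linconn A) e v (lam : R) i j k : A v -> cdom e (foot v) -> 0 < lam ->
  hatG1 D e (tscale lam v) i j k = hatG1 D e v i j k.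
Proof.
move=> Av ev l0; rewrite !hatG1E -(conn_hom D _ _ Av ev l0) /Defs.dscale /=.
by rewrite scaler0.
Qed.

Lemma hatG2_scale (D : linconn A) e v (lam : R) i j k : A v -> cdom e (foot v) -> 0 < lam ->
  hatG2 D e (tscale lam v) i j k = lam^-1 * hatG2 D e v i j k.
Proof.
move=> Av ev l0; rewrite !hatG2E -(conn_hom D _ _ Av ev l0) /Defs.dscale /=.
by rewrite !conn_bil /= !bil0l !add0r bilZl [X in _ = _ * X]mxE mulrA mulVf ?mul1r // gt_eqF.
Qed.

(** * Regularity, the horizontal lift and the parts of a connection *)

Section Horizontal.
Variable D : linconn A.

Definition hatG1_mx e v : 'M[R]_n := \matrix_(b, i) \sum_c hatG1 D e v b i c * ycoord e v c.
Definition ind_mx e v : 'M[R]_n := \matrix_(a, i) ind_coef D e v a i.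

Lemma ind_mxE e v : ind_mx e v = invmx (regmx (hatG2 D) e v) *m hatG1_mx e v.
Proof.
apply/matrixP => a i; rewrite !mxE; apply: eq_bigr => b _; rewrite mxE mulr_sumr.
by apply: eq_bigr => c _; rewrite mulrA.
Qed.

(** Vectors are rows while the upper index numbers the rows of the matrices, hence the transposes.
    By [nablaCE] the left side is the local expression of [nablaC]. *)
Lemma ker_mx e v w : w.2 + conn D e v w (tcoord e v).2 =
  w.2 *m (regmx (hatG2 D) e v)^T + w.1 *m (hatG1_mx e v)^T.
Proof.
rewrite conn_bil addrCA addrC; congr (_ + _); apply/rowP => i; rewrite !mxE.
  transitivity (\sum_j w.2 0 j * ((i == j)%:R + \sum_c hatG2 D e v i j c * ycoord e v c)).
    under [RHS]eq_bigr => j _ do rewrite mulrDr.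
    rewrite big_split /=; congr (_ + _).
      rewrite (bigD1 i) //= eqxx mulr1 big1 ?addr0 // => j /negPf ij.
      by rewrite eq_sym ij mulr0.
    apply: eq_bigr => j _; rewrite mulr_sumr; apply: eq_bigr => k _.
    by rewrite /ycoord; ring.
  by apply: eq_bigr => j _; rewrite !mxE.
apply: eq_bigr => j _; rewrite !mxE mulr_sumr; apply: eq_bigr => k _.
by rewrite /ycoord; ring.
Qed.

(** The vector a^j delta_{x^j} in natural coordinates, for the candidate components [ind_mx] of the
    nonlinear connection. *)
Definition hor_lift e v (a : Rn) : Rn * Rn := (a, - (a *m (ind_mx e v)^T)).

Lemma ker_hor e v w : regmx (hatG2 D) e v \in unitmx ->
  w.2 + conn D e v w (tcoord e v).2 = 0 <-> w = hor_lift e v w.1.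
Proof.
move=> U; have UT : (regmx (hatG2 D) e v)^T \in unitmx by rewrite unitmx_tr.
rewrite ker_mx /hor_lift ind_mxE trmx_mul trmx_inv; case: w => a b /=; split.
  move=> /eqP; rewrite addr_eq0 => /eqP E; congr (_, _).
  by rewrite mulmxA -[a *m _]opprK -E mulNmx mulmxK // opprK.
by case=> {1}->; rewrite mulNmx mulmxA mulmxKV // addNr.
Qed.

Lemma hor_linear e v : linear (hor_lift e v).
Proof.
move=> k a b; rewrite /hor_lift mulmxDl -scalemxAl opprD -scalerN.
by apply/pair_equal_spec.
Qed.

Lemma xcomp_pair e v w : cdom e (foot v) -> xcomp e v w =
  (tcomp e (foot v) w.1, hess (chart_at (foot v)) e (foot v) w.1
     (tcoord (chart_at (foot v)) v).2 + tcomp e (foot v) w.2).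
Proof. by move=> ev; rewrite xcompE tjacE ?tcompE //; exact: chart_at_dom. Qed.

Lemma hess0l e e' p b : hess e e' p 0 b = 0.
Proof.
have := hess_linl e e' p b 0 0 0; rewrite !scale0r !addr0.
by have := hess_suml e e' p 0 b => -> _; rewrite big1 // => j _; rewrite mxE scale0r.
Qed.

Lemma xcomp_vert e v u : cdom e (foot v) ->
  xcomp e v (0, u) = (0, tcomp e (foot v) u).
Proof. by move=> ev; rewrite xcomp_pair //= tcomp0 hess0l add0r. Qed.

Lemma nablaC_vert e v u : A v -> cdom e (foot v) ->
  tcomp e (foot v) (nablaC D v (0, u)) =
  tcomp e (foot v) u *m (regmx (hatG2 D) e v)^T.
Proof.
by move=> Av ev; rewrite nablaCE // xcomp_vert // ker_mx /= mul0mx addr0.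
Qed.

(** A row annihilated by the transposed matrix is the coordinate row of a vertical vector killed by
    [nablaC], hence is zero. *)
Lemma regular_unit e v : regular_conn D -> A v -> cdom e (foot v) ->
  regmx (hatG2 D) e v \in unitmx.
Proof.
move=> Dreg Av ev; rewrite -unitmx_tr -row_free_unit; apply: inj_row_free => x x0.
have h0 : nablaC D v (0, 0) = 0.
  by apply: (can_inj (tcompK ev)); rewrite nablaC_vert // tcomp0 mul0mx.
have hx : nablaC D v (0, tvec e (foot v) x) = 0.
  by apply: (can_inj (tcompK ev)); rewrite nablaC_vert // tvecK // x0 tcomp0.
have x1 := bij_inj (Dreg v Av) (etrans hx (esym h0)).
by rewrite -(tvecK ev x) x1 tcomp0.
Qed.

Lemma unit_regular :
  (forall v, A v -> regmx (hatG2 D) (chart_at (foot v)) v \in unitmx) -> regular_conn D.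
Proof.
move=> U v Av; have cv := chart_at_dom (foot v).
have UT : (regmx (hatG2 D) (chart_at (foot v)) v)^T \in unitmx by rewrite unitmx_tr U.
have E u : nablaC D v (0, u) = u *m (regmx (hatG2 D) (chart_at (foot v)) v)^T.
  by have := nablaC_vert u Av cv; rewrite !tcomp_chart_at.
exists (fun u => u *m invmx (regmx (hatG2 D) (chart_at (foot v)) v)^T) => u.
  by rewrite E mulmxK.
by rewrite E mulmxKV.
Qed.

Lemma nablaC_ker e v w : regular_conn D -> A v -> cdom e (foot v) ->
  nablaC D v w = 0 <-> xcomp e v w = hor_lift e v (xcomp e v w).1.
Proof.
move=> Dreg Av ev; rewrite -(ker_hor _ (regular_unit Dreg Av ev)) -nablaCE //.
split=> [->|E]; first by rewrite tcomp0.
by apply: (can_inj (tcompK ev)); rewrite E tcomp0.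
Qed.

(** In every chart the lift of a is the only kernel vector of [nablaC] with first component a. The
    kernel is independent of charts and first components transform by the Jacobian, so lifts
    correspond to lifts. *)
Lemma tjac_hor e e' v a : regular_conn D -> A v -> cdom e (foot v) -> cdom e' (foot v) ->
  tjac e e' v (hor_lift e v a) = hor_lift e' v (jac e e' (foot v) a).
Proof.
move=> Dreg Av ev e'v; pose u := tjac e (chart_at (foot v)) v (hor_lift e v a).
have cv := chart_at_dom (foot v).
have ue : xcomp e v u = hor_lift e v a by rewrite xcompE tjacK.
have ue' : xcomp e' v u = tjac e e' v (hor_lift e v a) by rewrite -ue tjac_xcomp.
have /(nablaC_ker _ Dreg Av e'v) : nablaC D v u = 0.
  by apply/(nablaC_ker _ Dreg Av ev); rewrite ue.
have E1 : (xcomp e' v u).1 = jac e e' (foot v) a by rewrite ue' (tjacE _ ev e'v).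
by move=> E; exact: etrans (esym ue') (etrans E (congr1 _ E1)).
Qed.

Lemma smooth_at_ycoord e v c : A v -> cdom e (foot v) ->
  smooth_at (tcoord e v) (fun z => ycoord e (tinv e z) c).
Proof.
move=> Av ev; apply: smooth_at_eq (smooth_at_coord c (smooth_at_snd (tcoord e v))).
apply: filterS (near_tloc Av ev (near_cdom ev)) => z [Az ez zE _].
by rewrite /ycoord zE.
Qed.

Lemma smooth_at_ind e v a i : regular_conn D -> A v -> cdom e (foot v) ->
  smooth_at (tcoord e v) (fun z => ind_coef D e (tinv e z) a i).
Proof.
move=> Dreg Av ev; apply: smooth_at_sum => b; apply: smooth_at_sum => c.
apply: smooth_atM; last exact: smooth_at_ycoord.
apply: smooth_atM; last exact: smooth_at_hatG1.
apply: smooth_at_invmx => [k l|]; last by rewrite tinvK // regular_unit.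
rewrite (_ : (fun y => _) = (fun y => (k == l)%:R +
    \sum_c hatG2 D e (tinv e y) k l c * ycoord e (tinv e y) c)); last first.
  by apply/funext => y; rewrite mxE.
apply: smooth_atD; first exact: smooth_at_cst.
apply: smooth_at_sum => m; apply: smooth_atM; last exact: smooth_at_ycoord.
exact: smooth_at_hatG2.
Qed.

Lemma ycoord_scale e v (lam : R) c : ycoord e (tscale lam v) c = lam * ycoord e v c.
Proof. by rewrite /ycoord tcoord_scale mxE. Qed.

(** The degree -1 of [hatG2] cancels against y in [regmx], which is thus invariant; the factor lam
    comes from the y contracted with [hatG1]. *)
Lemma ind_scale e v (lam : R) a i : A v -> cdom e (foot v) -> 0 < lam ->
  ind_coef D e (tscale lam v) a i = lam * ind_coef D e v a i.
Proof.
move=> Av ev l0; rewrite /ind_coef mulr_sumr; apply: eq_bigr => b _.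
rewrite mulr_sumr; apply: eq_bigr => c _.
have -> : regmx (hatG2 D) e (tscale lam v) = regmx (hatG2 D) e v.
  apply/matrixP => k l; rewrite !mxE; congr (_ + _); apply: eq_bigr => m _.
  rewrite hatG2_scale // ycoord_scale; field.
  by rewrite gt_eqF.
by rewrite hatG1_scale // ycoord_scale; ring.
Qed.

Lemma hor_scale e v (lam : R) a : A v -> cdom e (foot v) -> 0 < lam ->
  hor_lift e (tscale lam v) a = Defs.dscale lam (hor_lift e v a).
Proof.
move=> Av ev l0; rewrite /hor_lift /Defs.dscale /= scalerN scalemxAr; congr (_, - (_ *m _)).
by apply/matrixP => i j; rewrite !mxE ind_scale.
Qed.

Lemma hor_delta e v j a : (hor_lift e v (delta_mx 0 j)).2 0 a = - ind_coef D e v a j.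
Proof.
by rewrite /hor_lift mxE; congr (- _); rewrite -rowE !mxE.
Qed.

(** The lift is written in the preferred chart at each foot; [tjac_hor] turns its coefficients into
    [ind_coef] in any fixed chart, where smoothness can be read. *)
Lemma induced_exists : regular_conn D -> exists N : nlconn A, is_induced D N.
Proof.
move=> Dreg.
pose N v u := if `[< A v >] then hor_lift (chart_at (foot v)) v u else 0.
have NE v u : A v -> N v u = hor_lift (chart_at (foot v)) v u.
  by move=> Av; rewrite /N asboolT.
have Nlin v : linear (N v).
  rewrite /N; case: asboolP => // _; first exact: hor_linear.
  by move=> k a b; rewrite scaler0 addr0.
have Nsec v u : A v -> (N v u).1 = u by move=> Av; rewrite NE.
have Nhom v (lam : R) u : A v -> 0 < lam ->
    N (tscale lam v) u = Defs.dscale lam (N v u).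
  move=> Av l0; have Al : A (tscale lam v) by exact: car_conic.
  by rewrite !NE // hor_scale //; exact: chart_at_dom.
have Nco e v a j : A v -> cdom e (foot v) -> nl_coef N e v a j = ind_coef D e v a j.
  move=> Av ev; have cv := chart_at_dom (foot v).
  rewrite /nl_coef NE // xcompE tjac_hor // -tcompE tvecK //.
  by rewrite hor_delta opprK.
have Nsm e a j : smooth_on (tloc A e) (fun z => nl_coef N e (tinv e z) a j).
  apply/smooth_on_tloc => v Av ev; apply: smooth_at_eq (smooth_at_ind a j Dreg Av ev).
  apply: filterS (near_tloc Av ev (near_cdom ev)) => z [Az ez zE _].
  by rewrite Nco.
have Noff v u : ~ A v -> N v u = 0 by move=> nA; rewrite /N asboolF.
exists (NLConn Nlin Nsec Nhom Nsm Noff) => v Av w /=.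
have cv := chart_at_dom (foot v).
rewrite (nablaC_ker w Dreg Av cv) !xcomp_chart_at; split=> [wE|[u ->]].
  by exists w.1; rewrite NE.
by rewrite NE.
Qed.

(** N is known through its image only; as that image is the kernel of [nablaC], the value of N on
    d/dx^j is the lift of its first component. *)
Lemma induced_coef (N : nlconn A) e v a j : regular_conn D -> is_induced D N ->
  A v -> cdom e (foot v) -> nl_coef N e v a j = ind_coef D e v a j.
Proof.
move=> Dreg NI Av ev; set u := dvec e (foot v) j.
have /(nablaC_ker _ Dreg Av ev) E : nablaC D v (N v u) = 0.
  by apply/(NI v Av); exists u.
rewrite /nl_coef -/u E; have -> : (xcomp e v (N v u)).1 = delta_mx 0 j.
  by rewrite xcomp_pair //= nl_section // tvecK.
by rewrite hor_delta opprK.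
Qed.

Lemma nabla_loc_deltax (N : nlconn A) e v i j k : A v -> cdom e (foot v) ->
  (nabla_loc D e (deltax N e j) (@dxs R n k) v) 0 i =
  hatG1 D e v i j k - \sum_b nl_coef N e v b j * hatG2 D e v i b k.
Proof.
move=> Av ev; rewrite nabla_loc_const //; last first.
  apply/smooth_on_tloc => u Au eu; apply: smooth_at_pair; first exact: smooth_at_cst.
  apply: smooth_atN; apply: smooth_at_row => a.
  by have /smooth_on_tloc := nl_smooth N e a j; apply.
rewrite conn_bil mxE /= bil_delta tinvK //; congr (_ + _).
rewrite mxE -sumrN; apply: eq_bigr => b _.
rewrite (bigD1 k) //= !mxE !eqxx mulr1 big1 ?addr0 => [|l /negPf lk]; last first.
  by rewrite !mxE lk andbF mulr0.
by rewrite mulrN mulrC.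
Qed.

Lemma hpart_exists : regular_conn D -> exists G : anis A,
  forall e v i j k, A v -> cdom e (foot v) ->
  G e v i j k = hatG1 D e v i j k - \sum_b ind_coef D e v b j * hatG2 D e v i b k.
Proof.
move=> Dreg.
pose g e v i j k := hatG1 D e v i j k - \sum_b ind_coef D e v b j * hatG2 D e v i b k.
pose G e v i j k := if `[< A v /\ cdom e (foot v) >] then g e v i j k else 0.
have GE e v i j k : A v -> cdom e (foot v) -> G e v i j k = g e v i j k.
  by move=> Av ev; rewrite /G asboolT.
(* The horizontal part is [conn] evaluated on lifts. The lift of a has first component a, so the
   Hessian in [conn_chart] is the one in the Christoffel law. *)
have gE e v a b : bil (g e v) a b = conn D e v (hor_lift e v a) b.
  rewrite (bilE (f := fun a b => conn D e v (hor_lift e v a) b)).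
  - congr (bil _ a b); apply/funext => i; apply/funext => j; apply/funext => k.
    rewrite conn_bil mxE /= bil_delta; congr (_ + _).
    rewrite mxE -sumrN; apply: eq_bigr => l _.
    rewrite (bigD1 k) //= [X in _ = _ * X + _]mxE !eqxx mulr1 hor_delta big1 ?addr0.
      by rewrite mulrN mulrC.
    by move=> m /negPf mk; rewrite [X in _ * X]mxE mk andbF mulr0.
  - by move=> y k u w; rewrite hor_linear conn_linl.
  - by move=> x k u w; rewrite conn_linr.
have Gsm e i j k : smooth_on (tloc A e) (fun z => G e (tinv e z) i j k).
  apply/smooth_on_tloc => v Av ev.
  apply: (@smooth_at_eq _ _ _ _ (fun z => g e (tinv e z) i j k)).
    apply: filterS (near_tloc Av ev (near_cdom ev)) => z [Az ez zE _].
    by rewrite GE.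
  apply: smooth_atB; first exact: smooth_at_hatG1.
  apply: smooth_at_sum => b; apply: smooth_atM; first exact: smooth_at_ind.
  exact: smooth_at_hatG2.
have Ghom e v (lam : R) i j k : A v -> cdom e (foot v) -> 0 < lam ->
    G e (tscale lam v) i j k = G e v i j k.
  move=> Av ev l0; have Al : A (tscale lam v) by exact: car_conic.
  rewrite !GE // /g hatG1_scale //; congr (_ - _); apply: eq_bigr => b _.
  (* The degrees 1 of [ind_coef] and -1 of [hatG2] cancel. *)
  rewrite ind_scale // hatG2_scale //; field.
  by rewrite gt_eqF.
have Goff e v i j k : ~ (A v /\ cdom e (foot v)) -> G e v i j k = 0.
  by move=> nA; rewrite /G asboolF.
have GEf e v : A v -> cdom e (foot v) -> G e v = g e v.
  by move=> Av ev; do 3!apply/funext => ?; exact: GE.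
have gD e v i j k : g e v i j k =
  hatG1 D e v i j k - \sum_b ind_coef D e v b j * hatG2 D e v i b k by [].
clearbody G g.
have Gtr e e' v i j k : A v -> cdom e (foot v) -> cdom e' (foot v) ->
    G e' v i j k = \sum_a dtrans e e' (foot v) i a *
        (\sum_b \sum_c dtrans e' e (foot v) b j * dtrans e' e (foot v) c k
                       * G e v a b c + d2trans e' e (foot v) a j k).
  move=> Av ev e'v; move: i j k; apply/(trans_law_bil (fun e => G e v) ev e'v) => a b.
  rewrite (GEf _ _ Av ev) (GEf _ _ Av e'v) !gE -(tjac_hor _ Dreg Av e'v ev).
  exact: (conn_chart D (hor_lift e' v a) b Av e'v ev).
by exists (Anis Gsm Ghom Gtr Goff) => e v i j k Av ev; rewrite -gD -GE.
Qed.

(** A vertical w has zero first component, so the Hessian term of [conn_chart] vanishes and the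
    vertical coefficients transform as a tensor. *)
Lemma vpart_exists : exists T : tens A, tens_hom (-1) T /\ is_vpart D T.
Proof.
pose T v u w := if `[< A v >] then conn D (chart_at (foot v)) v (0, u) w else 0.
have TE v u w : A v -> T v u w = conn D (chart_at (foot v)) v (0, u) w.
  by move=> Av; rewrite /T asboolT.
have Tl v w : linear (fun u => T v u w).
  rewrite /T; case: asboolP => _ k a b; last by rewrite scaler0 addr0.
  by rewrite !conn_bil /= !bil0l !add0r bil_linl.
have Tr v u : linear (T v u).
  rewrite /T; case: asboolP => _ k a b; last by rewrite scaler0 addr0.
  exact: conn_linr.
have Tco e v i j k : A v -> cdom e (foot v) -> tens_coef T e v i j k = hatG2 D e v i j k.
  move=> Av ev; have cv := chart_at_dom (foot v).
  rewrite /tens_coef TE // tcompE -conn_chart //= hess0l addr0 hatG2E -!tcompE.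
  by rewrite -xcompE xcomp_vert // !tvecK.
have Tsm e i j k : smooth_on (tloc A e) (fun z => tens_coef T e (tinv e z) i j k).
  apply/smooth_on_tloc => v Av ev; apply: smooth_at_eq (smooth_at_hatG2 D i j k Av ev).
  apply: filterS (near_tloc Av ev (near_cdom ev)) => z [Az ez zE _].
  by rewrite Tco.
have Toff v u w : ~ A v -> T v u w = 0 by move=> nA; rewrite /T asboolF.
exists (Tens Tl Tr Tsm Toff); split=> // v lam u w Av l0 /=.
have Al : A (tscale lam v) by exact: car_conic.
rewrite !TE //= -(conn_hom D _ _ Av (chart_at_dom _) l0) /Defs.dscale /=.
rewrite !conn_bil /= !bil0l !add0r bilZl scalerA powR_inv1 ?ltW // mulVf ?scale1r //.
by rewrite gt_eqF.
Qed.

End Horizontal.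

End Coefs.

(** * The correspondence *)

Section Build.
Context {R : realType} {n : nat} {M : manifold R n} {A : cone M}.
Local Notation Rn := 'rV[R]_n.
Implicit Types (e : chart M) (v : TM M).

Lemma linconn_of (G : anis A) (T : tens A) : tens_hom (-1) T ->
  exists D : linconn A, forall e v, A v -> cdom e (foot v) ->
    (forall i j k, hatG1 D e v i j k = G e v i j k +
       \sum_b (\sum_c G e v b j c * ycoord e v c) * tens_coef T e v i b k) /\
    (forall i j k, hatG2 D e v i j k = tens_coef T e v i j k).
Proof.
move=> Th.
(* [vert] is the vertical projection along N = Gamma y, so w = w.1^j delta_{x^j} + [vert]; the
   connection sought acts by Gamma on the first summand and by T on the second. *)
pose vert e v (w : Rn * Rn) := w.2 + bil (G e v) w.1 (tcoord e v).2.
pose cc e v (w : Rn * Rn) y := bil (G e v) w.1 y + bil (tens_coef T e v) (vert e v w) y.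
have vertD e v w1 w2 : vert e v (w1 + w2) = vert e v w1 + vert e v w2.
  by rewrite /vert /= bilDl addrACA.
have vertZ e v k w : vert e v (k *: w) = k *: vert e v w.
  by rewrite /vert /= bilZl scalerDr.
have ccl e v y : linear (fun w => cc e v w y).
  by move=> k w1 w2; rewrite /cc vertD vertZ bilDl bilZl bilDl bilZl scalerDr addrACA.
have ccr e v w : linear (cc e v w).
  by move=> k y1 y2; rewrite /cc !bilDr !bilZr scalerDr addrACA.
have ccs e v (W : Rn * Rn -> Rn * Rn) (Y : Rn * Rn -> Rn) :
    A v -> cdom e (foot v) -> smooth_at (tcoord e v) W -> smooth_at (tcoord e v) Y ->
    smooth_at (tcoord e v) (fun z => cc e (tinv e z) (W z) (Y z)).
  move=> Av ev Ws Ys.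
  have W1 : smooth_at (tcoord e v) (fun z => (W z).1).
    by apply: (@smooth_at_comp _ _ _ _ _ W fst) => //; exact: smooth_at_fst.
  have W2 : smooth_at (tcoord e v) (fun z => (W z).2).
    by apply: (@smooth_at_comp _ _ _ _ _ W snd) => //; exact: smooth_at_snd.
  have Gs i j k : smooth_at (tcoord e v) (fun z => G e (tinv e z) i j k).
    by have /smooth_on_tloc := anis_smooth G e i j k; apply.
  have Ts i j k : smooth_at (tcoord e v) (fun z => tens_coef T e (tinv e z) i j k).
    by have /smooth_on_tloc := tens_smooth T e i j k; apply.
  apply: smooth_atD; apply: smooth_at_bil => //.
  apply: smooth_atD => //; apply: smooth_at_bil => //.
  apply: smooth_at_eq (smooth_at_snd (tcoord e v)).
  by apply: filterS (near_tloc Av ev (near_cdom ev)) => z [Az ez zE _]; rewrite zE.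
have cch e v (lam : R) w y : A v -> cdom e (foot v) -> 0 < lam ->
    cc e (tscale lam v) (Defs.dscale lam w) y = cc e v w y.
  move=> Av ev l0; have GE : bil (G e (tscale lam v)) = bil (G e v).
    by apply: eq_bil_coef => i j k; exact: anis_hom.
  rewrite /cc /vert GE tcoord_scale /Defs.dscale /= bilZr -scalerDr bilZl; congr (_ + _).
  apply/rowP => i; rewrite !mxE mulr_sumr; apply: eq_bigr => j _.
  rewrite mulr_sumr; apply: eq_bigr => k _.
  rewrite (tens_coef_scale _ _ _ _ Th Av l0) powR_inv1 ?ltW // -!mulrA mulVKf //.
  by rewrite gt_eqF.
have ccc e e' v w y : A v -> cdom e (foot v) -> cdom e' (foot v) ->
    cc e' v (tjac e e' v w) (jac e e' (foot v) y) + hess e e' (foot v) w.1 y =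
    jac e e' (foot v) (cc e v w y).
  move=> Av ev e'v.
  have JD a b : jac e e' (foot v) (a + b) = jac e e' (foot v) a + jac e e' (foot v) b.
    exact: linearD.
  (* The Hessian at (w.1, y) that [tjacE] adds to the vertical component is absorbed by the
     Christoffel law of Gamma at the same pair, so [vert] transforms by the Jacobian. *)
  have vE : vert e' v (tjac e e' v w) = jac e e' (foot v) (vert e v w).
    rewrite /vert (tjacE _ ev e'v) /=.
    have -> : tcomp e' (foot v) (vec v) = jac e e' (foot v) (tcomp e (foot v) (vec v)).
      by rewrite jac_tcomp.
    rewrite JD -(anis_bil G w.1 _ Av ev e'v).
    by rewrite addrAC [RHS]addrC (addrC (hess _ _ _ _ _)).
  have j1 : (tjac e e' v w).1 = jac e e' (foot v) w.1 by rewrite (tjacE _ ev e'v).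
  rewrite /cc JD vE j1 -(anis_bil G w.1 y Av ev e'v) addrAC; congr (_ + _ + _).
  exact: (tens_chart T (vert e v w) y ev e'v).
have [D DE] := koszul_of ccl ccr ccs cch ccc.
exists D => e v Av ev; split=> i j k.
  rewrite hatG1E DE // /cc mxE bil_delta; congr (_ + _).
  rewrite /vert /= add0r mxE; apply: eq_bigr => b _.
  rewrite (bigD1 k) //= [X in _ * X + _]mxE !eqxx mulr1 big1 ?addr0; last first.
    by move=> m /negPf mk; rewrite [X in _ * X]mxE mk andbF mulr0.
  rewrite mulrC; congr (_ * _); rewrite mxE (bigD1 j) //= [X in _ + X]big1 ?addr0.
    by apply: eq_bigr => c _; rewrite mxE !eqxx mulr1.
  by move=> m /negPf mj; rewrite big1 // => c _; rewrite mxE mj andbF mulr0 mul0r.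
by rewrite hatG2E DE // /cc /vert /= !bil0l addr0 add0r bil_delta.
Qed.

Lemma tens0_exists : exists T : tens A, forall v u w, T v u w = 0.
Proof.
have Tl v w : linear (fun u : Rn => (0 : Rn)) by move=> k a b; rewrite scaler0 addr0.
have Tsm e i j k : smooth_on (tloc A e)
    (fun z => tens_coef (fun (_ : TM M) _ _ => 0) e (tinv e z) i j k).
  apply/smooth_on_tloc => v Av ev; apply: smooth_at_eq (smooth_at_cst _ 0).
  by near=> z; rewrite /tens_coef tcomp0 mxE.
by exists (@Tens _ _ _ A (fun _ _ _ => 0) (fun v w => Tl _ v w) (fun v w => Tl _ v w) Tsm
  (fun _ _ _ _ => erefl)).
Unshelve. all: by end_near. Qed.

(** For Delta = 0 the matrix of regularity is the identity, so the induced nonlinear connection is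
    Gamma y itself. *)
Lemma linconn_rho (G : anis A) : exists D : linconn A, regular_conn D /\
  forall e v, A v -> cdom e (foot v) -> forall i j k,
    [/\ hatG1 D e v i j k = G e v i j k, hatG2 D e v i j k = 0 &
        ind_coef D e v i j = \sum_c G e v i j c * ycoord e v c].
Proof.
have [T T0] := tens0_exists.
have Tc e v i j k : tens_coef T e v i j k = 0 by rewrite /tens_coef T0 tcomp0 mxE.
have Th : tens_hom (-1) T by move=> v lam u w _ _; rewrite !T0 scaler0.
have [D DE] := linconn_of G Th; exists D.
have G2 e v i j k : A v -> cdom e (foot v) -> hatG2 D e v i j k = 0.
  by move=> Av ev; have [_ ->] := DE e v Av ev.
have G1 e v i j k : A v -> cdom e (foot v) -> hatG1 D e v i j k = G e v i j k.
  move=> Av ev; have [-> _] := DE e v Av ev.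
  by rewrite big1 ?addr0 // => b _; rewrite Tc mulr0.
have RE e v : A v -> cdom e (foot v) -> regmx (hatG2 D) e v = 1%:M.
  move=> Av ev; apply/matrixP => i j; rewrite !mxE big1 ?addr0 // => c _.
  by rewrite G2 // mul0r.
split.
  by apply: unit_regular => v Av; rewrite RE ?unitmx1 //; exact: chart_at_dom.
move=> e v Av ev i j k; split; [exact: G1 | exact: G2 |].
rewrite /ind_coef RE // invmx1 (bigD1 i) //= [X in _ + X]big1 ?addr0.
  by apply: eq_bigr => c _; rewrite mxE eqxx mul1r G1.
by move=> b /negPf bi; rewrite big1 // => c _; rewrite mxE eq_sym bi !mul0r.
Qed.

(** The nonlinear connection underlying Gamma is obtained as the one induced by the image of Gamma
    under rho. *)
Lemma nl_of_exists (G : anis A) : exists N : nlconn A, is_nl_of G N.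
Proof.
have [D [Dreg DE]] := linconn_rho G; have [N NI] := induced_exists Dreg.
exists N => e v i j Av ev; rewrite (induced_coef _ _ Dreg NI Av ev).
by have [_ _] := DE e v Av ev i j i.
Qed.

(* In matrix form, with Q = Delta y: hatG1 y = (1 + Q)(Gamma y), so that the
   induced nonlinear connection (1 + Q)^-1 (hatG1 y) is Gamma y. *)
Lemma ind_of_hpart (D : linconn A) (g : 'I_n -> 'I_n -> 'I_n -> R) e v :
  regmx (hatG2 D) e v \in unitmx ->
  (forall i j k, hatG1 D e v i j k = g i j k +
     \sum_b (\sum_c g b j c * ycoord e v c) * hatG2 D e v i b k) ->
  forall a i, ind_coef D e v a i = \sum_c g a i c * ycoord e v c.
Proof.
move=> U gE; pose gm : 'M[R]_n := \matrix_(a, i) \sum_c g a i c * ycoord e v c.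
have E : hatG1_mx D e v = regmx (hatG2 D) e v *m gm.
  apply/matrixP => a i; rewrite !mxE.
  under eq_bigr => c _ do rewrite gE mulrDl mulr_suml.
  under [RHS]eq_bigr => b _ do rewrite !mxE mulrDl mulr_suml.
  rewrite !big_split /=; congr (_ + _).
    rewrite [RHS](bigD1 a) //= eqxx mul1r [X in _ + X]big1 ?addr0 // => b /negPf ba.
    by rewrite eq_sym ba mul0r.
  rewrite exchange_big /=; apply: eq_bigr => b _; apply: eq_bigr => c _; ring.
move=> a i; have := ind_mxE D e v; rewrite E mulKmx // => /matrixP/(_ a i).
by rewrite !mxE.
Qed.

(* With P = hatG1 y and ind = (1 + Q)^-1 P: P - Q ind = ind. *)
Lemma ind_of_jm (D : linconn A) e v a i : regmx (hatG2 D) e v \in unitmx ->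
  ind_coef D e v a i = \sum_c (hatG1 D e v a i c -
    \sum_b ind_coef D e v b i * hatG2 D e v a b c) * ycoord e v c.
Proof.
move=> U; have : hatG1_mx D e v = regmx (hatG2 D) e v *m ind_mx D e v.
  by rewrite ind_mxE mulKVmx.
move=> /matrixP/(_ a i); rewrite !mxE.
under [RHS]eq_bigr => b _ do rewrite !mxE mulrDl mulr_suml.
rewrite big_split /= [X in _ = X + _](bigD1 a) //= eqxx mul1r [X in _ + X + _]big1 ?addr0; last first.
  by move=> b /negPf ba; rewrite eq_sym ba mul0r.
move=> /eqP; rewrite -subr_eq => /eqP <-.
under [RHS]eq_bigr => c _ do rewrite mulrBl mulr_suml.
rewrite sumrB; congr (_ - _); rewrite exchange_big /=.
by apply: eq_bigr => b _; apply: eq_bigr => c _; ring.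
Qed.

End Build.

Lemma regmx_eq {R : realType} {n : nat} {M : manifold R n}
    (S1 S2 : chart M -> TM M -> 'I_n -> 'I_n -> 'I_n -> R) e v :
  (forall i j k, S1 e v i j k = S2 e v i j k) -> regmx S1 e v = regmx S2 e v.
Proof.
move=> E; apply/matrixP => i j; rewrite !mxE; congr (_ + _).
by apply: eq_bigr => c _; rewrite E.
Qed.

Lemma sval_inj (T : Type) (P : T -> Prop) : injective (@sval T P).
Proof.
move=> [x px] [y py] /= xy; subst y; congr exist; exact: Prop_irrelevance.
Qed.

Theorem theorem8 (R : realType) (n : nat) (M : manifold R n) (A : cone M) :
  exists jm : reglin A -> anis A,
    (* jm is well defined by the nonlinear connection induced by D *)
    [/\ forall D : reglin A,
          [/\ exists N : nlconn A, is_induced (sval D) N,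
              forall N : nlconn A, is_induced (sval D) N ->
                (forall e v a i, A v -> cdom e (foot v) ->
                   nl_coef N e v a i = ind_coef (sval D) e v a i) /\
                is_hpart N (sval D) (jm D)
            & forall e v, A v -> cdom e (foot v) ->
                regmx (hatG2 (sval D)) e v \in unitmx /\
                forall i j k,
                  jm D e v i j k = hatG1 (sval D) e v i j k
                    - \sum_b ind_coef (sval D) e v b j
                             * hatG2 (sval D) e v i b k],
    (* (i) *)
        (exists (rho : anis A -> linconn A)
                (hreg : forall G, regular_conn (rho G)),
           (forall G D, is_rho G D <-> D = rho G) /\
           (forall G, jm (exist _ (rho G) (hreg G)) = G)) /\
        (forall G : anis A, exists D : reglin A, jm D = G)
    (* (ii) *)
      & exists (Phi : reglin A -> anis A * invtens A)
               (Psi : anis A * invtens A -> reglin A),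
          [/\ cancel Phi Psi,
              cancel Psi Phi,
              forall D, (Phi D).1 = jm D /\
                        is_vpart (sval D) (sval (Phi D).2)
            & forall (G : anis A) (T : invtens A),
                (exists N : nlconn A, is_nl_of G N) /\
                (forall N : nlconn A, is_nl_of G N ->
                   forall D : linconn A,
                     corresponds N D G (sval T) <-> D = sval (Psi (G, T)))]].
Proof.
(* Choosing witnesses here and below is harmless: their coefficients over A are prescribed, and the
   extensionality lemmas make objects with equal coefficients equal. *)
have hp (D : reglin A) := cid (hpart_exists (svalP D)).
pose jm D := projT1 (hp D).
have jmE D : forall e v i j k, A v -> cdom e (foot v) -> jm D e v i j k =
    hatG1 (sval D) e v i j k - \sum_b ind_coef (sval D) e v b j * hatG2 (sval D) e v i b k.
  exact: projT2 (hp D).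
have rhoP (G : anis A) := cid (linconn_rho G).
pose rho G := projT1 (rhoP G).
have rho_reg G : regular_conn (rho G) by have [] := projT2 (rhoP G).
have rhoE G e v i j k : A v -> cdom e (foot v) ->
    hatG1 (rho G) e v i j k = G e v i j k /\ hatG2 (rho G) e v i j k = 0.
  by move=> Av ev; have [_ /(_ e v Av ev i j k)[]] := projT2 (rhoP G).
have jm_rho G (r : regular_conn (rho G)) : jm (exist _ (rho G) r) = G.
  apply: anis_ext => e v i j k Av ev; rewrite jmE //=.
  have [-> _] := rhoE G e v i j k Av ev.
  rewrite big1 ?subr0 // => b _.
  by have [_ ->] := rhoE G e v i b k Av ev; rewrite mulr0.
have mkP (G : anis A) (T : invtens A) := cid (linconn_of G (svalP T).1).
pose mk G T := projT1 (mkP G T).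
have mkE1 G T e v i j k : A v -> cdom e (foot v) -> hatG1 (mk G T) e v i j k =
    G e v i j k + \sum_b (\sum_c G e v b j c * ycoord e v c) * tens_coef (sval T) e v i b k.
  by move=> Av ev; have [-> _] := projT2 (mkP G T) e v Av ev.
have mkE2 G T e v i j k : A v -> cdom e (foot v) ->
    hatG2 (mk G T) e v i j k = tens_coef (sval T) e v i j k.
  by move=> Av ev; have [_ ->] := projT2 (mkP G T) e v Av ev.
have mk_unit G (T : invtens A) e v : A v -> cdom e (foot v) ->
    regmx (hatG2 (mk G T)) e v \in unitmx.
  move=> Av ev; rewrite (@regmx_eq _ _ _ _ (tens_coef (sval T))) => [|i j k].
    exact: (svalP T).2.
  exact: mkE2.
have mk_reg G T : regular_conn (mk G T).
  by apply: unit_regular => v Av; apply: mk_unit => //; exact: chart_at_dom.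
have vpP (D : reglin A) := cid (vpart_exists (sval D)).
have vp_inv (D : reglin A) : tens_hom (-1) (projT1 (vpP D)) /\
    forall e v, A v -> cdom e (foot v) ->
      regmx (tens_coef (projT1 (vpP D))) e v \in unitmx.
  have [Th TE] := projT2 (vpP D); split=> // e v Av ev.
  rewrite (@regmx_eq _ _ _ _ (hatG2 (sval D))) => [|i j k]; last exact: TE.
  exact: regular_unit (svalP D) Av ev.
have vpE (D : reglin A) : is_vpart (sval D) (projT1 (vpP D)).
  by have [] := projT2 (vpP D).
exists jm; split.
- move=> D; split.
  + exact: induced_exists (svalP D).
  + move=> N NI; split=> [e v a i Av ev|e v i j k Av ev].
      exact: induced_coef (svalP D) NI Av ev.
    rewrite nabla_loc_deltax // jmE //; congr (_ - _); apply: eq_bigr => b _.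
    by rewrite (induced_coef _ _ (svalP D) NI Av ev).
  + move=> e v Av ev; split; first exact: regular_unit (svalP D) Av ev.
    by move=> i j k; exact: jmE.
- split; last by move=> G; exists (exist _ (rho G) (rho_reg G)).
  exists rho, rho_reg; split=> // G D; split=> [DG|-> e v i j k]; last exact: rhoE.
  apply: linconn_coef_ext => e v i j k Av ev.
  by have [-> ->] := DG e v i j k Av ev; have [-> ->] := rhoE G e v i j k Av ev.
exists (fun D => (jm D, exist _ (projT1 (vpP D)) (vp_inv D))),
  (fun GT => exist _ (mk GT.1 GT.2) (mk_reg GT.1 GT.2)).
split.
(* The correction that [mk] adds, with N = Gamma y, is the one that [jm] subtracted, with the
   induced N: this is [ind_of_jm]. *)
- move=> D; apply: sval_inj; apply: linconn_coef_ext => e v i j k Av ev /=.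
  have DU := regular_unit (svalP D) Av ev.
  rewrite mkE1 // mkE2 //= vpE //; split=> //; rewrite jmE //.
  rewrite -[RHS](subrK (\sum_b ind_coef (sval D) e v b j * hatG2 (sval D) e v i b k)).
  congr (_ + _); apply: eq_bigr => b _; rewrite vpE //; congr (_ * _).
  by rewrite [RHS](ind_of_jm b j DU); apply: eq_bigr => c _; rewrite jmE.
- move=> [G T]; congr (_, _).
    apply: anis_ext => e v i j k Av ev; rewrite jmE //= mkE1 //.
    rewrite -[RHS](addrK (\sum_b (\sum_c G e v b j c * ycoord e v c) *
      tens_coef (sval T) e v i b k)); congr (_ - _).
    (* [jm] subtracts with the connection induced by [mk G T], which [ind_of_hpart] identifies with
       Gamma y. *)
    apply: eq_bigr => b _; rewrite mkE2 //; congr (_ * _); apply: ind_of_hpart; first exact: mk_unit.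
    move=> {}i {}j {}k; rewrite mkE1 //; congr (_ + _).
    by apply: eq_bigr => l _; rewrite mkE2.
  apply: sval_inj; apply: tens_ext => e v i j k Av ev /=.
  by rewrite vpE //= mkE2.
- by move=> D; split=> //; exact: vpE.
move=> G T; split; first exact: nl_of_exists.
move=> N NG D /=.
have NE e v i j k : A v -> cdom e (foot v) ->
    \sum_b nl_coef N e v b j * tens_coef (sval T) e v i b k =
    \sum_b (\sum_c G e v b j c * ycoord e v c) * tens_coef (sval T) e v i b k.
  by move=> Av ev; apply: eq_bigr => b _; rewrite NG.
(* Given N = Gamma y and the vertical part, the equation Gamma = [hatG1] - N [hatG2] is solved for
   [hatG1], and the solution is the coefficient prescribed for [mk]. *)
split=> [[DG DT]|->].
  apply: linconn_coef_ext => e v i j k Av ev.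
  rewrite mkE1 // mkE2 // -DT //; split=> //.
  rewrite -NE // DG // nabla_loc_deltax // -addrA [X in _ + X]addrC.
  rewrite (eq_bigr (fun b => nl_coef N e v b j * hatG2 D e v i b k)) ?subrr ?addr0 //.
  by move=> b _; rewrite DT.
split=> e v i j k Av ev; last by rewrite mkE2.
rewrite nabla_loc_deltax // mkE1 // -NE //.
rewrite [X in _ - X](eq_bigr (fun b => nl_coef N e v b j * tens_coef (sval T) e v i b k)).
  by rewrite addrK.
by move=> b _; rewrite mkE2.
Qed.
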